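(* There exist constants $C_0,\varepsilon_0,\nu_0>0$ with the following property: for every $k\in\mathbb{S}^2$, every $\nu$ with $0<\nu<\nu_0$ and every $\psi^{in}\in L^2(\mathbb{S}^2)$, the advection-diffusion evolution satisfies for all $t\ge0$ $$\|e^{tL_{1,k}}\psi^{in}\|_{L^2(\mathbb{S}^2)}\le C_0\,e^{-\varepsilon_0\nu^{1/2}t}\,\|\psi^{in}\|_{L^2(\mathbb{S}^2)} .$$
   Context: For $k\in\mathbb{S}^2$ and $\nu>0$, $L_{1,k}:=-i\,k\cdot p+\nu\Delta_p$ acts on complex-valued functions of $p\in\mathbb{S}^2\subset\mathbb{R}^3$, where $\Delta_p$ is the Laplace–Beltrami operator on $\mathbb{S}^2$ and $k\cdot p$ is multiplication by the function $p\mapsto k\cdot p$. Thus $\psi(t)=e^{tL_{1,k}}\psi^{in}$ is the solution of $\partial_t\psi+i(k\cdot p)\psi=\nu\Delta_p\psi$, $\psi(0)=\psi^{in}$. *)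

(* Defs.v *)
From HB Require Import structures.
From mathcomp Require Import all_boot all_order all_algebra.
From mathcomp Require Import complex.
From mathcomp Require Import all_classical all_reals all_analysis.
From mathcomp Require Import measurable_realfun ring.

Set Implicit Arguments.
Unset Strict Implicit.
Unset Printing Implicit Defensive.

Import Order.TTheory GRing.Theory Num.Theory.
Import numFieldNormedType.Exports.

Local Open Scope classical_set_scope.
Local Open Scope ring_scope.

(* The norm that MathComp-Analysis puts on 'rV[R]_3 is the sup norm, so the
   Euclidean structure is written out. *)
Definition dot (R : realType) (x y : 'rV[R]_3) : R := \sum_i x 0 i * y 0 i.

Record sphere (R : realType) := Sphere {
  vec :> 'rV[R]_3 ;
  vecP : dot vec vec == 1 }.

HB.instance Definition _ (R : realType) := [isSub for @vec R].
HB.instance Definition _ (R : realType) := [Choice of sphere R by <:].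

Lemma north_subproof (R : realType) :
  dot (delta_mx 0 ord_max : 'rV[R]_3) (delta_mx 0 ord_max) == 1.
Proof.
by rewrite /dot !big_ord_recl big_ord0 !mxE /= !mulr0 !add0r mulr1 addr0.
Qed.

HB.instance Definition _ (R : realType) :=
  isPointed.Build (sphere R) (Sphere (north_subproof R)).

Definition coord (R : realType) (i : 'I_3) (p : sphere R) : R := vec p 0 i.

Fact sphere_display : measure_display. Proof. exact: default_measure_display. Qed.

(* Borel sets of the sphere: the sigma-algebra generated by the coordinates. *)
Section sphere_measurable.
Variable R : realType.

Let sphere_measurable : set (set (sphere R)) := g_sigma_preimage (@coord R).

Let sphere_set0 : sphere_measurable set0.
Proof. exact: sigma_algebra0. Qed.

Let sphere_setC A : sphere_measurable A -> sphere_measurable (~` A).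
Proof. by rewrite -setTD; exact: sigma_algebraCD. Qed.

Let sphere_bigcup (F : (set (sphere R))^nat) :
  (forall i, sphere_measurable (F i)) -> sphere_measurable (\bigcup_i F i).
Proof. exact: sigma_algebra_bigcup. Qed.

HB.instance Definition _ := @isMeasurable.Build sphere_display
  (sphere R) sphere_measurable sphere_set0 sphere_setC sphere_bigcup.
End sphere_measurable.

Lemma measurable_coord (R : realType) (i : 'I_3) :
  measurable_fun [set: sphere R] (@coord R i).
Proof.
move=> _ Y mY; rewrite setTI; apply: sub_sigma_algebra.
rewrite -bigcup_mkord_ord; exists i; first exact: ltn_ord.
by exists Y => //; rewrite setTI inord_val.
Qed.

Lemma measurable_fun_sphere (R : realType) d (T : measurableType d)
    (f : T -> sphere R) :
  (forall i, measurable_fun [set: T] (@coord R i \o f)) ->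
  measurable_fun [set: T] f.
Proof.
move=> mf _; suff : @measurable _ (sphere R) `<=`
    image_set_system [set: T] f measurable by move=> h A /h.
apply: smallest_sub; first exact/sigma_algebra_image/sigma_algebra_measurable.
rewrite -bigcup_mkord_ord; apply: bigcup_sub => i _ A [B mB <-].
by rewrite /image_set_system/= setTI; exact: mf.
Qed.

(* Spherical coordinates: z.1 is the polar angle and z.2 the azimuth. *)
Section spherical.
Variable R : realType.
Implicit Type z : R * R.

Definition spherical_vec z : 'rV[R]_3 := \row_(i < 3)
  [:: sin z.1 * cos z.2; sin z.1 * sin z.2; cos z.1]`_i.

Lemma spherical_vecP z : dot (spherical_vec z) (spherical_vec z) == 1.
Proof.
rewrite /dot !big_ord_recl big_ord0 !mxE /= -(cos2Dsin2 z.1); apply/eqP.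
have := cos2Dsin2 z.2; set a := sin z.1; set b := cos z.1 => h.
rewrite addr0 -[a ^+ 2]mulr1 -h; ring.
Qed.

Definition spherical z : sphere R := Sphere (spherical_vecP z).

Lemma measurable_spherical : measurable_fun setT spherical.
Proof.
have mS1 : measurable_fun setT (fun z : R * R => sin z.1).
  by apply: measurableT_comp => //; apply: continuous_measurable_fun;
    exact: continuous_sin.
have mC1 : measurable_fun setT (fun z : R * R => cos z.1).
  by apply: measurableT_comp => //; apply: continuous_measurable_fun;
    exact: continuous_cos.
have mS2 : measurable_fun setT (fun z : R * R => sin z.2).
  by apply: measurableT_comp => //; apply: continuous_measurable_fun;
    exact: continuous_sin.
have mC2 : measurable_fun setT (fun z : R * R => cos z.2).
  by apply: measurableT_comp => //; apply: continuous_measurable_fun;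
    exact: continuous_cos.
apply: measurable_fun_sphere => i; rewrite /coord /= /comp /=.
under eq_fun do rewrite mxE.
case: i => [[|[|[|//]]] ?] /=; [exact: measurable_funM..|exact: mC1].
Qed.

(* The area element sin(theta) d(theta) d(phi) on [0, pi] x [0, 2 pi]. *)
Definition area_element : R * R -> \bar R :=
  (fun z => (sin z.1)%:E) \_ (`[0, pi] `*` `[0, pi *+ 2]).

Lemma measurable_area_element : measurable_fun setT area_element.
Proof.
apply/(measurable_restrictT _ _).1.
  by apply: measurableX; exact: measurable_itv.
apply: measurable_funTS; apply/measurable_EFinP.
by apply: measurableT_comp => //; apply: continuous_measurable_fun;
  exact: continuous_sin.
Qed.

Lemma area_element_ge0 z : (0 <= area_element z)%E.
Proof.
apply: erestrict_ge0 => -[t p] [/=]; rewrite in_itv /= => t0pi _.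
by rewrite lee_fin sin_ge0_pi.
Qed.

Definition area (A : set (sphere R)) : \bar R :=
  (\int[lebesgue_measure \x lebesgue_measure]_(z in spherical @^-1` A)
     area_element z)%E.

Let area0 : area set0 = 0%E.
Proof. by rewrite /area preimage_set0 integral_set0. Qed.

Let area_ge0 A : (0 <= area A)%E.
Proof. by apply: integral_ge0 => z _; exact: area_element_ge0. Qed.

Let area_sigma_additive : semi_sigma_additive area.
Proof.
move=> F mF tF mUF; rewrite /area preimage_bigcup.
apply: semi_sigma_additive_nng_induced.
- exact: measurable_area_element.
- exact: area_element_ge0.
- by move=> n; rewrite -[X in measurable X]setTI; exact: measurable_spherical.
- apply/trivIsetP => i j _ _ ij; rewrite -preimage_setI.
  by move/trivIsetP : tF => /(_ _ _ _ _ ij) ->//; rewrite preimage_set0.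
- rewrite -preimage_bigcup -[X in measurable X]setTI.
  exact: measurable_spherical.
Qed.

HB.instance Definition _ := isMeasure.Build _ _ _
  area area0 area_ge0 area_sigma_additive.
End spherical.

Section laplace_beltrami.
Variable R : realType.

Definition radial_proj (x : 'rV[R]_3) : sphere R :=
  insubd (point : sphere R) ((Num.sqrt (dot x x))^-1 *: x).

(* The extension of f to R^3 minus the origin that is homogeneous of degree 0;
   its value at the origin is irrelevant. *)
Definition extend (f : sphere R -> R) (x : 'rV[R]_3) : R^o :=
  f (radial_proj x).

Definition partial (i : 'I_3) (g : 'rV[R]_3 -> R^o) (x : 'rV[R]_3) : R^o :=
  'D_(delta_mx 0 i) g x.

(* f is C^oo on the sphere iff its extension is C^oo away from the origin, i.e.
   iff all its iterated partial derivatives are differentiable there. *)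
Definition smooth (f : sphere R -> R) : Prop :=
  forall (s : seq 'I_3) (x : 'rV[R]_3), x != 0 ->
    differentiable (foldr partial (extend f) s) x.

(* The gradient in R^3 of the extension is, at a point p of the sphere, the
   gradient of f along the sphere, seen as a vector of R^3 orthogonal to p.
   Applied to the components of a tangent field V, the same tangential
   derivatives give the surface divergence of V. *)
Definition tderiv (i : 'I_3) (f : sphere R -> R) (p : sphere R) : R :=
  partial i (extend f) p.

Definition grad (f : sphere R -> R) (p : sphere R) : 'rV[R]_3 :=
  \row_i tderiv i f p.

Definition divergence (V : sphere R -> 'rV[R]_3) (p : sphere R) : R :=
  \sum_i tderiv i (fun q => V q 0 i) p.

Definition laplace_beltrami (f : sphere R -> R) : sphere R -> R :=
  divergence (grad f).

End laplace_beltrami.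

Section complex_functions.
Variable R : realType.
Local Notation C := R[i].
Implicit Types f g : sphere R -> C.

Definition csmooth f : Prop :=
  smooth (fun p => complex.Re (f p)) /\ smooth (fun p => complex.Im (f p)).

Definition claplace_beltrami f (p : sphere R) : C :=
  (laplace_beltrami (fun q => complex.Re (f q)) p
     +i* laplace_beltrami (fun q => complex.Im (f q)) p)%C.

Definition L1 (k : sphere R) (nu : R) f (p : sphere R) : C :=
  - 'i%C * (dot k p)%:C%C * f p + nu%:C%C * claplace_beltrami f p.

Definition L2norm f : \bar R :=
  'N[@area R]_2%:E[EFin \o (fun p => Normc.normc (f p))]%E.

(* Representatives of the elements of L^2; the operators below act on
   representatives, and identities between them hold almost everywhere. *)
Definition L2 f : Prop :=
  [/\ measurable_fun setT (fun p => complex.Re (f p)),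
      measurable_fun setT (fun p => complex.Im (f p)) &
      (L2norm f < +oo)%E].

Definition eqL2 f g : Prop := {ae @area R, forall p, f p = g p}.

Record C0_semigroup (T : R -> (sphere R -> C) -> (sphere R -> C)) : Prop := {
  semigroup_L2 : forall (t : R) f, 0 <= t -> L2 f -> L2 (T t f) ;
  semigroup_linear : forall (t : R) (a : C) f g, 0 <= t -> L2 f -> L2 g ->
    eqL2 (T t (fun p => a * f p + g p)) (fun p => a * T t f p + T t g p) ;
  semigroup_bounded : forall t : R, 0 <= t -> exists M : R,
    forall f, L2 f -> (L2norm (T t f) <= M%:E * L2norm f)%E ;
  semigroup_0 : forall f, L2 f -> eqL2 (T 0 f) f ;
  semigroup_add : forall (s t : R) f, 0 <= s -> 0 <= t -> L2 f ->
    eqL2 (T (s + t) f) (T s (T t f)) ;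
  semigroup_continuous : forall f, L2 f ->
    L2norm (fun p => T h f p - f p) @[h --> 0^'+] --> 0%E }.

(* (f, g) belongs to the graph of the infinitesimal generator of T. *)
Definition generator_graph (T : R -> (sphere R -> C) -> (sphere R -> C)) f g :=
  [/\ L2 f, L2 g &
      L2norm (fun p => (h^-1)%:C%C * (T h f p - f p) - g p) @[h --> 0^'+]
        --> 0%E].

(* (f, g) belongs to the closure in L^2 x L^2 of the graph of the operator A
   with domain the smooth functions. *)
Definition closure_graph (A : (sphere R -> C) -> (sphere R -> C)) f g :=
  [/\ L2 f, L2 g &
      exists phi : nat -> sphere R -> C,
        [/\ forall n, csmooth (phi n),
            L2norm (fun p => phi n p - f p) @[n --> \oo] --> 0%E &
            L2norm (fun p => A (phi n) p - g p) @[n --> \oo] --> 0%E]].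

(* T t = e^{t A}: T is the strongly continuous semigroup on L^2 whose generator
   is (the closure of) the differential operator A. *)
Definition is_exp (A : (sphere R -> C) -> (sphere R -> C))
    (T : R -> (sphere R -> C) -> (sphere R -> C)) : Prop :=
  C0_semigroup T /\
  forall f g, generator_graph T f g <-> closure_graph A f g.

End complex_functions.

(* Main.v *)
(** Write u = k.p, m = sqrt nu and let X be the derivative along grad u. With
    M0 = 1, M1 = - Delta, M2 = - i X + i u and M3 = 1 - u^2 (iterated commutators
    with i u, up to constants), the time-weighted energy
      Phi_t(f) = sum_j c_j t^j <M_j f, f>,   c = (1, 36 e m^2, 6 e m^2, e m^2),
    does not increase along the flow on [0, 1/m] when e is small. It equals |f|^2
    at t = 0 and dominates |f|^2 for every t. Since Delta u = - 2 u gives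
      2 int |f|^2 = 3 int (1 - u^2) |f|^2 + 2 int u Re (conj f X f),
    it dominates (1 + e/4) |f|^2 at t = 1/m. So each time step 1/m contracts the
    norm by a fixed factor, which gives the rate m = nu^(1/2).

    For the abstract semigroup, the smooth functions are only a core of the
    generator L. Each <M_j f, f> is therefore rewritten as a form in (f, L f)
    without derivatives, continuous for the graph norm; all inequalities then pass
    from smooth functions to the domain of L, and the monotonicity of Phi_t follows
    from its upper right Dini derivative. Density of the domain ends the proof. *)

(* The semigroup acts on functions, not on classes, and is bounded at each time separately. So the
   argument uses a real semi-inner product, reads every identity up to null vectors, and first
   recovers a bound that is locally uniform in time: it gives left continuity of the orbits, without
   which a Dini derivative from the right proves nothing.

   On the sphere only one formula is integrated in coordinates, int D_i f = 2 int x_i f for the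
   tangential derivatives D_i. Together with the Leibniz rule, D_i x_j = delta_ij - x_i x_j and
   sum_i x_i D_i = 0, it yields Green's formula and all commutator identities by algebra in a
   commutative ring, f = a + i b being a pair of real functions. After these identities each energy
   inequality holds between the integrands at a single point, by Cauchy-Schwarz and Young.

   The powers t^j let the energy start from |f|^2 alone, so that no derivative of the initial datum
   enters the constants. With e = 1/576 and m <= 1 they come out as C_0 = sqrt (1 + e/4), eps_0 = ln
   C_0 and nu_0 = 1. *)
From HB Require Import structures.
From mathcomp Require Import all_boot all_order all_algebra.
From mathcomp Require Import complex.
From mathcomp Require Import all_classical all_reals all_analysis.
From mathcomp Require Import measurable_realfun ring lra.
Require Import Defs.

Set Implicit Arguments.
Unset Strict Implicit.
Unset Printing Implicit Defensive.

Import Order.TTheory GRing.Theory Num.Theory.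
Import numFieldNormedType.Exports.

Local Open Scope classical_set_scope.
Local Open Scope ring_scope.

(** * Semi-inner products *)

Section semi_inner.
Context (R : realType) (V : lmodType R) (ip : V -> V -> R).

(** Vectors will be functions rather than classes modulo null sets, so [ip] is only semidefinite,
    and [nm (x - y) = 0] plays the role of equality almost everywhere. *)
Definition semi_inner := [/\ forall x y, ip x y = ip y x,
  forall a x y z, ip (a *: x + y) z = a * ip x z + ip y z &
  forall x, 0 <= ip x x].

Definition nm x := Num.sqrt (ip x x).

Context (ipP : semi_inner).

Lemma ipC x y : ip x y = ip y x. Proof. by case: ipP. Qed.

Lemma ip_ge0 x : 0 <= ip x x. Proof. by case: ipP. Qed.

Lemma ipDl x y z : ip (x + y) z = ip x z + ip y z.
Proof. by case: ipP => _ h _; rewrite -[x]scale1r h mul1r scale1r. Qed.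

Lemma ip0l z : ip 0 z = 0.
Proof. by apply: (addrI (ip 0 z)); rewrite -ipDl !addr0. Qed.

Lemma ipZl a x z : ip (a *: x) z = a * ip x z.
Proof. by case: ipP => _ h _; rewrite -[a *: x]addr0 h ip0l addr0. Qed.

Lemma ipBl x y z : ip (x - y) z = ip x z - ip y z.
Proof. by rewrite ipDl -scaleN1r ipZl mulN1r. Qed.

Lemma ipDr x y z : ip z (x + y) = ip z x + ip z y.
Proof. by rewrite !(ipC z) ipDl. Qed.

Lemma ipZr a x z : ip z (a *: x) = a * ip z x.
Proof. by rewrite !(ipC z) ipZl. Qed.

Lemma ipBr x y z : ip z (x - y) = ip z x - ip z y.
Proof. by rewrite !(ipC z) ipBl. Qed.

Lemma nm_ge0 x : 0 <= nm x. Proof. exact: sqrtr_ge0. Qed.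

Lemma sqr_nm x : nm x ^+ 2 = ip x x. Proof. by rewrite sqr_sqrtr// ip_ge0. Qed.

Lemma nm0 : nm 0 = 0. Proof. by rewrite /nm ip0l sqrtr0. Qed.

Lemma nmZ a x : nm (a *: x) = `|a| * nm x.
Proof.
by rewrite /nm ipZl ipZr mulrA -expr2 sqrtrM ?sqr_ge0// sqrtr_sqr.
Qed.

Lemma nmN x : nm (- x) = nm x.
Proof. by rewrite -scaleN1r nmZ normrN1 mul1r. Qed.

Lemma nm_sub x y : nm (x - y) = nm (y - x).
Proof. by rewrite -nmN opprB. Qed.

Lemma ip_CS x y : `|ip x y| <= nm x * nm y.
Proof.
have h a b : 0 <= a ^+ 2 * ip x x + 2 * a * b * ip x y + b ^+ 2 * ip y y.
  rewrite [leRHS](_ : _ = ip (a *: x + b *: y) (a *: x + b *: y)) ?ip_ge0//.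
  by rewrite ipDl !ipDr !ipZl !ipZr (ipC y x); ring.
rewrite -[leRHS]ger0_norm ?mulr_ge0 ?nm_ge0// -ler_sqr ?nnegrE//.
rewrite -!normrX !ger0_norm ?sqr_ge0// exprMn !sqr_nm.
(* If [ip y y = 0] but [ip x y] is not [0], the form is affine in [b] and takes the negative value
   [- ip x x - 2] at the chosen point. *)
have [y0|y0] := eqVneq (ip y y) 0.
  rewrite y0 mulr0 real_exprn_even_le0 ?num_real//=; apply/negPn/negP => z0.
  have := h 1 (- (ip x x + 1) / ip x y); rewrite y0 mulr0 addr0 mulr1 expr1n.
  rewrite mul1r mulrA -[2 * _ / _ * _]mulrA mulVf// mulr1.
  have := ip_ge0 x; lra.
have {}y0 : 0 < ip y y by rewrite lt_neqAle eq_sym y0 ip_ge0.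
(* At this point the form equals [ip y y] times the Gram determinant. *)
have := h (ip y y) (- ip x y).
have -> : ip y y ^+ 2 * ip x x + 2 * ip y y * - ip x y * ip x y +
  (- ip x y) ^+ 2 * ip y y = ip y y * (ip x x * ip y y - ip x y ^+ 2) by ring.
by rewrite pmulr_rge0// subr_ge0.
Qed.

Lemma ler_ip x y : ip x y <= nm x * nm y.
Proof. exact: le_trans (ler_norm _) (ip_CS _ _). Qed.

Lemma nmD x y : nm (x + y) <= nm x + nm y.
Proof.
rewrite -ler_sqr ?nnegrE ?addr_ge0 ?nm_ge0// sqr_nm sqrrD !sqr_nm.
rewrite ipDl !ipDr (ipC y x).
have := ler_ip x y; lra.
Qed.

Lemma nmB x y : nm (x - y) <= nm x + nm y.
Proof. by rewrite -(nmN y) nmD. Qed.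

Lemma nm_tri z x y : nm (x - y) <= nm (x - z) + nm (z - y).
Proof. by rewrite -[x - y](subrKA z) nmD. Qed.

Lemma nm_dist x y : `|nm x - nm y| <= nm (x - y).
Proof.
rewrite ler_norml lerBrDr lerBlDr addrC.
have := nmD (y - x) x; have := nmD (x - y) y.
rewrite !subrK (nm_sub y); lra.
Qed.

Lemma nm_null x y : nm (x - y) = 0 -> nm x = nm y.
Proof.
move=> xy; apply/eqP; rewrite -subr_eq0 -normr_eq0 eq_le normr_ge0 andbT.
by rewrite -xy nm_dist.
Qed.

End semi_inner.

(** * Semigroups and their generators *)

Lemma near_right0P (R : realType) (P : R -> Prop) :
  (\forall h \near (0 : R)^'+, P h) <->
  exists2 d : R, 0 < d & forall h, 0 < h -> h < d -> P h.
Proof.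
split=> [/nbhs_ballP[d /= d0 hd]|[d d0 hd]].
  exists d => // h h0 hd'; apply: hd => //.
  by rewrite /ball/= sub0r normrN gtr0_norm.
near=> h; apply: hd => //; near: h; exact: nbhs_right_lt.
Unshelve. all: by end_near. Qed.

(** Compare [E] with the line of slope [eta] through [E 0], and let [c] be the supremum of the times
    up to which [E] stays below it. Left continuity keeps [E] below at [c] itself, and the estimate
    to the right of [c] would push the supremum further if [c < tau]. *)
Lemma dini_nonincreasing (R : realType) (E : R -> R) (tau : R) : 0 <= tau ->
  (forall t, 0 < t -> t <= tau -> E s @[s --> t^'-] --> E t) ->
  (forall t, 0 <= t -> t < tau -> forall eta, 0 < eta ->
     \forall h \near (0 : R)^'+, E (t + h) <= E t + eta * h) ->
  E tau <= E 0.
Proof.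
move=> tau0 El Edr; apply/ler_addgt0Pr => e e0.
have [eta eta0 etae] : exists2 eta : R, 0 < eta & eta * tau <= e.
  (* The [+ 1] keeps the denominator positive when [tau = 0]. *)
  exists (e / (tau + 1)); first by rewrite divr_gt0// ltr_pwDr.
  by rewrite mulrAC ler_pdivrMr ?ltr_pwDr// ler_wpM2l ?(ltW e0)// lerDl.
suff : E tau <= E 0 + eta * tau by move=> h; apply: (le_trans h); rewrite lerD2l.
pose A := [set t | [/\ 0 <= t, t <= tau &
  forall s, 0 <= s -> s <= t -> E s <= E 0 + eta * s]].
have A0 : A 0.
  by split=> // s s0 s0'; rewrite (@le_anti _ _ s 0) ?mulr0 ?addr0 ?s0 ?s0'.
have hA : has_sup A by split; [exists 0|exists tau => t []].
pose c := sup A.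
have cub t : A t -> t <= c by move=> At; apply: ub_le_sup => //; case: hA.
have c0 : 0 <= c by exact: cub.
have ctau : c <= tau by apply: ge_sup => [|t []//]; exists 0.
have below s : 0 <= s -> s < c -> E s <= E 0 + eta * s.
  move=> s0 sc; have [a [_ _ ha] sa] := sup_gt (ex_intro _ 0 A0) sc.
  by apply: ha => //; exact: ltW.
have Ec : E c <= E 0 + eta * c.
  have [->|cn0] := eqVneq c 0; first by rewrite mulr0 addr0.
  have {}cn0 : 0 < c by rewrite lt_neqAle eq_sym cn0.
  rewrite -lerBlDr.
  apply: (@cvgr_to_le _ (c^'-) _ _ (fun s => E s - eta * s)).
    apply: cvgB; first exact: El.
    by apply: cvgMl_tmp; apply: cvg_at_left_filter; exact: cvg_id.
  near=> s; rewrite lerBlDr; apply: below => //.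
  by near: s; exact: nbhs_left_ge.
have Ac : A c.
  split=> // s s0; rewrite le_eqVlt => /predU1P[->//|]; exact: below.
have [<-//|ct] := eqVneq c tau.
have {}ct : c < tau by rewrite lt_neqAle ct.
have [d d0 hd] := (near_right0P _).1 (Edr c c0 ct eta eta0).
have Ah h : 0 < h -> h < d -> c + h <= tau -> A (c + h).
  move=> h0 hlt htau; split=> //; first by rewrite addr_ge0// ltW.
  move=> s s0 sch; have [sc|cs] := ltP s c; first exact: below.
  have [->//|sc] := eqVneq s c.
  rewrite -[s](subrKC c) (@le_trans _ _ (E c + eta * (s - c)))//.
    by apply: hd; [rewrite subr_gt0 lt_neqAle eq_sym sc|
      rewrite (le_lt_trans _ hlt)// lerBlDl].
  by rewrite mulrDr mulrN; move: Ec; lra.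
have m0 : 0 < Num.min (d / 2) (tau - c).
  by rewrite lt_min subr_gt0 ct divr_gt0.
have /cub : A (c + Num.min (d / 2) (tau - c)).
  apply: Ah => //; last by rewrite -lerBrDl ge_min lexx orbT.
  by rewrite gt_min ltr_pdivrMr// mulr_natr mulr2n ltrDl d0.
by rewrite gerDl leNgt m0.
Unshelve. all: by end_near. Qed.

Section semigroup.
Context (R : realType) (V : lmodType R) (ip : V -> V -> R).
Context (ipP : semi_inner ip).
Local Notation nm := (nm ip).

(** The real-linear counterpart of [C0_semigroup], with identities almost everywhere turned into
    vanishing seminorms. *)
Record semigroup (T : R -> V -> V) : Prop := {
  sg_linear : forall t a x y, 0 <= t ->
    nm (T t (a *: x + y) - (a *: T t x + T t y)) = 0 ;
  sg_bounded : forall t, 0 <= t -> exists M : R, forall x, nm (T t x) <= M * nm x ;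
  sg_0 : forall x, nm (T 0 x - x) = 0 ;
  sg_add : forall s t x, 0 <= s -> 0 <= t ->
    nm (T (s + t) x - T s (T t x)) = 0 ;
  sg_continuous : forall x, nm (T h x - x) @[h --> 0^'+] --> 0 }.

Context (T : R -> V -> V) (TP : semigroup T).

Definition bounded_by (M s : R) := forall x, nm (T s x) <= M * nm x.

Lemma sg_bounded_ge0 t : 0 <= t -> exists2 M : R, 0 <= M & bounded_by M t.
Proof.
move=> /(sg_bounded TP)[M hM]; exists (Num.max M 0); first by rewrite le_max lexx orbT.
by move=> x; rewrite (le_trans (hM x))// ler_wpM2r ?nm_ge0// le_max lexx.
Qed.

Lemma nm_sgB t x y : 0 <= t -> nm (T t x - T t y) = nm (T t (x - y)).
Proof.
move=> t0; have := sg_linear TP (-1) y x t0.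
rewrite !scaleN1r ![- _ + _]addrC => /(nm_null ipP) ->.
by [].
Qed.

Lemma nm_sgD s t x : 0 <= s -> 0 <= t -> nm (T (s + t) x) = nm (T s (T t x)).
Proof. by move=> s0 t0; exact: nm_null (sg_add TP _ s0 t0). Qed.

Lemma sg_right_continuous t x : 0 <= t ->
  nm (T (t + h) x - T t x) @[h --> 0^'+] --> 0.
Proof.
move=> t0; have [M M0 hM] := sg_bounded_ge0 t0.
apply: (@squeeze_cvgr _ _ _ _ (cst 0) (fun h => M * nm (T h x - x))).
- near=> h; rewrite nm_ge0//=.
  have h0 : 0 < h by near: h; exact: nbhs_right_gt.
  have -> : nm (T (t + h) x - T t x) = nm (T t (T h x) - T t x).
    by apply: (nm_null ipP); rewrite opprB subrKA sg_add// ltW.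
  by rewrite nm_sgB//; exact: hM.
- exact: cvg_cst.
- by rewrite -[X in _ --> X](mulr0 M); apply: cvgMl_tmp; exact: sg_continuous.
Unshelve. all: by end_near. Qed.

(* Baire's theorem on the real line rather than in V: the sets of times at which
   T is bounded by n cover, and right continuity makes them closed enough. *)
Lemma sg_bounded_interval (b : R) : 0 < b -> exists m r M : R,
  [/\ 0 < r, 0 < m, m < b, 0 <= M &
      forall s, `|s - m| < r -> 0 <= s -> bounded_by M s].
Proof.
move=> b0; pose I : set R := [set` `]0, b[].
pose K (n : nat) := [set s | I s /\ bounded_by n%:R s].
have [n [U [oU U0 UK]]] : exists n, exists U : set R,
    [/\ open U, U !=set0 & U `<=` I `&` closure (K n)].
  apply: contrapT => hn.
  (* If no [closure (K i)] contained a nonempty open part of the interval, the intersection of their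
     complements would be dense by Baire. But a time of the interval lying there has [T s] bounded
     by some integer, hence belongs to one of the [K i]. *)
  have /(_ I) : dense (\bigcap_i ~` closure (K i)).
    apply: Baire => i; split.
      by apply: closed_openC; exact: closed_closure.
    move=> O O0 oO; apply: contrapT => hO.
    have OK : O `<=` closure (K i).
      by move=> x Ox; apply: contrapT => xK; apply: hO; exists x.
    apply: hn; exists i, (I `&` O); split.
    + by apply: openI => //; exact: interval_open.
    + have [x Ox] := O0.
      have [y [[yb _] Oy]] := OK _ Ox O (open_nbhs_nbhs (conj oO Ox)).
      by exists y.
    + by move=> x [xb Ox]; split => //; exact: OK.
  case=> [||s [/= sb hs]].
  - by exists (b / 2); rewrite /I /= in_itv/= divr_gt0//= ltr_pdivrMr// ltr_pMr// ltr1n.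
  - exact: interval_open.
  - have [M M0 hM] : exists2 M : R, 0 <= M & bounded_by M s.
      by apply: sg_bounded_ge0; move: sb; rewrite /I /= in_itv/= => /andP[/ltW].
    pose N := Num.bound M.
    apply: (hs N Logic.I); apply: subset_closure; split => // x.
    rewrite (le_trans (hM x))// ler_wpM2r ?nm_ge0//.
    exact/ltW/archi_boundP.
have [m Um] := U0.
have /nbhs_ballP[r /= r0 rU] : nbhs m U by exact: open_nbhs_nbhs.
have [mb _] := UK _ Um; move: mb; rewrite /I /= in_itv/= => /andP[m0 mb].
exists m, r, n%:R; split => // s sm s0 x.
apply/ler_addgt0Pr => e e0.
have /near_right0P[d d0 hd] : \forall h \near (0 : R)^'+, nm (T (s + h) x - T s x) < e.
  have /cvgr_lt := sg_right_continuous x s0; exact.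
have /nbhs_ballP[d' /= d'0 hd'] : nbhs s U.
  by apply: open_nbhs_nbhs; split => //; apply: rU; rewrite /ball/= distrC.
(* The ball of radius [c] around [s + c] lies to the right of [s] and within distance [d]. So the
   point [s1] of [K n] found in it is on the side of [s] on which [T] is known to be continuous. *)
pose c := Num.min d d' / 2.
have c0 : 0 < c by rewrite divr_gt0// lt_min d0.
have c2 : c + c = Num.min d d' by rewrite -splitr.
have Uc : U (s + c).
  apply: hd'; rewrite /ball/= opprD addNKr normrN gtr0_norm//.
  by rewrite (@lt_le_trans _ _ (c + c)) ?ltrDl// c2 ge_min lexx orbT.
have [s1 [[_ hs1]]] := (UK _ Uc).2 _ (nbhsx_ballx (s + c) c c0).
rewrite /ball/= ltr_norml => /andP[s1l s1r].
have ed : nm (T s1 x - T s x) < e.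
  rewrite -[s1](subrKC s); apply: hd; first lra.
  by rewrite (@lt_le_trans _ _ (c + c))// ?c2 ?ge_min ?lexx//; lra.
have := hs1 x; have := nm_dist ipP (T s1 x) (T s x).
rewrite ler_norml => /andP[]; lra.
Qed.

(** A window of boundedness around some [m < t] is carried to [t] by the factorization of [T s] as
    [T (t - m)] after [T (s - (t - m))]. *)
Lemma sg_locally_bounded t : 0 < t -> exists r M : R,
  [/\ 0 < r, 0 <= M & forall s, `|s - t| < r -> 0 <= s -> bounded_by M s].
Proof.
move=> t0; have [m [r [M [r0 m0 mt M0 hM]]]] := sg_bounded_interval t0.
have tm0 : 0 <= t - m by rewrite subr_ge0 ltW.
have [N N0 hN] := sg_bounded_ge0 tm0.
exists (Num.min r m), (N * M); split; [by rewrite lt_min r0|exact: mulr_ge0|].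
move=> s; rewrite lt_min => /andP[sr sm] _ x.
have s0 : 0 <= s - (t - m) by move: sm; rewrite ltr_norml => /andP[]; lra.
rewrite -[s](subrKC (t - m)) nm_sgD// (le_trans (hN _))// -mulrA ler_wpM2l//.
apply: hM => //; rewrite (_ : _ - _ - m = s - t)//; ring.
Qed.

(** Up to null vectors the difference is [T s] applied to [x - T (t - s) x]. The operator varies
    with [s], hence the need for a bound uniform near [t]. *)
Lemma sg_left_continuous t x : 0 < t -> nm (T s x - T t x) @[s --> t^'-] --> 0.
Proof.
move=> t0; have [r [M [r0 M0 hM]]] := sg_locally_bounded t0.
apply: (@squeeze_cvgr _ _ _ _ (cst 0) (fun s => M * nm (T (t - s) x - x))).
- near=> s; rewrite nm_ge0//=.
  have st : s < t by near: s; exact: nbhs_left_lt.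
  have s0 : 0 <= s by near: s; exact: nbhs_left_ge.
  have st0 : 0 <= t - s by rewrite subr_ge0 ltW.
  have -> : nm (T s x - T t x) = nm (T s (T (t - s) x) - T s x).
    rewrite [LHS]nm_sub//; apply: (nm_null ipP); rewrite opprB subrKA.
    by rewrite -{1}[t](subrKC s) sg_add.
  rewrite nm_sgB//; apply: hM => //.
  by rewrite distrC ger0_norm// ltrBlDl -ltrBlDr; near: s;
    apply: nbhs_left_gt; rewrite gtrBl.
- exact: cvg_cst.
- rewrite -[X in _ --> X](mulr0 M); apply: cvgMl_tmp.
  apply/cvgrPdist_lt => e e0.
  have /near_right0P[d d0 hd] : \forall h \near (0 : R)^'+, nm (T h x - x) < e.
    by have /cvgr_lt := sg_continuous TP x; exact.
  near=> s; rewrite sub0r normrN ger0_norm ?nm_ge0//; apply: hd.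
    by rewrite subr_gt0; near: s; exact: nbhs_left_lt.
  by rewrite ltrBlDl -ltrBlDr; near: s; apply: nbhs_left_gt; rewrite gtrBl.
Unshelve. all: by end_near. Qed.

Definition gen x y := nm (h^-1 *: (T h x - x) - y) @[h --> 0^'+] --> 0.

Lemma null_trans y x z : nm (x - y) = 0 -> nm (y - z) = 0 -> nm (x - z) = 0.
Proof.
move=> xy yz; apply/eqP; rewrite eq_le nm_ge0 andbT.
by rewrite (le_trans (nm_tri ipP y x z))// xy yz addr0.
Qed.

Lemma null_sym x y : nm (x - y) = 0 -> nm (y - x) = 0.
Proof. by rewrite nm_sub. Qed.

Lemma null_addr x y z : nm (x - y) = 0 -> nm (x + z - (y + z)) = 0.
Proof. by rewrite opprD addrACA subrr addr0. Qed.

Lemma null_scale a x y : nm (x - y) = 0 -> nm (a *: x - a *: y) = 0.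
Proof. by rewrite -scalerBr nmZ// => ->; rewrite mulr0. Qed.

Lemma sg_sub t x y : 0 <= t -> nm (T t (x - y) - (T t x - T t y)) = 0.
Proof.
by move=> t0; have := sg_linear TP (-1) y x t0; rewrite !scaleN1r ![- _ + _]addrC.
Qed.

Lemma sg_scale t a x : 0 <= t -> nm (T t (a *: x) - a *: T t x) = 0.
Proof.
move=> t0; have T0 : nm (T t 0) = 0.
  have := sg_sub 0 0 t0; rewrite !subrr subr0; exact.
have := sg_linear TP a x 0 t0; rewrite addr0 => /null_trans; apply.
by rewrite addrC addKr.
Qed.

(** The bounded operator [T t] commutes with the difference quotients, so the domain of the
    generator is invariant and the energy can be followed along an orbit. *)
Lemma gen_sg t x y : 0 <= t -> gen x y -> gen (T t x) (T t y).
Proof.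
move=> t0 xy; have [M M0 hM] := sg_bounded_ge0 t0.
apply: (@squeeze_cvgr _ _ _ _ (cst 0)
  (fun h => M * nm (h^-1 *: (T h x - x) - y))).
- near=> h; rewrite nm_ge0//=.
  have h0 : 0 <= h by near: h; exact: nbhs_right_ge.
  rewrite (le_trans _ (hM _))// le_eqVlt; apply/orP; left; apply/eqP.
  apply: (nm_null ipP); apply: null_sym; apply: (null_trans (sg_sub _ _ t0)).
  apply: null_addr; apply: (null_trans (sg_scale _ _ t0)).
  apply: null_scale; apply: (null_trans (sg_sub _ _ t0)); apply: null_addr.
  apply: (null_trans (null_sym (sg_add TP _ t0 h0))).
  by rewrite (addrC t h); apply: (sg_add TP).
- exact: cvg_cst.
- by rewrite -[X in _ --> X](mulr0 M); exact: cvgMl_tmp.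
Unshelve. all: by end_near. Qed.

(** Joint continuity in the two slots; with [y] the image of [x] under the generator it is
    continuity for the graph norm. Arbitrary filters let one notion serve sequences in the core as
    well as one-sided limits in time. *)
Definition form_continuous (q : V -> V -> R) :=
  forall (I : Type) (F : set_system I) (FF : Filter F) (X Y : I -> V) x y,
    nm (X i - x) @[i --> F] --> 0 -> nm (Y i - y) @[i --> F] --> 0 ->
    q (X i) (Y i) @[i --> F] --> q x y.

Lemma nm_cvg (I : Type) (F : set_system I) (FF : Filter F) (X : I -> V) x :
  nm (X i - x) @[i --> F] --> 0 -> nm (X i) @[i --> F] --> nm x.
Proof.
move=> Xx; apply/cvgrPdist_le => e e0.
move/cvgrPdist_le : Xx => /(_ e e0); apply: filterS => i.
rewrite sub0r normrN ger0_norm ?nm_ge0// => h.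
by rewrite distrC; apply: le_trans h; exact: nm_dist.
Qed.

Lemma ip_cvg (I : Type) (F : set_system I) (FF : Filter F) (X Y : I -> V) x y :
    nm (X i - x) @[i --> F] --> 0 -> nm (Y i - y) @[i --> F] --> 0 ->
  ip (X i) (Y i) @[i --> F] --> ip x y.
Proof.
move=> Xx Yy; apply/cvgrPdist_le => e e0.
have h : nm (X i - x) * nm (Y i) + nm x * nm (Y i - y) @[i --> F] --> 0.
  have -> : 0 = 0 * nm y + nm x * 0 by rewrite mulr0 mul0r addr0.
  by apply: cvgD; [apply: cvgM => //; exact: nm_cvg|exact: cvgMl_tmp].
move/cvgrPdist_le : h => /(_ e e0); apply: filterS => i.
rewrite sub0r normrN => le_e; apply: le_trans le_e; rewrite distrC.
rewrite -[_ - ip x y](subrKA (ip x (Y i))) -(ipBl ipP) -(ipBr ipP).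
rewrite (le_trans (ler_normD _ _))//.
rewrite (le_trans (lerD (ip_CS ipP _ _) (ip_CS ipP _ _)))//.
exact: ler_norm.
Qed.

End semigroup.

(** * Decay from a time-weighted energy *)

Lemma cvg_sumr (R : realType) (I T : Type) (F : set_system T) (FF : Filter F)
    (r : seq I) (f : I -> T -> R) (a : I -> R) :
  (forall i, f i x @[x --> F] --> a i) ->
  (\sum_(i <- r) f i x) @[x --> F] --> \sum_(i <- r) a i.
Proof. by move=> fa; apply: cvg_big => //; exact: add_continuous. Qed.

(** For [j = 0] the truncated exponent [j.-1] is harmless, its factor being [0]. *)
Lemma cvg_pow_slope (R : realType) (j : nat) (t : R) :
  h^-1 * ((t + h) ^+ j - t ^+ j) @[h --> 0^'+] --> j%:R * t ^+ j.-1.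
Proof.
have := @exprn_derivable R j t 1; rewrite /derivable => /cvg_ex[l lP].
have -> : j%:R * t ^+ j.-1 = l.
  by have := exp_derive j t (1 : R); rewrite /derive (cvg_lim _ lP)// => ->; rewrite scaler1.
apply: cvg_dnbhs_at_right; apply: cvg_trans lP; apply: near_eq_cvg.
by apply: nearW => h; rewrite /= -[h *: 1]/(h * 1) mulr1 (addrC h).
Qed.

Section hypocoercive_semigroup.
Context (R : realType) (V : lmodType R) (ip : V -> V -> R).
Context (ipP : semi_inner ip).
Local Notation nm := (nm ip).
Context (T : R -> V -> V) (TP : semigroup ip T).
Context (S : V -> Prop) (L : V -> V).
Context (SB : forall x y, S x -> S y -> S (x - y))
  (LB : forall x y, S x -> S y -> L (x - y) = L x - L y)
  (genS : forall x y, gen ip T x y -> exists phi : nat -> V,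
    [/\ forall n, S (phi n), nm (phi n - x) @[n --> \oo] --> 0 &
        nm (L (phi n) - y) @[n --> \oo] --> 0])
  (Sgen : forall x, S x -> gen ip T x (L x))
  (Sdense : forall x (e : R), 0 < e -> exists2 y, S y & nm (y - x) < e).
Context (n : nat) (c : 'I_n -> R) (q : 'I_n -> V -> V -> R) (M : 'I_n -> V -> V).
Context (qc : forall j, form_continuous ip (q j))
  (qM : forall j x, S x -> q j x (L x) = ip (M j x) x)
  (MB : forall j x y, S x -> S y -> M j (x - y) = M j x - M j y)
  (MC : forall j x y, S x -> S y -> ip (M j x) y = ip (M j y) x)
  (Mbd : forall j, exists2 K : R, 0 <= K &
    forall x, S x -> nm (M j x) <= K * (nm x + nm (L x))).
Context (tau kappa : R) (tau0 : 0 < tau) (kappa0 : 0 < kappa).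

(** The slot [y] stands for the generator applied to [x], so the energy is defined on the whole
    graph. [denergy] differentiates the weights only, and [multiplier] is the operator of the same
    quadratic form on the core [S], where the algebra takes place. *)
Definition energy (t : R) x y := \sum_j c j * t ^+ j * q j x y.
Definition denergy (t : R) x y := \sum_(j < n) c j * (j%:R * t ^+ j.-1) * q j x y.
Definition multiplier (t : R) x := \sum_j (c j * t ^+ j) *: M j x.

Context (dissipation : forall (t : R) x, 0 <= t -> t <= tau -> S x ->
    2 * ip (multiplier t x) (L x) + denergy t x (L x) <= 0)
  (energy_le : forall x, S x -> energy 0 x (L x) <= ip x x)
  (energy_ge : forall (t : R) x, 0 <= t -> t <= tau -> S x -> ip x x <= energy t x (L x))
  (energy_gain : forall x, S x -> (1 + kappa) * ip x x <= energy tau x (L x)).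

Lemma ip_suml (I : Type) (r : seq I) (P : pred I) (F : I -> V) y :
  ip (\sum_(i <- r | P i) F i) y = \sum_(i <- r | P i) ip (F i) y.
Proof. by apply: (big_morph (ip^~ y)) => [? ?|]; [exact: ipDl|exact: ip0l]. Qed.

Lemma energyE t x : S x -> energy t x (L x) = ip (multiplier t x) x.
Proof.
move=> Sx; rewrite /energy /multiplier ip_suml; apply: eq_bigr => j _.
by rewrite qM// (ipZl ipP).
Qed.

Lemma multiplierC t x y : S x -> S y ->
  ip (multiplier t x) y = ip (multiplier t y) x.
Proof.
move=> Sx Sy; rewrite /multiplier !ip_suml; apply: eq_bigr => j _.
by rewrite !(ipZl ipP) MC.
Qed.

Lemma multiplierB t x y : S x -> S y ->
  multiplier t (x - y) = multiplier t x - multiplier t y.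
Proof.
move=> Sx Sy; rewrite /multiplier -sumrB; apply: eq_bigr => j _.
by rewrite -scalerBr MB.
Qed.

(** It lets the remainders of a quadratic expansion be measured in the graph norm, the only norm in
    which the core approximates the domain. *)
Lemma multiplier_bounded t : exists2 K : R, 0 <= K &
  forall x, S x -> nm (multiplier t x) <= K * (nm x + nm (L x)).
Proof.
have /choice[K hK] : forall j, exists K : R, 0 <= K /\
    forall x, S x -> nm (M j x) <= K * (nm x + nm (L x)).
  by move=> j; have [K ? ?] := Mbd j; exists K.
exists (\sum_j `|c j * t ^+ j| * K j).
  by apply: sumr_ge0 => j _; rewrite mulr_ge0//; case: (hK j).
move=> x Sx; rewrite mulr_suml /multiplier.
elim/big_ind2 : _ => [|x1 x2 y1 y2 h1 h2|j _].
- by rewrite (nm0 ipP).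
- by rewrite (le_trans (nmD ipP _ _))// lerD.
- by rewrite (nmZ ipP) -mulrA ler_wpM2l//; case: (hK j) => _; exact.
Qed.

Lemma energy_continuous t : form_continuous ip (energy t).
Proof.
move=> I F FF X Y x y Xx Yy; rewrite /energy.
by apply: cvg_sumr => j; apply: cvgMl_tmp; exact: qc.
Qed.

Lemma denergy_continuous t : form_continuous ip (denergy t).
Proof.
move=> I F FF X Y x y Xx Yy; rewrite /denergy.
by apply: cvg_sumr => j; apply: cvgMl_tmp; exact: qc.
Qed.

Lemma form_null f x y x' y' : form_continuous ip f ->
  nm (x' - x) = 0 -> nm (y' - y) = 0 -> f x' y' = f x y.
Proof.
move=> fc xx yy; have : f x' y' @[_ --> \oo] --> f x y.
  by apply: (fc nat \oo _ (fun=> x') (fun=> y')); rewrite ?xx ?yy; exact: cvg_cst.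
by move/(cvg_lim (@Rhausdorff R)); rewrite lim_cst.
Qed.

(** Both sides are continuous for the graph norm, and the core approximates every point of the graph
    in that norm. *)
Lemma core_le (f g : V -> V -> R) : form_continuous ip f -> form_continuous ip g ->
  (forall x, S x -> f x (L x) <= g x (L x)) ->
  forall x y, gen ip T x y -> f x y <= g x y.
Proof.
move=> fc gc fg x y /genS[phi [Sphi phix Lphiy]].
apply: (@ler_cvg_to _ \oo _ _ (fun n => f (phi n) (L (phi n)))
  (fun n => g (phi n) (L (phi n)))).
- exact: (fc nat \oo _ phi (L \o phi)).
- exact: (gc nat \oo _ phi (L \o phi)).
- by apply: nearW => k; exact: fg.
Qed.

Lemma ip_continuous : form_continuous ip (fun x _ => ip x x).
Proof. by move=> I F FF X Y x y Xx _; exact: (ip_cvg ipP). Qed.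

(** One step of the flow with the time in the weights frozen. To first order the form changes by
    twice the pairing of the multiplier with [h *: y], which [dissipation] bounds by
    [- h * denergy]. The remainder, stated in graph norms, survives the passage from smooth vectors
    to the domain. *)
Lemma energy_step t : 0 <= t -> t <= tau -> exists2 K : R, 0 <= K &
  forall x y x' y' h, 0 <= h -> gen ip T x y -> gen ip T x' y' ->
  energy t x' y' - energy t x y <= - (h * denergy t x y) +
    K * ((nm x + nm y) * nm (x' - x - h *: y) +
         (nm (x' - x) + nm (y' - y)) * nm (x' - x)).
Proof.
move=> t0 ttau; have [K K0 hK] := multiplier_bounded t.
exists (2 * K); first exact: mulr_ge0.
move=> x y x' y' h h0 /genS[f [Sf fx Lfy]] /genS[g [Sg gx Lgy]].
have sub_cvg (X X' : nat -> V) z z' : nm (X k - z) @[k --> \oo] --> 0 ->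
    nm (X' k - z') @[k --> \oo] --> 0 ->
    nm (X' k - X k - (z' - z)) @[k --> \oo] --> 0.
  move=> Xz Xz'; apply: (@squeeze_cvgr _ _ _ _ (cst 0)
      (fun k => nm (X' k - z') + nm (X k - z))).
  - near=> k; rewrite nm_ge0/=.
    have -> : X' k - X k - (z' - z) = (X' k - z') - (X k - z).
      by rewrite opprD addrACA -opprD.
    exact: nmB.
  - exact: cvg_cst.
  - by rewrite -(addr0 0); exact: cvgD.
have scale_cvg (X : nat -> V) z : nm (X k - z) @[k --> \oo] --> 0 ->
    nm (h *: X k - h *: z) @[k --> \oo] --> 0.
  move=> Xz; under eq_fun do rewrite -scalerBr (nmZ ipP).
  by rewrite -(mulr0 `|h|); exact: cvgMl_tmp.
apply: (@ler_cvg_to _ \oo _ _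
  (fun k => energy t (g k) (L (g k)) - energy t (f k) (L (f k)))
  (fun k => - (h * denergy t (f k) (L (f k))) +
    2 * K * ((nm (f k) + nm (L (f k))) * nm (g k - f k - h *: L (f k)) +
         (nm (g k - f k) + nm (L (g k) - L (f k))) * nm (g k - f k)))).
- by apply: cvgB; exact: energy_continuous.
- apply: cvgD.
    by apply: cvgN; apply: cvgMl_tmp; exact: denergy_continuous.
  apply: cvgMl_tmp; apply: cvgD; apply: cvgM.
  + by apply: cvgD; exact: (nm_cvg ipP).
  + apply: (nm_cvg ipP) => //.
    by apply: (sub_cvg); [exact: scale_cvg|exact: sub_cvg].
  + by apply: cvgD; apply: (nm_cvg ipP) => //; exact: sub_cvg.
  + by apply: (nm_cvg ipP) => //; exact: sub_cvg.
apply: nearW => k; rewrite !energyE//.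
set a := f k; set b := g k; set d := b - a.
have Sa : S a by exact: Sf. have Sb : S b by exact: Sg.
have Sd : S d by exact: SB.
have bE : b = a + d by rewrite subrKC.
have Mb : multiplier t b = multiplier t a + multiplier t d.
  by rewrite /d multiplierB// subrKC.
have Ld : L d = L b - L a by exact: LB.
clearbody d.
(* Symmetry of the multiplier gives the expansion at [b = a + d]; the increment [d] is split into
   [h *: L a] and an error. *)
have -> : ip (multiplier t b) b - ip (multiplier t a) a =
    2 * ip (multiplier t a) (d - h *: L a) + ip (multiplier t d) d
    + h * (2 * ip (multiplier t a) (L a)).
  have -> : ip (multiplier t b) b = ip (multiplier t a + multiplier t d) (a + d).
    by rewrite -Mb -bE.
  rewrite (ipBr ipP) (ipZr ipP) (ipDl ipP) !(ipDr ipP) (multiplierC _ Sd Sa).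
  ring.
have h1 : 2 * ip (multiplier t a) (d - h *: L a) <=
    2 * K * ((nm a + nm (L a)) * nm (d - h *: L a)).
  rewrite -mulrA ler_wpM2l//; apply: (le_trans (ler_ip ipP _ _)).
  by rewrite mulrA ler_wpM2r ?nm_ge0// hK.
have h2 : ip (multiplier t d) d <=
    2 * K * ((nm d + nm (L b - L a)) * nm d).
  apply: (le_trans (ler_ip ipP _ _)).
  rewrite -Ld mulrA ler_wpM2r ?nm_ge0// (le_trans (hK _ Sd))//.
  by rewrite ler_wpM2r ?addr_ge0 ?nm_ge0// ler_peMl// ler1n.
have := mulr_ge0_le0 h0 (dissipation t0 ttau Sa).
lra.
Unshelve. all: by end_near. Qed.

Lemma energy_decreasing s x y : 0 <= s -> s <= tau -> gen ip T x y ->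
  energy s (T s x) (T s y) <= energy 0 x y.
Proof.
move=> s0 stau xy.
have -> : energy 0 x y = energy 0 (T 0 x) (T 0 y).
  by apply/esym; apply: form_null; [exact: energy_continuous|exact: (sg_0 TP)..].
apply: (dini_nonincreasing (E := fun t => energy t (T t x) (T t y))) => //.
- move=> t t_gt0 _; apply: cvg_sumr => j; apply: cvgM.
    apply: cvgMl_tmp; apply: cvg_at_left_filter.
    by apply: (@exprn_continuous _ j).
  by apply: qc; exact: sg_left_continuous.
move=> t t0 ts eta eta0; have tt := lt_le_trans ts stau.
have [K K0 hK] := energy_step t0 (ltW tt).
pose X h := T (t + h) x; pose Y h := T (t + h) y.
have Xc : nm (X h - T t x) @[h --> 0^'+] --> 0 by exact: sg_right_continuous.
have Yc : nm (Y h - T t y) @[h --> 0^'+] --> 0 by exact: sg_right_continuous.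
have Xd : nm (h^-1 *: (X h - T t x) - T t y) @[h --> 0^'+] --> 0.
  have := gen_sg ipP TP t0 xy; apply: cvg_trans; apply: near_eq_cvg.
  near=> h; have h0 : 0 <= h by near: h; exact: nbhs_right_ge.
  apply: (nm_null ipP); apply: null_addr => //; apply: null_scale => //.
  apply: null_addr => //; apply: null_sym => //.
  by rewrite /X (addrC t h); exact: (sg_add TP).
(* An upper bound for the difference quotient of the energy. The slopes of the weights tend to
   [denergy], which cancels the term coming from [energy_step], and the remainder tends to [0]. *)
pose r h := \sum_j c j * (h^-1 * ((t + h) ^+ j - t ^+ j)) * q j (X h) (Y h) -
  denergy t (T t x) (T t y) +
  K * ((nm (T t x) + nm (T t y)) * nm (h^-1 *: (X h - T t x) - T t y) +
     (nm (X h - T t x) + nm (Y h - T t y)) * nm (h^-1 *: (X h - T t x))).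
have r0 : r h @[h --> 0^'+] --> 0.
  have r1 : \sum_j c j * (h^-1 * ((t + h) ^+ j - t ^+ j)) * q j (X h) (Y h)
      @[h --> 0^'+] --> denergy t (T t x) (T t y).
    apply: cvg_sumr => j; apply: cvgM; last exact: qc.
    apply: cvgMl_tmp; exact: cvg_pow_slope.
  have r2 : (nm (T t x) + nm (T t y)) * nm (h^-1 *: (X h - T t x) - T t y) +
     (nm (X h - T t x) + nm (Y h - T t y)) * nm (h^-1 *: (X h - T t x))
      @[h --> 0^'+] --> (nm (T t x) + nm (T t y)) * 0 + (0 + 0) * nm (T t y).
    apply: cvgD; first exact: cvgMl_tmp.
    by apply: cvgM; [exact: cvgD|exact: nm_cvg].
  have : r h @[h --> 0^'+] --> denergy t (T t x) (T t y) -
      denergy t (T t x) (T t y) +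
      K * ((nm (T t x) + nm (T t y)) * 0 + (0 + 0) * nm (T t y)).
    apply: cvgD; last by apply: cvgMl_tmp; exact: r2.
    by apply: cvgB; [exact: r1|exact: cvg_cst].
  by rewrite subrr mulr0 addr0 mul0r addr0 mulr0 addr0.
move/cvgr_le : r0 => /(_ _ eta0) reta.
near=> h; have h0 : 0 < h by near: h; exact: nbhs_right_gt.
rewrite -lerBlDl -ler_pdivrMr//; apply: (@le_trans _ _ (r h)); last by near: h.
rewrite ler_pdivrMr//.
have := hK _ _ _ _ h (ltW h0) (gen_sg ipP TP t0 xy)
  (gen_sg ipP TP (addr_ge0 t0 (ltW h0)) xy).
rewrite -/(X h) -/(Y h).
have -> : X h - T t x - h *: T t y = h *: (h^-1 *: (X h - T t x) - T t y).
  by rewrite scalerBr scalerA divff ?gt_eqF// scale1r.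
have {3}-> : X h - T t x = h *: (h^-1 *: (X h - T t x)).
  by rewrite scalerA divff ?gt_eqF// scale1r.
rewrite ![nm (h *: _)](nmZ ipP) gtr0_norm//.
have : energy (t + h) (X h) (Y h) - energy t (X h) (Y h) =
  (\sum_j c j * (h^-1 * ((t + h) ^+ j - t ^+ j)) * q j (X h) (Y h)) * h.
  rewrite /energy -sumrB mulr_suml; apply: eq_bigr => j _.
  by field; rewrite gt_eqF.
rewrite /r; lra.
Unshelve. all: by end_near. Qed.

Lemma domain_bounds x y : gen ip T x y ->
  [/\ energy 0 x y <= ip x x, (1 + kappa) * ip x x <= energy tau x y &
      forall t, 0 <= t -> t <= tau -> ip x x <= energy t x y].
Proof.
move=> xy; split.
- by apply: (@core_le (energy 0) (fun x _ => ip x x)) xy;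
    [exact: energy_continuous|exact: ip_continuous|exact: energy_le].
- apply: (@core_le (fun x _ => (1 + kappa) * ip x x) (energy tau)) xy.
  + by move=> I F FF X Y z w Xz _; apply: cvgMl_tmp; exact: (ip_cvg ipP).
  + exact: energy_continuous.
  + exact: energy_gain.
- move=> t t0 ttau.
  by apply: (@core_le (fun x _ => ip x x) (energy t)) xy;
    [exact: ip_continuous|exact: energy_continuous|move=> z; exact: energy_ge].
Qed.

(** The energy argument reaches smooth [x] only; density then suffices because the single operator
    [T t] is bounded. *)
Lemma extend_bound a t : 0 <= a -> 0 <= t ->
    (forall x, S x -> a * nm (T t x) <= nm x) ->
  forall x, a * nm (T t x) <= nm x.
Proof.
move=> a0 t0 aS x; apply/ler_addgt0Pr => e e0.
have [B B0 hB] := sg_bounded_ge0 TP t0.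
have aB : 0 < a * B + 1 by rewrite ltr_wpDl// mulr_ge0.
have [|y Sy yx] := Sdense x (e := e / (a * B + 1)); first by rewrite divr_gt0.
have h1 := nm_dist ipP (T t x) (T t y); have h2 := nm_dist ipP y x.
have h3 : nm (T t x - T t y) <= B * nm (y - x).
  by rewrite (nm_sgB ipP TP)// (nm_sub ipP y); exact: hB.
move: yx; rewrite ltr_pdivlMr// => yx.
move: h1 h2; rewrite !ler_norml => /andP[_ h1] /andP[_ h2].
have := ler_wpM2l a0 (le_trans h1 h3); have := aS y Sy; lra.
Qed.

Lemma sg_contraction t x : 0 <= t -> t <= tau -> nm (T t x) <= nm x.
Proof.
move=> t0 ttau; rewrite -[leLHS]mul1r; apply: extend_bound => // {}x Sx.
rewrite mul1r -ler_sqr ?nnegrE ?nm_ge0// !(sqr_nm ipP).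
have [_ _ /(_ t t0 ttau) h] := domain_bounds (gen_sg ipP TP t0 (Sgen Sx)).
apply: (le_trans h); apply: (le_trans (energy_decreasing t0 ttau (Sgen Sx))).
by have [] := domain_bounds (Sgen Sx).
Qed.

Lemma sg_strict_contraction x : Num.sqrt (1 + kappa) * nm (T tau x) <= nm x.
Proof.
apply: extend_bound; [exact: sqrtr_ge0|exact: ltW|] => {}x Sx.
rewrite -ler_sqr ?nnegrE ?mulr_ge0 ?sqrtr_ge0 ?nm_ge0// exprMn !(sqr_nm ipP).
rewrite sqr_sqrtr ?addr_ge0 ?(ltW kappa0)//.
have [_ h _] := domain_bounds (gen_sg ipP TP (ltW tau0) (Sgen Sx)).
apply: (le_trans h).
apply: (le_trans (energy_decreasing (ltW tau0) (lexx tau) (Sgen Sx))).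
by have [] := domain_bounds (Sgen Sx).
Qed.

(** Write [t] as [N] steps [tau] plus a rest in [[0, tau]]. Each full step gains the factor [a], the
    rest is a contraction, and the prefactor [a] pays for rounding [t / tau] down to [N]. *)
Theorem sg_decay t x : 0 <= t ->
  nm (T t x) <=
    Num.sqrt (1 + kappa) * expR (- (ln (Num.sqrt (1 + kappa)) * t / tau)) * nm x.
Proof.
move=> t0; set a := Num.sqrt (1 + kappa).
have a1 : Num.sqrt 1 <= a by apply: ler_wsqrtr; rewrite lerDl ltW.
rewrite sqrtr1 in a1.
have a0 : 0 < a by exact: lt_le_trans a1.
pose N := Num.truncn (t / tau).
have /andP[Nt tN] : (N%:R <= t / tau < N.+1%:R)%R.
  by apply: truncn_itv; rewrite divr_ge0// ltW.
have iter k s y : 0 <= s -> s <= tau -> a ^+ k * nm (T (k%:R * tau + s) y) <= nm y.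
  move=> s0 st; elim: k y => [|k IH] y.
    by rewrite mul0r add0r mul1r; exact: sg_contraction.
  have kt : 0 <= k%:R * tau + s by rewrite addr_ge0// mulr_ge0// ltW.
  have -> : k.+1%:R * tau + s = (k%:R * tau + s) + tau by rewrite -natr1; ring.
  rewrite (nm_sgD ipP TP)// ?(ltW tau0)// exprS -mulrA.
  by rewrite (le_trans _ (sg_strict_contraction y))// ler_wpM2l// ltW.
have := iter N (t - N%:R * tau) x; rewrite subrKC.
rewrite subr_ge0 -ler_pdivlMr// Nt => /(_ isT).
rewrite lerBlDl -{2}[tau]mul1r -mulrDl natr1 -ler_pdivrMr// (ltW tN) => /(_ isT) h.
rewrite -(ler_pM2l (exprn_gt0 N a0)); apply: (le_trans h).
rewrite mulrA ler_peMl ?nm_ge0// -(@lnK _ a) ?posrE// -expRM_natl -!expRD.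
rewrite -[leLHS]expR0 ler_expR expRK.
have : 0 <= ln a * (N%:R + 1 - t / tau).
  by rewrite mulr_ge0 ?ln_ge0// subr_ge0 natr1 ltW.
lra.
Qed.

End hypocoercive_semigroup.

(** * Smooth functions on the sphere *)

Section smooth_functions.
Context (R : realType).
Local Notation E := 'rV[R]_3.
Implicit Types (f g h : E -> R^o) (x : E).

Lemma dot_ge0 (x : E) : 0 <= dot x x.
Proof. by apply: sumr_ge0 => i _; rewrite -expr2 sqr_ge0. Qed.

Lemma dot_gt0 (x : E) : x != 0 -> 0 < dot x x.
Proof.
move=> x0; rewrite lt_neqAle dot_ge0 andbT eq_sym; apply: contraNneq x0.
move=> /eqP; rewrite /dot psumr_eq0 => [/allP h|i _]; last by rewrite -expr2 sqr_ge0.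
apply/eqP/rowP => i; rewrite mxE.
by have := h i (mem_index_enum _); rewrite -expr2 sqrf_eq0 => /eqP.
Qed.

Lemma nonzero_near x : x != 0 -> \forall y \near x, y != 0.
Proof.
move=> x0; have oC : open (~` [set (0 : E)]).
  by apply: closed_openC; apply: accessible_closed_set1;
    apply: hausdorff_accessible; exact: norm_hausdorff.
have : nbhs x (~` [set (0 : E)]) by apply: open_nbhs_nbhs; split => //; exact/eqP.
by apply: filterS => y /eqP.
Qed.

Lemma partial_eq f g : (forall x, x != 0 -> f x = g x) ->
  forall i x, x != 0 -> partial i f x = partial i g x.
Proof.
move=> fg i x x0; apply: near_eq_derive.
by apply: filterS (nonzero_near x0) => y /fg.
Qed.

Lemma partials_eq f g s : (forall x, x != 0 -> f x = g x) ->
  forall x, x != 0 -> foldr (@partial R) f s x = foldr (@partial R) g s x.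
Proof. by move=> fg; elim: s => //= i s IH; exact: partial_eq. Qed.

(** The functions agree near [x], so [g - f] vanishes there and has differential [0]; then [g] is
    the sum of [g - f] and [f]. *)
Lemma differentiable_eq f g x : (forall y : E, y != 0 -> f y = g y) -> x != 0 ->
  differentiable f x -> differentiable g x.
Proof.
move=> fg x0 df.
have e : \forall y \near (0 : E), f (y + x) = g (y + x).
  have := nonzero_near x0; rewrite (near_shift (0 : E)) => h.
  by apply: filterS h => y /=; rewrite subr0 => /fg.
have k0 : (g - f) \o shift x = cst ((g - f) x) + \0 +o_ (0 : E) id.
  apply/eqaddoP => eps eps0; near=> y.
  have -> : ((g - f) \o shift x - (cst ((g - f) x) + \0)) y = 0.
    change (g (y + x) - f (y + x) - (g x - f x + 0) = 0).
    rewrite (fg x x0) subrr addr0 subr0; apply/eqP; rewrite subr_eq0; apply/eqP/esym.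
    by near: y.
  by rewrite normr0 mulr_ge0// ltW.
have dk0 : 'd (g - f) x = \0 :> (E -> R^o) by apply: diff_unique => //; exact: cst_continuous.
have dk : differentiable (g - f) x.
  by apply/diff_locallyP; split; rewrite dk0//; exact: cst_continuous.
by rewrite -(subrKC f g); exact: differentiableD.
Unshelve. all: by end_near. Qed.

Definition smooth_off0 f := forall (s : seq 'I_3) x, x != 0 ->
  differentiable (foldr (@partial R) f s) x.

(** Coinduction in place of rules for iterated derivatives: it is enough to exhibit a class of
    differentiable functions that every partial derivative maps into itself, off the origin. The
    induction peels off the innermost derivative, the last one of the list. *)
Lemma smooth_off0_coind (P : (E -> R^o) -> Prop) :
  (forall f, P f -> (forall x, x != 0 -> differentiable f x) /\
    forall i, exists g, P g /\ forall x, x != 0 -> partial i f x = g x) ->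
  forall f, P f -> smooth_off0 f.
Proof.
move=> Pstep f + s; elim/last_ind: s f => [|s i IH] f Pf x x0.
  by have [+ _] := Pstep f Pf; exact.
rewrite foldr_rcons; have [_ /(_ i)[g [Pg fg]]] := Pstep f Pf.
apply: (@differentiable_eq (foldr (@partial R) g s)) => //; last exact: IH.
by move=> y y0; apply/esym; exact: partials_eq.
Qed.

Lemma partial_comp (G : R -> R) h x i (G' : R) : differentiable h x ->
  is_derive (h x) 1 G G' ->
  differentiable (G \o h : E -> R^o) x /\ partial i (G \o h) x = G' * partial i h x.
Proof.
move=> dh [dG dGE].
have dG1 : differentiable G (h x) by exact/derivable1_diffP.
have dc : differentiable (G \o h : E -> R^o) x by exact: differentiable_comp.
split=> //; rewrite /partial !deriveE//.
rewrite (@diff_comp _ _ _ _ h G)//= diff1E//= derive1E dGE.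
by rewrite mulrC.
Qed.

Lemma is_derive_inv (y : R) : y != 0 ->
  is_derive y 1 (@GRing.inv R) (- (y ^+ 2)^-1).
Proof.
move=> y0; have := is_deriveV (f := id) y0 (is_derive_id y 1).
by move=> h; apply: is_derive_eq h _; rewrite -[_ *: 1]/(_ * 1) mulr1.
Qed.

(** The class fed to [smooth_off0_coind]: smooth functions are atoms, and the derivative of each
    constructor is again a term over the same constructors. *)
Inductive calculus_closure : (E -> R^o) -> Prop :=
| cc_base f : smooth_off0 f -> calculus_closure f
| cc_cst (c : R) : calculus_closure (fun=> c)
| cc_coord i : calculus_closure (fun x => x 0 i)
| cc_add f g : calculus_closure f -> calculus_closure g ->
    calculus_closure (fun x => f x + g x)
| cc_mul f g : calculus_closure f -> calculus_closure g ->
    calculus_closure (fun x => f x * g x)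
| cc_exp f : calculus_closure f -> calculus_closure (fun x => expR (f x))
| cc_inv f : calculus_closure f -> (forall x, x != 0 -> f x != 0) ->
    calculus_closure (fun x => (f x)^-1)
| cc_sqrt f : calculus_closure f -> (forall x, x != 0 -> 0 < f x) ->
    calculus_closure (fun x => Num.sqrt (f x)).

Lemma partial_smooth_off0 i f : smooth_off0 f -> smooth_off0 (partial i f).
Proof. by move=> sf s x x0; have := sf (rcons s i) x x0; rewrite foldr_rcons. Qed.

Lemma partial_coord i j x : partial i (fun y : E => y 0 j : R^o) x = (i == j)%:R.
Proof.
rewrite /partial /derive; apply: cvg_lim => //.
have h0 : (fun=> (i == j)%:R : R^o) @ (0 : R)^' --> ((i == j)%:R : R^o).
  exact: cvg_cst.
apply: cvg_trans h0; apply: near_eq_cvg; near=> h.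
rewrite /= !mxE /= addrK eq_sym -[RHS]/(h^-1 * _) mulKf//.
near: h; exact: nbhs_dnbhs_neq.
Unshelve. all: by end_near. Qed.

Lemma calculus_closureP f : calculus_closure f -> smooth_off0 f.
Proof.
apply: smooth_off0_coind => {}f; elim => {f}.
- move=> f sf; split=> [x x0|i]; first exact: (sf [::]).
  by exists (partial i f); split => //; apply/cc_base/partial_smooth_off0.
- move=> c; split=> [x _|i]; first exact: differentiable_cst.
  exists (fun=> 0); split; first exact: cc_cst.
  by move=> x x0; rewrite /partial derive_cst.
- move=> j; split=> [x _|i]; first exact: differentiable_coord.
  exists (fun=> (i == j)%:R); split; first exact: cc_cst.
  by move=> x x0; exact: partial_coord.
- move=> f g cf [df pf] cg [dg pg]; split => [x x0|i].
    by apply: differentiableD; [exact: df|exact: dg].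
  have [f' [cf' ff']] := pf i; have [g' [cg' gg']] := pg i.
  exists (fun x => f' x + g' x); split; first exact: cc_add.
  move=> x x0; rewrite -ff'// -gg'//; apply: deriveD; apply: diff_derivable.
    exact: df.
  exact: dg.
- move=> f g cf [df pf] cg [dg pg]; split => [x x0|i].
    by apply: differentiableM; [exact: df|exact: dg].
  have [f' [cf' ff']] := pf i; have [g' [cg' gg']] := pg i.
  exists (fun x => f x * g' x + g x * f' x); split.
    by apply: cc_add; exact: cc_mul.
  move=> x x0; rewrite -ff'// -gg'//; apply: deriveM; apply: diff_derivable.
    exact: df.
  exact: dg.
- move=> f cf [df pf].
  have h x (x0 : x != 0) i :=
    partial_comp i (df _ x0) (is_derive_expR (f x)).
  split=> [x x0|i]; first by have [] := h x x0 ord0.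
  have [f' [cf' ff']] := pf i.
  exists (fun x => expR (f x) * f' x); split.
    by apply: cc_mul => //; exact: cc_exp.
  by move=> x x0; have [_ e] := h x x0 i; rewrite -ff'.
- move=> f cf [df pf] f0.
  have h x (x0 : x != 0) i :=
    partial_comp i (df _ x0) (is_derive_inv (f0 _ x0)).
  split=> [x x0|i]; first by have [] := h x x0 ord0.
  have [f' [cf' ff']] := pf i.
  exists (fun x => (-1) * (((f x)^-1 * (f x)^-1) * f' x)); split.
    by do 4?[apply: cc_mul => //; try exact: cc_cst; try exact: cc_inv].
  move=> x x0; have [_ e] := h x x0 i; rewrite -ff'//.
  by rewrite mulrA mulN1r -invfM -expr2.
- move=> f cf [df pf] f0.
  have h x (x0 : x != 0) i :=
    partial_comp i (df _ x0) (is_derive1_sqrt (f0 _ x0)).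
  split=> [x x0|i]; first by have [] := h x x0 ord0.
  have [f' [cf' ff']] := pf i.
  exists (fun x => (2 * Num.sqrt (f x))^-1 * f' x); split.
    apply: cc_mul => //; apply: cc_inv => [|x x0].
      by apply: cc_mul; [exact: cc_cst|exact: cc_sqrt].
    by rewrite mulf_neq0// gt_eqF// sqrtr_gt0 f0.
  by move=> x x0; have [_ e] := h x x0 i; rewrite -ff'.
Qed.

End smooth_functions.

(** * Tangential derivatives on the sphere *)

Section sphere_calculus.
Context (R : realType).
Local Notation E := 'rV[R]_3.
Implicit Types (x : E) (p : sphere R) (f g : sphere R -> R).

Definition radius x : R := Num.sqrt (dot x x).

Lemma radius_gt0 x : x != 0 -> 0 < radius x.
Proof. by move=> /dot_gt0; rewrite sqrtr_gt0. Qed.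

Lemma dotZ (c : R) x : dot (c *: x) (c *: x) = c ^+ 2 * dot x x.
Proof. by rewrite /dot mulr_sumr; apply: eq_bigr => i _; rewrite !mxE; ring. Qed.

Lemma vec_radial_proj x : x != 0 -> vec (radial_proj x) = (radius x)^-1 *: x.
Proof.
move=> x0; rewrite /radial_proj val_insubd ifT// dotZ exprVn.
by rewrite /radius sqr_sqrtr ?dot_ge0// mulVf// gt_eqF ?dot_gt0.
Qed.

Lemma dot_vec p : dot (vec p) (vec p) = 1. Proof. exact/eqP/vecP. Qed.

Lemma vec_neq0 p : vec p != 0.
Proof.
apply/eqP => p0; have := dot_vec p; rewrite p0 /dot big1 => [/esym/eqP|i _].
  by rewrite oner_eq0.
by rewrite mxE mul0r.
Qed.

Lemma radius_vec p : radius (vec p) = 1.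
Proof. by rewrite /radius dot_vec sqrtr1. Qed.

Lemma vec_inj : injective (@vec R). Proof. exact: val_inj. Qed.

Lemma radial_proj_vec p : radial_proj (vec p) = p.
Proof.
by apply: vec_inj; rewrite vec_radial_proj ?vec_neq0// radius_vec invr1 scale1r.
Qed.

Lemma radial_projZ (c : R) x : 0 < c -> radial_proj (c *: x) = radial_proj x.
Proof.
move=> c0; have [->|x0] := eqVneq x 0; first by rewrite scaler0.
have cx0 : c *: x != 0 by rewrite scaler_eq0 negb_or gt_eqF.
apply: vec_inj; rewrite !vec_radial_proj// /radius dotZ sqrtrM ?sqr_ge0//.
by rewrite sqrtr_sqr gtr0_norm// invfM scalerA mulrAC mulVf ?mul1r ?gt_eqF.
Qed.

Lemma extend_vec f p : extend f (vec p) = f p.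
Proof. by rewrite /extend radial_proj_vec. Qed.

Lemma smooth_off0_eq (f g : E -> R^o) : (forall x, x != 0 -> f x = g x) ->
  smooth_off0 f -> smooth_off0 g.
Proof.
move=> fg sf s x x0; apply: (@differentiable_eq _ (foldr (@partial R) f s)) => //.
  exact: partials_eq.
exact: sf.
Qed.

Lemma smooth_eq f (g : E -> R^o) :
  (forall x, x != 0 -> extend f x = g x) -> calculus_closure g -> smooth f.
Proof.
move=> fg /calculus_closureP; apply: smooth_off0_eq => x x0.
by rewrite fg.
Qed.

Lemma cc_radius : calculus_closure (radius : E -> R^o).
Proof.
apply: cc_sqrt => [|x /dot_gt0//].
rewrite (_ : (fun x => _) = fun x => x 0 0 * x 0 0 + x 0 1 * x 0 1 +
  x 0 2%:R * x 0 2%:R :> R^o).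
  by do 2?apply: cc_add; apply: cc_mul; exact: cc_coord.
apply/funext => x; rewrite /dot !big_ord_recl big_ord0 addr0 addrA.
by congr (_ + _ + _); congr (x _ _ * x _ _); exact/val_inj.
Qed.

Lemma cc_extend f : smooth f -> calculus_closure (extend f).
Proof. by move=> sf; exact: cc_base. Qed.

Lemma smooth_cst (c : R) : smooth (fun=> c : R).
Proof. by apply: (@smooth_eq _ (fun=> c)) => //; exact: cc_cst. Qed.

Lemma smooth_add f g : smooth f -> smooth g -> smooth (fun p => f p + g p).
Proof.
move=> /cc_extend sf /cc_extend sg.
exact: (@smooth_eq _ (fun x => extend f x + extend g x) _ (cc_add sf sg)).
Qed.

Lemma smooth_mul f g : smooth f -> smooth g -> smooth (fun p => f p * g p).
Proof.
move=> /cc_extend sf /cc_extend sg.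
exact: (@smooth_eq _ (fun x => extend f x * extend g x) _ (cc_mul sf sg)).
Qed.

Lemma smooth_exp f : smooth f -> smooth (fun p => expR (f p)).
Proof.
move=> /cc_extend sf.
exact: (@smooth_eq _ (fun x => expR (extend f x)) _ (cc_exp sf)).
Qed.

Lemma smooth_inv f : (forall p, f p != 0) -> smooth f -> smooth (fun p => (f p)^-1).
Proof.
move=> f0 /cc_extend sf.
apply: (@smooth_eq _ (fun x => (extend f x)^-1) _ (cc_inv sf _)) => // x _.
exact: f0.
Qed.

Lemma extend_coord j x : x != 0 -> extend (@coord R j) x = (radius x)^-1 * x 0 j.
Proof. by move=> x0; rewrite /extend /coord vec_radial_proj// mxE. Qed.

Lemma smooth_coord j : smooth (@coord R j).
Proof.
apply: (smooth_eq (@extend_coord j)); apply: cc_mul; last exact: cc_coord.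
apply: cc_inv; first exact: cc_radius.
by move=> x /radius_gt0/lt0r_neq0.
Qed.

Lemma extend_homogeneous f (c : R) x : 0 < c -> extend f (c *: x) = extend f x.
Proof. by move=> c0; rewrite /extend radial_projZ. Qed.

(** Differentiation of the degree 0 homogeneity of the extension: its partial derivatives have
    degree -1. *)
Lemma partial_extendZ f i (c : R) x : 0 < c -> smooth f -> x != 0 ->
  partial i (extend f) x = c * partial i (extend f) (c *: x).
Proof.
move=> c0 sf x0; have cx0 : c *: x != 0 by rewrite scaler_eq0 negb_or gt_eqF.
have df : differentiable (extend f) (c *: x) by exact: (sf [::]).
have ds : differentiable ( *:%R c : E -> E) x by [].
have dx : differentiable (extend f) x by exact: (sf [::]).
have fE : extend f \o *:%R c = extend f.
  by apply/funext => y /=; rewrite extend_homogeneous.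
have dE := diff_comp ds df; rewrite fE in dE.
have sE : 'd ( *:%R c : E -> E) x = *:%R c :> (E -> E) by exact: diff_val.
rewrite /partial (deriveE _ dx) (deriveE _ df).
have vE := congr1 (fun h : E -> E => h (delta_mx 0 i)) sE.
apply: (etrans (congr1 (fun h : E -> R^o => h (delta_mx 0 i)) dE)).
apply: (etrans (congr1 ('d (extend f) (c *: x)) vE)).
exact: linearZ.
Qed.

(** The partial derivative has degree -1, so its product with [radius] has degree 0, and on the
    sphere it equals [tderiv]. Smoothness of [tderiv] follows. *)
Lemma extend_tderiv f i x : smooth f -> x != 0 ->
  extend (tderiv i f) x = radius x * partial i (extend f) x.
Proof.
move=> sf x0; rewrite [LHS]/extend /tderiv vec_radial_proj//.
have r0 := radius_gt0 x0.
rewrite (@partial_extendZ f i (radius x)^-1 x) ?invr_gt0// mulrA divff ?mul1r//.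
by rewrite gt_eqF.
Qed.

Lemma smooth_tderiv f i : smooth f -> smooth (tderiv i f).
Proof.
move=> sf; apply: (smooth_eq (fun x => @extend_tderiv f i x sf)).
apply: cc_mul; first exact: cc_radius.
by apply: cc_base; exact: partial_smooth_off0.
Qed.

Lemma differentiable_extend f p : smooth f -> differentiable (extend f) (vec p).
Proof. by move=> sf; exact: (sf [::] _ (vec_neq0 p)). Qed.

Lemma tderiv_cst i (c : R) p : tderiv i (fun=> c : R) p = 0.
Proof. by rewrite /tderiv /partial derive_cst. Qed.

Lemma tderiv_add i f g p : smooth f -> smooth g ->
  tderiv i (fun p => f p + g p) p = tderiv i f p + tderiv i g p.
Proof.
move=> sf sg; apply: deriveD; apply: diff_derivable;
  exact: differentiable_extend.
Qed.

Lemma tderiv_mul i f g p : smooth f -> smooth g ->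
  tderiv i (fun p => f p * g p) p = f p * tderiv i g p + g p * tderiv i f p.
Proof.
move=> sf sg; rewrite -(extend_vec f p) -(extend_vec g p).
by apply: deriveM; apply: diff_derivable; exact: differentiable_extend.
Qed.

Lemma differentiable_coord_rV j x : differentiable (fun y : E => y 0 j : R^o) x.
Proof. exact: differentiable_coord. Qed.

Lemma differentiable_dot x : differentiable (fun y : E => dot y y : R^o) x.
Proof.
rewrite (_ : (fun y => _) = \sum_i (fun y : E => y 0 i * y 0 i : R^o)); last first.
  by apply/funext => y; rewrite /dot fct_sumE.
by apply: differentiable_sum => i; apply: differentiableM;
  exact: differentiable_coord_rV.
Qed.

Lemma partial_dot i x : partial i (fun y => dot y y : R^o) x = x 0 i *+ 2.
Proof.
rewrite (_ : (fun y => _) = \sum_i (fun y : E => y 0 i * y 0 i : R^o)); last first.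
  by apply/funext => y; rewrite /dot fct_sumE.
have dc j := diff_derivable (v := delta_mx 0 i) (differentiable_coord_rV j x).
rewrite /partial derive_sum => [|j]; last exact: derivableM.
under eq_bigr => j _.
  rewrite (deriveM (dc j) (dc j)) -/(partial i _ _) partial_coord. over.
rewrite (bigD1 i)//= eqxx big1 => [|j /negbTE ji]; last first.
  by rewrite eq_sym ji !scaler0 addr0.
by rewrite addr0 -!scalerDl -[RHS]mulr1 mulr2n.
Qed.

Lemma is_derive_sqrtV1 : is_derive (1 : R) 1 (fun y => (Num.sqrt y)^-1) (- 2^-1).
Proof.
have s1 : is_derive (1 : R) 1 Num.sqrt (2 * Num.sqrt 1)^-1 by exact: is_derive1_sqrt.
have s0 : Num.sqrt (1 : R) != 0 by rewrite sqrtr1 oner_eq0.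
have := is_deriveV s0 s1; rewrite sqrtr1 => h; apply: is_derive_eq h _.
by rewrite expr1n invr1 mulr1 scaleN1r.
Qed.

(** The extension of the coordinate is [x_j / |x|], whose gradient at [p] is the projection of [e_j]
    onto the plane orthogonal to [p]. *)
Lemma tderiv_coord i j p :
  tderiv i (@coord R j) p = (i == j)%:R - coord i p * coord j p.
Proof.
have rp : is_derive (dot (vec p) (vec p)) 1 (fun y => (Num.sqrt y)^-1) (- 2^-1).
  by rewrite dot_vec; exact: is_derive_sqrtV1.
have [dr pr] := partial_comp i (differentiable_dot (vec p)) rp.
rewrite /tderiv.
rewrite (@partial_eq R _ (fun x => ((fun y => (Num.sqrt y)^-1) \o (fun y => dot y y)) x * x 0 j)); last 2 first.
- by move=> x x0; rewrite extend_coord.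
- exact: vec_neq0.
have := deriveM (diff_derivable (v := delta_mx 0 i) dr)
  (diff_derivable (v := delta_mx 0 i) (differentiable_coord_rV j (vec p))).
rewrite -/(partial i _ _) => ->; rewrite -!/(partial i _ _) pr partial_coord.
rewrite partial_dot /= dot_vec sqrtr1 invr1 scale1r /coord; congr (_ + _).
by rewrite -[LHS]/(_ * _); field.
Qed.

Lemma derive_radial f p : 'D_(vec p) (extend f) (vec p) = 0.
Proof.
rewrite /derive; apply: cvg_lim => //.
have h0 : (fun=> 0 : R^o) @ (0 : R)^' --> (0 : R^o) by exact: cvg_cst.
apply: cvg_trans h0; apply: near_eq_cvg; near=> h.
have h1 : 0 < h + 1.
  have : `|h| < 1 by near: h; apply: dnbhs0_lt.
  by rewrite ltr_norml => /andP[]; lra.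
by rewrite /= -{2}[vec p]scale1r -scalerDl extend_homogeneous// subrr scaler0.
Unshelve. all: by end_near. Qed.

(** The extension is constant along rays, so its gradient is tangent to the sphere. *)
Lemma euler f p : smooth f -> \sum_i coord i p * tderiv i f p = 0.
Proof.
move=> sf; have df := differentiable_extend p sf.
rewrite -[RHS](derive_radial f p) (deriveE _ df).
rewrite (row_sum_delta (vec p)) linear_sum; apply: eq_bigr => i _.
rewrite linearZ /tderiv /partial (deriveE _ df) /coord.
by rewrite -row_sum_delta.
Qed.

End sphere_calculus.

(** * Integration on the sphere *)

Section sphere_measure.
Context (R : realType).
Local Notation E := 'rV[R]_3.
Implicit Types (x : E) (p : sphere R) (f g : sphere R -> R).

(** The sigma-algebra is generated by the coordinates, so measurability of an open set requires
    writing it as a countable union of coordinate boxes. *)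
Definition rat_box (qr : {ffun 'I_3 -> rat} * rat) : set E :=
  [set x | forall i, `|x 0 i - ratr (qr.1 i)| < ratr qr.2].

Lemma measurable_rat_box qr : measurable (@vec R @^-1` rat_box qr).
Proof.
rewrite (_ : _ @^-1` _ = \bigcap_i
  (@coord R i @^-1` [set y | `|y - ratr (qr.1 i)| < ratr qr.2])); last first.
  by apply/seteqP; split => p /= h i; [move=> _|]; exact: h.
apply: fin_bigcap_measurable => // i _.
rewrite -[X in measurable X]setTI; apply: measurable_coord => //.
have mf : measurable_fun [set: R] (fun y : R => `|y - ratr (qr.1 i)|).
  by apply: measurableT_comp => //; exact: measurable_funB.
have := mf measurableT `]-oo, (ratr qr.2)[%classic (measurable_itv _).
by rewrite setTI; congr measurable.
Qed.

Lemma open_rat_box (O : set E) x : open O -> O x ->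
  exists qr, rat_box qr x /\ rat_box qr `<=` O.
Proof.
move=> oO Ox; have /nbhs_ballP[e /= e0 eO] : nbhs x O by exact: open_nbhs_nbhs.
have [|r] := @rat_in_itvoo R 0 (e / 2); first by rewrite divr_gt0.
rewrite in_itv/= => /andP[r0 re].
have /choice[q hq] : forall i : 'I_3, exists q : rat, `|x 0 i - ratr q| < ratr r.
  move=> i; have [|q] := @rat_in_itvoo R (x 0 i - ratr r) (x 0 i + ratr r).
    by rewrite ltrD2l (lt_trans _ r0)// oppr_lt0.
  by rewrite in_itv/= => qx; exists q; rewrite distrC ltr_distl.
exists ([ffun i => q i], r); split=> [i|y hy].
  by rewrite /= ffunE; exact: hq.
apply: eO; split => // i j; rewrite (ord1 i) /ball/=.
have := hy j; rewrite /= ffunE; have := hq j.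
rewrite !ltr_norml => /andP[? ?] /andP[? ?]; apply/andP; split; lra.
Qed.

Lemma measurable_vec_open (O : set E) : open O -> measurable (@vec R @^-1` O).
Proof.
move=> oO.
pose F k := if unpickle k is Some qr then
  if `[< rat_box qr `<=` O >] then @vec R @^-1` rat_box qr else set0 else set0.
rewrite (_ : _ @^-1` _ = \bigcup_k F k); last first.
  apply/seteqP; split => [p Op|p [k _]].
    have [qr [qp qO]] := open_rat_box oO Op.
    by exists (pickle qr) => //; rewrite /F pickleK; case: asboolP.
  by rewrite /F; case: unpickle => [qr|//]; case: asboolP => // qO; exact: qO.
apply: bigcupT_measurable => k; rewrite /F; case: unpickle => [qr|]//.
by case: ifP => _ //; exact: measurable_rat_box.
Qed.

Lemma continuous_extend f x : smooth f -> x != 0 -> {for x, continuous (extend f)}.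
Proof. by move=> sf x0; apply: differentiable_continuous; exact: (sf [::]). Qed.

(** The preimage of an open interval is the trace on the sphere of an open set of R^3: the extension
    is continuous off the origin. *)
Lemma measurable_smooth f : smooth f -> measurable_fun setT f.
Proof.
move=> sf _; apply: (measurability _ (RGenOpens.measurableE R)) => //.
move=> _ [_ [a [b ->] <-]]; rewrite setTI.
have oab : open `]a, b[%classic by exact: interval_open.
rewrite (_ : f @^-1` _ = @vec R @^-1` [set x | x != 0 /\ `]a, b[%classic (extend f x)]).
  apply: measurable_vec_open; rewrite openE => x [x0 fx].
  have h1 := nonzero_near x0.
  have h2 : \forall y \near x, `]a, b[%classic (extend f y).
    by apply: (continuous_extend sf x0); exact: open_nbhs_nbhs.
  by apply: filterS2 h1 h2.
apply/seteqP; split => p /=; rewrite extend_vec; first by rewrite vec_neq0.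
by case.
Qed.

(** The extreme value theorem for the extension on the unit sphere, a compact set of R^3. *)
Lemma bounded_smooth f : smooth f -> exists M : R, forall p, `|f p| <= M.
Proof.
move=> sf; pose A : set E := [set x | dot x x = 1].
have A0 : A !=set0 by exists (vec point); exact: dot_vec.
have cA : compact A.
  apply: bounded_closed_compact.
    exists 2; split => // M M1 x Ax; apply: ltW; apply: lt_trans M1.
    have : ball (0 : E) 2 x.
      split => // i j; rewrite (ord1 i) /ball/= mxE sub0r normrN.
      have : x 0 j ^+ 2 <= 1.
        rewrite -Ax /dot (bigD1 j)//= -expr2 lerDl.
        by apply: sumr_ge0 => k _; rewrite -expr2 sqr_ge0.
      rewrite -real_normK ?num_real// => h.
      have := normr_ge0 (x 0 j); nra.
    by rewrite -ball_normE /ball_/= sub0r normrN.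
  rewrite (_ : A = (fun x => dot x x : R^o) @^-1` [set 1]) //.
  apply: closed_comp => [x _|]; last exact: closed_eq.
  exact/differentiable_continuous/differentiable_dot.
have cf : {within A, continuous (extend f)}.
  apply: continuous_in_subspaceT => x; rewrite inE => Ax.
  apply: continuous_extend => //; apply/eqP => x0; move: Ax.
  rewrite x0 /A /= /dot big1 => [/esym/eqP|i _]; first by rewrite oner_eq0.
  by rewrite mxE mul0r.
have [c _ fc] := EVT_max_rV A0 cA cf.
have [d _ fd] := EVT_min_rV A0 cA cf.
exists (Num.max `|extend f c| `|extend f d|) => p.
have pA : vec p \in A by rewrite inE; exact: dot_vec.
have := fc _ pA; have := fd _ pA; rewrite !extend_vec => h1 h2.
rewrite ler_norml lerNl !le_max; apply/andP; split; apply/orP.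
  by right; rewrite -normrN (le_trans _ (ler_norm _))// lerN2.
by left; rewrite (le_trans h2)// ler_norm.
Qed.

Lemma area_fin : (@area R setT < +oo)%E.
Proof.
rewrite /area preimage_setT /area_element -integral_mkcond.
set D := (X in integral _ X _).
have mD : measurable D.
  by apply: measurableX; exact: measurable_itv.
apply: (@le_lt_trans _ _ (\int[lebesgue_measure \x lebesgue_measure]_(z in D)
   (1 : R)%:E)%E).
  apply: ge0_le_integral => //.
  - move=> -[t p] [/=]; rewrite in_itv /= => t0pi _.
    by rewrite lee_fin sin_ge0_pi.
  - apply: measurable_funTS; apply/measurable_EFinP.
    by apply: measurableT_comp => //; apply: continuous_measurable_fun;
      exact: continuous_sin.
  - by move=> z _; rewrite lee_fin sin_le1.
rewrite integral_cst// mul1e /D /= product_measure1E; [|exact: measurable_itv..].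
have h (b : R) : (lebesgue_measure (`[0%R, b]%classic : set R) < +oo)%E.
  by rewrite lebesgue_measure_itv/=; case: ifP => _; rewrite ?oppr0 ?addr0 ?sube0 ?ltry.
by apply: lte_mul_pinfty; [exact: measure_ge0|rewrite ge0_fin_numE ?measure_ge0//|]; exact: h.
Qed.

End sphere_measure.

(** * Change of variables for a measure given by a density *)

Section density_pushforward.
Context d1 d2 (X : measurableType d1) (Y : measurableType d2) (R : realType).
Context (mu : {measure set X -> \bar R}) (nu : {measure set Y -> \bar R}).
Context (phi : X -> Y) (mphi : measurable_fun setT phi).
Context (w : X -> \bar R) (mw : measurable_fun setT w) (w0 : forall x, (0 <= w x)%E)
  (wfin : forall x, w x \is a fin_num).
Context (nuE : forall A, measurable A -> nu A = (\int[mu]_(x in phi @^-1` A) w x)%E).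
Local Open Scope ereal_scope.
Import HBNNSimple.

(** Level sets of simple functions reduce to [nuE]; monotone convergence does the rest. *)
Lemma ge0_integral_density (f : Y -> \bar R) : measurable_fun setT f ->
  (forall y, 0 <= f y) -> \int[nu]_y f y = \int[mu]_x (f (phi x) * w x).
Proof.
move=> mf f0; pose f_ := nnsfun_approx measurableT mf.
have mfphi n : measurable_fun setT (fun x => (f_ n (phi x))%:E).
  apply/measurable_EFinP; apply: measurableT_comp => //; exact: measurable_funP.
have fw0 n x : 0 <= (f_ n (phi x))%:E * w x.
  by rewrite mule_ge0// lee_fin.
have ndf m n : (m <= n)%N -> forall y, (f_ m y <= f_ n y)%R.
  by move=> mn y; exact/lefP/nd_nnsfun_approx.
transitivity (limn (fun n => \int[nu]_y (f_ n y)%:E)).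
  rewrite -monotone_convergence//.
  - apply: eq_integral => y _; apply/esym/cvg_lim => //.
    exact: cvg_nnsfun_approx.
  - by move=> n; exact/measurable_EFinP/measurable_funP.
  - by move=> n y _; rewrite lee_fin.
  - by move=> y _ m n mn; rewrite lee_fin; exact: ndf.
rewrite [X in limn X](_ : _ =
    (fun n => \int[mu]_x ((f_ n (phi x))%:E * w x))).
  rewrite -monotone_convergence//; last 2 first.
  - by move=> n; apply: emeasurable_funM.
  - by move=> x _ m n mn; rewrite lee_wpmul2r// lee_fin; exact: ndf.
  apply: eq_integral => x _; apply/cvg_lim => //.
  by apply: cvgeMr => //; exact: cvg_nnsfun_approx.
apply/funext => n.
have mA r : measurable (f_ n @^-1` [set r]) by [].
have mphiA r : measurable (phi @^-1` (f_ n @^-1` [set r])).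
  by rewrite -[X in measurable X]setTI; exact: mphi.
rewrite integralT_nnsfun sintegralE.
under [RHS]eq_integral => x _.
  rewrite fimfunE -fsumEFin// ge0_mule_fsuml; last first.
    by move=> r; rewrite nnfun_muleindic_ge0.
  over.
rewrite ge0_integral_fsum//; last 2 first.
- move=> r; apply: emeasurable_funM => //.
  apply/measurable_EFinP; apply: measurable_funM => //.
  by apply: measurableT_comp mphi; exact: measurable_indic.
- by move=> r x _; rewrite mule_ge0// nnfun_muleindic_ge0.
apply: eq_fsbigr => r _.
(* A nonnegative simple function does not take a negative value [r]: the level set is empty and both
   sides are [0]. *)
have [r0|r0] := leP 0%R r; last first.
  rewrite preimage_nnfun0// measure0 mule0 integral0_eq// => x _.
  by rewrite indicE in_set0 mulr0 mul0e.
rewrite nuE//.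
under [RHS]eq_integral do rewrite EFinM -muleA.
rewrite ge0_integralZl//.
  congr (_ * _); rewrite integral_mkcond; apply: eq_integral => x _.
  rewrite patchE indicE.
  have -> : (x \in phi @^-1` (f_ n @^-1` [set r])) = (phi x \in f_ n @^-1` [set r]).
    by apply/idP/idP; rewrite !inE.
  by case: (_ \in _); rewrite ?mul1e ?mul0e.
- apply: emeasurable_funM => //; apply/measurable_EFinP.
  by apply: measurableT_comp mphi; exact: measurable_indic.
- by move=> x _; rewrite mule_ge0// lee_fin.
Qed.

Lemma integral_density (f : Y -> \bar R) : measurable_fun setT f ->
  \int[nu]_y f y = \int[mu]_x (f (phi x) * w x).
Proof.
move=> mf; rewrite [LHS]integralE [RHS]integralE.
rewrite !ge0_integral_density//; [|exact: measurable_funeneg|exact: measurable_funepos].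
congr (_ - _); apply: eq_integral => x _.
  by rewrite !funeposE maxe_pMl// mul0e.
by rewrite !funenegE maxe_pMl// mul0e mulNe.
Qed.
End density_pushforward.

Section curves.
Context (R : realType).
Local Notation E := 'rV[R]_3.

(** The chain rule in R^3 for the extension, whose partial derivatives at points of the sphere are
    the [tderiv]. *)
Lemma is_derive_curve (f : sphere R -> R) (g : R -> sphere R) (t : R) (v : 'I_3 -> R) :
  smooth f -> (forall i, is_derive t 1 (fun s => coord i (g s)) (v i)) ->
  is_derive t 1 (f \o g) (\sum_i v i * tderiv i f (g t)).
Proof.
move=> sf dg.
have fE : f \o g = extend f \o (fun s => vec (g s)).
  by apply/funext => s /=; rewrite extend_vec.
have dvg : derivable (fun s => vec (g s)) t 1.
  by apply/derivable_mxP => i j; rewrite (ord1 i); case: (dg j).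
have dG : differentiable (fun s : R => vec (g s)) t by exact/derivable1_diffP.
have df := differentiable_extend (g t) sf.
have dfg : differentiable (f \o g : R -> R^o) t.
  by rewrite fE; exact: differentiable_comp.
have dE : 'D_1 (f \o g : R -> R^o) t = \sum_i v i * tderiv i f (g t).
  rewrite (deriveE _ dfg).
  have e := diff_comp dG df; rewrite -[X in 'd X t]/(extend f \o (fun s => vec (g s))) in e.
  rewrite -fE in e.
  apply: (etrans (congr1 (fun h : R -> R^o => h 1) e)).
  have vE : 'd (fun s => vec (g s)) t 1 = \row_i v i.
    rewrite -(deriveE _ dG) derive_mx//; apply/rowP => i; rewrite !mxE.
    by case: (dg i).
  apply: (etrans (congr1 ('d (extend f) (vec (g t))) vE)).
  rewrite (row_sum_delta (\row_i v i)) linear_sum; apply: eq_bigr => i _.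
  by rewrite linearZ mxE /tderiv /partial (deriveE _ df).
by split; [exact/derivable1_diffP|exact: dE].
Qed.

End curves.

(** * Integrals of exact derivatives over a rectangle *)

Section rectangle.
Context (R : realType).
Local Notation mu := (@lebesgue_measure R).
Implicit Types (a b c d : R).

Lemma segment_FTC (F f : R -> R) a b : a < b -> continuous f ->
  (forall x : R, is_derive x 1 F (f x)) -> F a = F b ->
  (\int[mu]_(x in `[a, b]) (f x)%:E = 0)%E.
Proof.
move=> ab cf dF Fab; rewrite (@continuous_FTC2 _ f F a b) //.
- by rewrite Fab -EFinB subrr.
- exact: continuous_subspaceT.
- have cF x : {for x, continuous F}.
    by apply: differentiable_continuous; apply/derivable1_diffP; case: (dF x).
  split=> [x _||]; first by case: (dF x).
    by apply: cvg_at_right_filter; exact: cF.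
  by apply: cvg_at_left_filter; exact: cF.
- by move=> x _; rewrite derive1E; case: (dF x).
Qed.

Lemma bounded_integrable_rectangle (h : R * R -> R) M a b c d :
  measurable_fun setT h -> (forall z, `|h z| <= M) ->
  (mu \x mu)%E.-integrable (`[a, b]%classic `*` `[c, d]%classic) (EFin \o h).
Proof.
move=> mh hM; apply: measurable_bounded_integrable.
- by apply: measurableX; exact: measurable_itv.
- rewrite /= product_measure1E; [|exact: measurable_itv..].
  have hi (x y : R) : (mu `[x, y]%classic < +oo)%E.
    by rewrite lebesgue_measure_itv/=; case: ifP => _; rewrite ?ltry// -EFinB ltry.
  by apply: lte_mul_pinfty; [exact: measure_ge0|rewrite ge0_fin_numE ?measure_ge0//|];
    exact: hi.
- exact: measurable_funTS.
- exists M; split; first exact: num_real.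
  by move=> N MN z _; rewrite /= (le_trans (hM z))// ltW.
Qed.

(** By Fubini the inner integral is that of a derivative between two points where the primitive has
    equal values. *)
Lemma integral_rectangle1 (F f : R -> R -> R) M a b c d : a < b ->
  measurable_fun setT (fun z : R * R => f z.1 z.2) ->
  (forall x y, `|f x y| <= M) -> (forall y, continuous (f ^~ y)) ->
  (forall x y : R, is_derive x 1 (F ^~ y) (f x y)) -> (forall y, F a y = F b y) ->
  (\int[mu \x mu]_(z in `[a, b]%classic `*` `[c, d]%classic) (f z.1 z.2)%:E = 0)%E.
Proof.
move=> ab mf fM cf dF Fab; rewrite integral_mkcond.
have mD : measurable (`[a, b]%classic `*` `[c, d]%classic : set (R * R)).
  by apply: measurableX; exact: measurable_itv.
rewrite -integral21_prod_meas1; last first.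
  have hI := @bounded_integrable_rectangle (fun z => f z.1 z.2) M a b c d mf
    (fun z => fM z.1 z.2).
  exact: (@integrable_mkcond _ _ R (mu \x mu)%E _ (fun z => (f z.1 z.2)%:E) mD).1 hI.
apply: integral0_eq => y _; rewrite /fubini_G.
have [yc|yc] := boolP (y \in `[c, d]).
  rewrite -[RHS](segment_FTC ab (cf y) (dF^~ y) (Fab y)) [RHS]integral_mkcond.
  apply: eq_integral => x _; rewrite !patchE.
  rewrite (_ : ((x, y) \in _) = (x \in `[a, b]%classic))//.
  by apply/idP/idP; rewrite !inE /=; [case|split].
apply: integral0_eq => x _; rewrite patchE ifF//.
by apply/negP; rewrite inE => -[_ /= /(elimN idP yc)].
Qed.

Lemma integral_rectangle2 (F f : R -> R -> R) M a b c d : c < d ->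
  measurable_fun setT (fun z : R * R => f z.1 z.2) ->
  (forall x y, `|f x y| <= M) -> (forall x, continuous (f x)) ->
  (forall x y : R, is_derive y 1 (F x) (f x y)) -> (forall x, F x c = F x d) ->
  (\int[mu \x mu]_(z in `[a, b]%classic `*` `[c, d]%classic) (f z.1 z.2)%:E = 0)%E.
Proof.
move=> cd mf fM cf dF Fcd; rewrite integral_mkcond.
have mD : measurable (`[a, b]%classic `*` `[c, d]%classic : set (R * R)).
  by apply: measurableX; exact: measurable_itv.
rewrite -integral12_prod_meas1; last first.
  have hI := @bounded_integrable_rectangle (fun z => f z.1 z.2) M a b c d mf
    (fun z => fM z.1 z.2).
  exact: (@integrable_mkcond _ _ R (mu \x mu)%E _ (fun z => (f z.1 z.2)%:E) mD).1 hI.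
apply: integral0_eq => x _; rewrite /fubini_F.
have [xa|xa] := boolP (x \in `[a, b]).
  rewrite -[RHS](segment_FTC cd (cf x) (dF x) (Fcd x)) [RHS]integral_mkcond.
  apply: eq_integral => y _; rewrite !patchE.
  rewrite (_ : ((x, y) \in _) = (y \in `[c, d]%classic))//.
  by apply/idP/idP; rewrite !inE /=; [case|split].
apply: integral0_eq => y _; rewrite patchE ifF//.
by apply/negP; rewrite inE => -[/= /(elimN idP xa)].
Qed.

End rectangle.

Lemma sum_ord3 (V : nmodType) (g : 'I_3 -> V) : \sum_i g i = g 0 + g 1 + g 2%:R.
Proof.
rewrite !big_ord_recl big_ord0 addr0 addrA.
by congr (g _ + g _ + g _); exact/val_inj.
Qed.

(** * Integration by parts on the sphere in spherical coordinates *)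

Section integration_by_parts.
Context (R : realType).
Implicit Types (f : sphere R -> R) (h : R -> R -> R).

(** The regularity that Fubini and the fundamental theorem require in either variable, packaged so
    as to be stable under sums and products. *)
Record tame h : Prop := Tame {
  tame_measurable : measurable_fun setT (fun z : R * R => h z.1 z.2) ;
  tame_bounded : exists M, forall x y, `|h x y| <= M ;
  tame_continuous1 : forall y, continuous (h ^~ y) ;
  tame_continuous2 : forall x, continuous (h x) }.

Lemma tame_add h1 h2 : tame h1 -> tame h2 -> tame (fun x y => h1 x y + h2 x y).
Proof.
move=> [m1 [M1 b1] c1 d1] [m2 [M2 b2] c2 d2]; split.
- exact: measurable_funD.
- by exists (M1 + M2) => x y; rewrite (le_trans (ler_normD _ _))// lerD.
- by move=> y x; apply: cvgD; [exact: c1|exact: c2].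
- by move=> x y; apply: cvgD; [exact: d1|exact: d2].
Qed.

Lemma tame_mul h1 h2 : tame h1 -> tame h2 -> tame (fun x y => h1 x y * h2 x y).
Proof.
move=> [m1 [M1 b1] c1 d1] [m2 [M2 b2] c2 d2]; split.
- exact: measurable_funM.
- by exists (M1 * M2) => x y; rewrite normrM ler_pM.
- by move=> y x; apply: cvgM; [exact: c1|exact: c2].
- by move=> x y; apply: cvgM; [exact: d1|exact: d2].
Qed.

Lemma tame_cst (c : R) : tame (fun _ _ => c).
Proof.
split => [||y x|x y]; first exact: measurable_cst.
- by exists (`|c|).
- exact: cvg_cst.
- exact: cvg_cst.
Qed.

Lemma tame_fst (g : R -> R) M : continuous g -> (forall x, `|g x| <= M) ->
  tame (fun x _ => g x).
Proof.
move=> cg gM; split => [||y x|x y]; [|by exists M|exact: cg|exact: cvg_cst].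
by apply: measurableT_comp => //; exact: continuous_measurable_fun.
Qed.

Lemma tame_snd (g : R -> R) M : continuous g -> (forall x, `|g x| <= M) ->
  tame (fun _ y => g y).
Proof.
move=> cg gM; split => [||y x|x y]; [|by exists M|exact: cvg_cst|exact: cg].
by apply: measurableT_comp => //; exact: continuous_measurable_fun.
Qed.

Lemma norm_sin_le1 (x : R) : `|sin x| <= 1.
Proof. by rewrite ler_norml sin_geN1 sin_le1. Qed.

Lemma norm_cos_le1 (x : R) : `|cos x| <= 1.
Proof. by rewrite ler_norml cos_geN1 cos_le1. Qed.

Definition dtheta_coord (t p : R) (i : 'I_3) : R :=
  [:: cos t * cos p; cos t * sin p; - sin t]`_i.
Definition dphi_coord (t p : R) (i : 'I_3) : R :=
  [:: - (sin t * sin p); sin t * cos p; 0]`_i.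

Lemma is_derive_theta (t p : R) i :
  is_derive t 1 (fun s => coord i (spherical (s, p))) (dtheta_coord t p i).
Proof.
case: i => [[|[|[|//]]] ?]; rewrite /coord /dtheta_coord /=.
- rewrite (_ : (fun s => _) = (fun s => sin s * cos p)); last first.
    by apply/funext => s; rewrite mxE.
  apply: is_derive_eq; rewrite scaler0 add0r -[LHS]/(_ * _).
  ring.
- rewrite (_ : (fun s => _) = (fun s => sin s * sin p)); last first.
    by apply/funext => s; rewrite mxE.
  apply: is_derive_eq; rewrite scaler0 add0r -[LHS]/(_ * _).
  ring.
- rewrite (_ : (fun s => _) = cos); first exact: is_derive_cos.
  by apply/funext => s; rewrite mxE.
Qed.

Lemma is_derive_phi (t p : R) i :
  is_derive p 1 (fun s => coord i (spherical (t, s))) (dphi_coord t p i).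
Proof.
case: i => [[|[|[|//]]] ?]; rewrite /coord /dphi_coord /=.
- rewrite (_ : (fun s => _) = (fun s => sin t * cos s)); last first.
    by apply/funext => s; rewrite mxE.
  apply: is_derive_eq; rewrite -[LHS]/(_ * _).
  ring.
- rewrite (_ : (fun s => _) = (fun s => sin t * sin s)); last first.
    by apply/funext => s; rewrite mxE.
  apply: is_derive_eq; rewrite -[LHS]/(_ * _).
  ring.
- rewrite (_ : (fun s => _) = cst (cos t)); first exact: is_derive_cst.
  by apply/funext => s; rewrite mxE.
Qed.

Lemma tame_spherical f : smooth f -> tame (fun t p => f (spherical (t, p))).
Proof.
move=> sf; split.
- rewrite (_ : (fun z => _) = f \o @spherical R); last by apply/funext => -[].
  by apply: measurableT_comp; [exact: measurable_smooth|exact: measurable_spherical].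
- by have [M fM] := bounded_smooth sf; exists M.
- move=> y x; apply: differentiable_continuous; apply/derivable1_diffP.
  by have [] := is_derive_curve sf (is_derive_theta x y).
- move=> x y; apply: differentiable_continuous; apply/derivable1_diffP.
  by have [] := is_derive_curve sf (is_derive_phi x y).
Qed.

Lemma integral_area f : smooth f -> (\int[@area R]_p (f p)%:E =
  \int[lebesgue_measure \x lebesgue_measure]_(z in
     `[0%R, pi]%classic `*` `[0%R, (pi *+ 2)%R]%classic)
     (f (spherical z) * sin z.1)%:E)%E.
Proof.
move=> sf; rewrite (@integral_density _ _ _ _ _
   (lebesgue_measure \x lebesgue_measure)%E (@area R) (@spherical R)
   (@measurable_spherical R) (@area_element R) (@measurable_area_element R)
   (@area_element_ge0 R)) //.
- rewrite [RHS]integral_mkcond; apply: eq_integral => z _.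
  by rewrite /area_element !patchE; case: ifPn => _; rewrite ?mule0// EFinM.
- by move=> z; rewrite /area_element patchE; case: ifPn.
- by apply/measurable_EFinP; exact: measurable_smooth.
Qed.

Local Notation box := (`[0%R, pi]%classic `*` `[0%R, (pi *+ 2)%R]%classic).
Local Notation mu2 := (lebesgue_measure \x lebesgue_measure)%E.

Let F f (t p : R) := f (spherical (t, p)).
Let dF f (v : R -> R -> 'I_3 -> R) (t p : R) :=
  \sum_i v t p i * F (tderiv i f) t p.

Lemma tame_sum (n : nat) (h : 'I_n -> R -> R -> R) : (forall i, tame (h i)) ->
  tame (fun x y => \sum_i h i x y).
Proof.
elim: n h => [|n IH] h th.
  rewrite (_ : (fun x y => _) = fun _ _ => 0); first exact: tame_cst.
  by apply/funext => x; apply/funext => y; rewrite big_ord0.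
rewrite (_ : (fun x y => _) =
   fun x y => h ord0 x y + \sum_i h (lift ord0 i) x y).
  by apply: tame_add => //; exact: IH.
by apply/funext => x; apply/funext => y; rewrite big_ord_recl.
Qed.

Lemma tame_sin1 : tame (fun x _ => sin x).
Proof. exact: tame_fst (@continuous_sin R) norm_sin_le1. Qed.
Lemma tame_cos1 : tame (fun x _ => cos x).
Proof. exact: tame_fst (@continuous_cos R) norm_cos_le1. Qed.
Lemma tame_sin2 : tame (fun _ y => sin y).
Proof. exact: tame_snd (@continuous_sin R) norm_sin_le1. Qed.
Lemma tame_cos2 : tame (fun _ y => cos y).
Proof. exact: tame_snd (@continuous_cos R) norm_cos_le1. Qed.

Lemma tame_opp h : tame h -> tame (fun x y => - h x y).
Proof.
move=> th; rewrite (_ : (fun x y => _) = fun x y => -1 * h x y).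
  by apply: tame_mul => //; exact: tame_cst.
by apply/funext => x; apply/funext => y; rewrite mulN1r.
Qed.

Lemma tame_dtheta f : smooth f -> tame (dF f dtheta_coord).
Proof.
move=> sf; apply: tame_sum => i; apply: tame_mul; last first.
  by apply: tame_spherical; exact: smooth_tderiv.
case: i => [[|[|[|//]]] ?]; rewrite /dtheta_coord /=.
- exact: tame_mul tame_cos1 tame_cos2.
- exact: tame_mul tame_cos1 tame_sin2.
- exact: tame_opp tame_sin1.
Qed.

Lemma tame_dphi f : smooth f -> tame (dF f dphi_coord).
Proof.
move=> sf; apply: tame_sum => i; apply: tame_mul; last first.
  by apply: tame_spherical; exact: smooth_tderiv.
case: i => [[|[|[|//]]] ?]; rewrite /dphi_coord /=.
- exact: tame_opp (tame_mul tame_sin1 tame_sin2).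
- exact: tame_mul tame_sin1 tame_cos2.
- exact: tame_cst.
Qed.

(** The theta component of the field carries no flux: [a] vanishes at both poles. *)
Lemma integral_box_theta f (a a' b : R -> R) : smooth f ->
  tame (fun x _ => a x) -> tame (fun x _ => a' x) -> tame (fun _ y => b y) ->
  (forall x : R, is_derive x 1 a (a' x)) -> a 0 = 0 -> a pi = 0 ->
  let g x y := a' x * b y * F f x y + a x * b y * dF f dtheta_coord x y in
  tame g /\ (\int[mu2]_(z in box) (g z.1 z.2)%:E = 0)%E.
Proof.
move=> sf ta ta' tb da a0 api /=.
pose G x y := a x * b y * F f x y.
set g := fun x y => a' x * b y * F f x y + a x * b y * dF f dtheta_coord x y.
have tg : tame g.
  apply: tame_add; apply: tame_mul; try exact: tame_mul.
    exact: tame_spherical.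
  exact: tame_dtheta.
have [mg [M gM] cg _] := tg; split => //.
apply: (@integral_rectangle1 _ G g M) => //; first exact: pi_gt0.
- move=> x y; have dFx := is_derive_curve sf (is_derive_theta x y).
  have dax := da x; rewrite /G /F.
  have h1 : is_derive x 1 (fun s => a s * b y) (a' x * b y).
    apply: is_derive_eq; rewrite scaler0 add0r -[LHS]/(_ * _); ring.
  have h2 := is_deriveM h1 dFx.
  apply: is_derive_eq h2 _; rewrite /g /dF /F -!/(_ * _) /=.
  by rewrite addrC -[X in X + _]/(_ * _) -[X in _ + X]/(_ * _) mulrC.
- by move=> y; rewrite /G a0 api !mul0r.
Qed.

(** The sides phi = 0 and phi = 2 pi are the same meridian, so the fluxes through them cancel. *)
Lemma integral_box_phi f (b b' : R -> R) : smooth f ->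
  tame (fun _ y => b y) -> tame (fun _ y => b' y) ->
  (forall x : R, is_derive x 1 b (b' x)) -> b (pi *+ 2) = b 0 ->
  let g x y := b' y * F f x y + b y * dF f dphi_coord x y in
  tame g /\ (\int[mu2]_(z in box) (g z.1 z.2)%:E = 0)%E.
Proof.
move=> sf tb tb' db bpi /=.
pose G x y := b y * F f x y.
set g := fun x y => b' y * F f x y + b y * dF f dphi_coord x y.
have tg : tame g.
  apply: tame_add; apply: tame_mul => //.
    exact: tame_spherical.
  exact: tame_dphi.
have [mg [M gM] _ cg] := tg; split => //.
apply: (@integral_rectangle2 _ G g M) => //.
- by rewrite mulrn_wgt0// pi_gt0.
- move=> x y; have dFx := is_derive_curve sf (is_derive_phi x y).
  have h2 := is_deriveM (db y) dFx.
  apply: is_derive_eq h2 _; rewrite /g /dF /F /=.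
  by rewrite addrC -[X in X + _]/(_ * _) -[X in _ + X]/(_ * _) mulrC.
- move=> x; rewrite /G bpi; congr (_ * f _); apply: vec_inj; apply/rowP => i.
  by rewrite !mxE /= -[pi *+ 2]add0r cosD2pi sinD2pi.
Qed.

Lemma coord_spherical i (t p : R) :
  coord i (spherical (t, p)) = [:: sin t * cos p; sin t * sin p; cos t]`_i.
Proof. by rewrite /coord mxE. Qed.

Lemma integral_box_add (k : R * R -> R) g1 g2 : tame g1 -> tame g2 ->
  (\int[mu2]_(z in box) (g1 z.1 z.2)%:E = 0)%E ->
  (\int[mu2]_(z in box) (g2 z.1 z.2)%:E = 0)%E ->
  (forall t p, k (t, p) = g1 t p + g2 t p) ->
  (\int[mu2]_(z in box) (k z)%:E = 0)%E.
Proof.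
move=> [m1 [M1 b1] _ _] [m2 [M2 b2] _ _] i1 i2 kE.
have mD : measurable (box : set (R * R)).
  by apply: measurableX; exact: measurable_itv.
have h1 := @bounded_integrable_rectangle R (fun z => g1 z.1 z.2) M1
  0 pi 0 (pi *+ 2) m1 (fun z => b1 z.1 z.2).
have h2 := @bounded_integrable_rectangle R (fun z => g2 z.1 z.2) M2
  0 pi 0 (pi *+ 2) m2 (fun z => b2 z.1 z.2).
have := @integralD_EFin _ _ R mu2 box mD (fun z => g1 z.1 z.2)
  (fun z => g2 z.1 z.2) h1 h2; rewrite i1 i2 adde0 => <-.
by apply: eq_integral => -[t p] _; rewrite kE.
Qed.

(* In spherical coordinates [(D_i f - 2 x_i f) sin theta] is the divergence
   of a field on the coordinate rectangle with no flux through its boundary. *)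
Lemma integral_tderiv_eq0 f i : smooth f ->
  (\int[@area R]_p (tderiv i f p - 2 * (coord i p * f p))%:E = 0)%E.
Proof.
move=> sf; pose h p := tderiv i f p - 2 * (coord i p * f p).
have sh : smooth h.
  rewrite /h (_ : (fun p => _) = fun p => tderiv i f p + (-2) * (coord i p * f p)).
    apply: smooth_add; first exact: smooth_tderiv.
    apply: smooth_mul; first exact: smooth_cst.
    by apply: smooth_mul => //; exact: smooth_coord.
  by apply/funext => p; rewrite mulNr.
rewrite -[LHS]/(\int[@area R]_p (h p)%:E)%E integral_area// /h {h sh}.
have tF := tame_spherical sf.
have tt := tame_dtheta sf; have tp := tame_dphi sf.
have [G GE] := exist (fun g => g = F f) _ erefl.
have [F0 F0E] := exist (fun g => g = F (tderiv 0 f)) _ erefl.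
have [F1 F1E] := exist (fun g => g = F (tderiv 1 f)) _ erefl.
have [F2 F2E] := exist (fun g => g = F (tderiv 2%:R f)) _ erefl.
have eul t p : sin t * cos p * F0 t p + sin t * sin p * F1 t p + cos t * F2 t p = 0.
  by rewrite -[RHS](euler (spherical (t, p)) sf) sum_ord3 !coord_spherical F0E F1E F2E.
have cs (x : R) : cos x * cos x = 1 - sin x * sin x.
  by have := cos2Dsin2 x; rewrite !expr2 => <-; rewrite addrK.
have dthE t p : dF f dtheta_coord t p =
    cos t * cos p * F0 t p + cos t * sin p * F1 t p + - sin t * F2 t p.
  by rewrite /dF sum_ord3 F0E F1E F2E.
have dphE t p : dF f dphi_coord t p =
    - (sin t * sin p) * F0 t p + sin t * cos p * F1 t p + 0 * F2 t p.
  by rewrite /dF sum_ord3 F0E F1E F2E.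
have GE' t p : f (spherical (t, p)) = G t p by rewrite GE.
have GF t p : F f t p = G t p by rewrite GE.
have F0' t p : tderiv 0 f (spherical (t, p)) = F0 t p by rewrite F0E.
have F1' t p : tderiv 1 f (spherical (t, p)) = F1 t p by rewrite F1E.
have F2' t p : tderiv 2%:R f (spherical (t, p)) = F2 t p by rewrite F2E.
have dsin2 (x : R) : is_derive x 1 (fun x => sin x * sin x) (2 * (sin x * cos x)).
  by apply: is_derive_eq; rewrite -[LHS]/(_ * _ + _ * _); ring.
have dsc (x : R) : is_derive x 1 (fun x => sin x * cos x)
    (cos x * cos x - sin x * sin x).
  by apply: is_derive_eq; rewrite -[LHS]/(_ * _ + _ * _); ring.
have [tsc tss tcc] : [/\ tame (fun x _ => sin x * cos x),
    tame (fun x _ => sin x * sin x) & tame (fun x _ => cos x * cos x)].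
  by split; apply: tame_mul; (exact: tame_sin1 || exact: tame_cos1).
have sin0pi (x : R) : sin 0 * x = 0 /\ sin pi * x = 0.
  by rewrite sin0 sinpi !mul0r.
have eul' t p : cos t * F2 t p =
    - (sin t * cos p * F0 t p + sin t * sin p * F1 t p).
  by apply/eqP; rewrite -addr_eq0 addrC eul.
clear GE F0E F1E F2E.
(* The field is [f] times the component of [e_i] along the unit vector of theta, multiplied by sin
   theta, and [f] times its component along the unit vector of phi. For the third coordinate the
   latter is zero. *)
have [->|->|->] : [\/ i = 0, i = 1 | i = 2%:R].
  case: i => [[|[|[|//]]] ilt]; [constructor 1|constructor 2|constructor 3];
  exact/val_inj.
- have [t1 i1] := integral_box_theta sf tsc (tame_add tcc (tame_opp tss)) tame_cos2
    dsc (sin0pi _).1 (sin0pi _).2.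
  have [] := integral_box_phi sf (tame_opp tame_sin2) (tame_opp tame_cos2)
    (fun x => is_deriveN (is_derive_sin x)); first by rewrite sin2pi sin0.
  move=> t2 i2; apply: (integral_box_add t1 t2 i1 i2) => t p.
  rewrite dthE dphE GF F0' GE' coord_spherical.
  rewrite /=; move: (cs t) (cs p) (eul' t p).
  move: (G t p) (F0 t p) (F1 t p) (F2 t p).
  move: (sin t) (cos t) (sin p) (cos p) => s c S C x x0 x1 x2 e1 e2 e3.
  ring: e1 e2 e3.
- have [t1 i1] := integral_box_theta sf tsc (tame_add tcc (tame_opp tss)) tame_sin2
    dsc (sin0pi _).1 (sin0pi _).2.
  have [] := integral_box_phi sf tame_cos2 (tame_opp tame_sin2)
    (fun x => is_derive_cos x); first by rewrite cos2pi cos0.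
  move=> t2 i2; apply: (integral_box_add t1 t2 i1 i2) => t p.
  rewrite dthE dphE GF F1' GE' coord_spherical.
  rewrite /=; move: (cs t) (cs p) (eul' t p).
  move: (G t p) (F0 t p) (F1 t p) (F2 t p).
  move: (sin t) (cos t) (sin p) (cos p) => s c S C x x0 x1 x2 e1 e2 e3.
  ring: e1 e2 e3.
- have [t1 i1] := integral_box_theta sf tss
    (tame_mul (tame_cst 2) tsc) (tame_cst (-1)) dsin2 (sin0pi _).1 (sin0pi _).2.
  have [t2 i2] := integral_box_phi sf (tame_cst 0) (tame_cst 0)
    (fun x => is_derive_cst (0 : R) x (1 : R)) erefl.
  apply: (integral_box_add t1 t2 i1 i2) => t p.
  rewrite dthE GF F2' GE' coord_spherical.
  rewrite /=; move: (cs t) (cs p) (eul' t p).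
  move: (G t p) (F0 t p) (F1 t p) (F2 t p).
  move: (sin t) (cos t) (sin p) (cos p) => s c S C x x0 x1 x2 e1 e2 e3.
  have e4 : s * s = 1 - c * c by rewrite e1 subKr.
  by ring: e4 e3.
Qed.

End integration_by_parts.

(** * Energy estimates on smooth functions *)

Section pointwise.
Context (R : realFieldType) (c : R) (c0 : 0 <= c) (c1 : 576 * c <= 1).
Implicit Types (m t p q z N Q F w l x y : R).

Lemma young2 p q z : 0 <= p -> 0 <= q -> z ^+ 2 <= p * q -> 2 * `|z| <= p + q.
Proof.
move=> p0 q0 zpq; rewrite -ler_sqr ?nnegrE ?addr_ge0 ?mulr_ge0//.
rewrite exprMn real_normK ?num_real//.
have := sqr_ge0 (p - q); rewrite sqrrB sqrrD; lra.
Qed.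

(** Here [60 + 12 + 4 = 76] copies of the bound [9 p + q / 36] cost [684 c p] and [76 / 36 c q].
    They fit because [36 + 684 = 720], with [720 / 576 < 2], and [76 / 36 < 3]. *)
Lemma absorb p q x y x' y' (l k1 k2 : R) : 0 <= p -> 0 <= q ->
  `|x| <= 9 * p + 1 / 36 * q -> `|y| <= 9 * p + 1 / 36 * q ->
  `|x'| <= `|x| -> `|y'| <= `|y| -> 2 * `|l| <= k1 + k2 ->
  36 * (c * p) - 2 * p - 3 * (c * q) + (2 * l - k1 - k2) - 60 * (c * x)
  - 12 * (c * x') + 4 * (c * y') <= 0.
Proof.
move=> p0 q0 hx hy hx' hy' hl.
have cp : 576 * (c * p) <= p by rewrite mulrA ler_piMl.
have cq : 0 <= c * q by rewrite mulr_ge0.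
have hcx : c * (60 * x + 12 * x' - 4 * y') >= c * - (684 * p + 76 / 36 * q).
  apply: ler_wpM2l => //.
  have := ler_norm (- x); have := ler_norm (- x'); have := ler_norm y'.
  rewrite !normrN; lra.
have := ler_norm l; move: hcx; rewrite mulrN !mulrDr mulrN ![c * (_ * _)]mulrCA.
move: (c * x) (c * x') (c * y') (c * p) (c * q) cp cq => *; lra.
Qed.

(** At one point of the sphere, [N], [Q] and [F] are the squares of grad f, Delta f and f,
    [w = 1 - u^2], and [x], [y], [l] are the three products of indefinite sign. In the units [p] and
    [q] all powers of [m] and [m t] left over are at most 1. The [l] term is absorbed by those in
    [Q] and [w N], since [6 ^ 2 <= 72 * 2]. *)
Lemma dissipation_pointwise m t N Q F w l x y :
  0 <= m -> m <= 1 -> 0 <= t -> m * t <= 1 ->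
  0 <= N -> 0 <= Q -> 0 <= F -> 0 <= w ->
  x ^+ 2 <= F * (w * N) -> y ^+ 2 <= F * (w * N) -> l ^+ 2 <= Q * (w * N) ->
  (36 * c * m ^+ 2 - 2 * m ^+ 2) * N - (72 * c * m ^+ 4 * t) * Q
  - (3 * c * m ^+ 2 * t ^+ 2) * (w * F) + (12 * c * m ^+ 4 * t ^+ 2) * l
  - (60 * c * m ^+ 2 * t + 12 * c * m ^+ 4 * t ^+ 2) * x
  - (2 * c * m ^+ 4 * t ^+ 3) * (w * N) + (4 * c * m ^+ 4 * t ^+ 3) * y <= 0.
Proof.
move=> m0 m1 t0 mt1 N0 Q0 F0 w0 hx hy hl.
have mt0 : 0 <= m * t by rewrite mulr_ge0.
have wN0 : 0 <= w * N by rewrite mulr_ge0.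
have wF0 : 0 <= w * F by rewrite mulr_ge0.
pose p := m ^+ 2 * N; pose q := (m * t) ^+ 2 * (w * F).
have p0 : 0 <= p by rewrite mulr_ge0// sqr_ge0.
have q0 : 0 <= q by rewrite mulr_ge0// sqr_ge0.
have bound v : v ^+ 2 <= F * (w * N) ->
    `|m * (m * t) * v| <= 9 * p + 1 / 36 * q.
  move=> hv; have : 2 * `|m * (m * t) * v| <= 18 * p + 1 / 18 * q; last lra.
  apply: young2; [by rewrite mulr_ge0|by rewrite mulr_ge0// divr_ge0|].
  rewrite [leRHS](_ : _ = (m * (m * t)) ^+ 2 * (F * (w * N))).
    by rewrite exprMn ler_wpM2l// sqr_ge0.
  by rewrite /p /q; field.
have bx := bound _ hx; have by_ := bound _ hy.
set zx := m * (m * t) * x in bx; set zy := m * (m * t) * y in by_.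
have r1 : m * (m * t) <= 1 by rewrite -[1]mulr1 ler_pM.
have r0 : 0 <= m * (m * t) by rewrite mulr_ge0.
have rx : `|m * (m * t) * zx| <= `|zx|.
  by rewrite normrM ger0_norm// ler_piMl.
have ry : `|(m * t) ^+ 2 * zy| <= `|zy|.
  by rewrite normrM ger0_norm ?sqr_ge0// ler_piMl// exprn_ile1.
have bl : 2 * `|6 * c * m ^+ 4 * t ^+ 2 * l| <=
    72 * c * m ^+ 4 * t * Q + 2 * c * m ^+ 4 * t ^+ 3 * (w * N).
  have m4 : 0 <= m ^+ 4 by rewrite exprn_ge0.
  have t3 : 0 <= t ^+ 3 by rewrite exprn_ge0.
  have k0 (n : nat) : 0 <= n%:R * c by rewrite mulr_ge0.
  apply: young2.
  - exact: mulr_ge0 (mulr_ge0 (mulr_ge0 (k0 _) m4) t0) Q0.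
  - exact: mulr_ge0 (mulr_ge0 (mulr_ge0 (k0 _) m4) t3) wN0.
  rewrite [leRHS](_ : _ = 144 * ((c * m ^+ 4 * t ^+ 2) ^+ 2 * (Q * (w * N)))); last ring.
  rewrite [leLHS](_ : _ = 36 * ((c * m ^+ 4 * t ^+ 2) ^+ 2 * l ^+ 2)); last ring.
  have h1 := ler_wpM2l (sqr_ge0 (c * m ^+ 4 * t ^+ 2)) hl.
  have h2 := mulr_ge0 (sqr_ge0 (c * m ^+ 4 * t ^+ 2)) (sqr_ge0 l).
  move: h1 h2; move: (_ * l ^+ 2) (_ * (Q * _)) => *; lra.
have := absorb p0 q0 bx by_ rx ry bl.
by congr (_ <= 0); rewrite /zx /zy /p /q; ring.
Qed.

Lemma energy_ge_pointwise m t N F w x : 0 <= t ->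
  0 <= N -> 0 <= F -> 0 <= w -> x ^+ 2 <= F * (w * N) ->
  0 <= 36 * c * m ^+ 2 * t * N + 6 * c * m ^+ 2 * t ^+ 2 * x
    + c * m ^+ 2 * t ^+ 3 * (w * F).
Proof.
move=> t0 N0 F0 w0 hx.
have m2 : 0 <= m ^+ 2 by rewrite sqr_ge0.
have t3 : 0 <= t ^+ 3 by rewrite exprn_ge0.
have h : 2 * `|3 * c * m ^+ 2 * t ^+ 2 * x| <=
    36 * c * m ^+ 2 * t * N + c * m ^+ 2 * t ^+ 3 * (w * F).
  apply: young2.
  - exact: mulr_ge0 (mulr_ge0 (mulr_ge0 (mulr_ge0 (ler0n _ _) c0) m2) t0) N0.
  - exact: mulr_ge0 (mulr_ge0 (mulr_ge0 c0 m2) t3) (mulr_ge0 w0 F0).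
  rewrite [leRHS](_ : _ = 36 * ((c * m ^+ 2 * t ^+ 2) ^+ 2 * (F * (w * N)))); last ring.
  rewrite [leLHS](_ : _ = 9 * ((c * m ^+ 2 * t ^+ 2) ^+ 2 * x ^+ 2)); last ring.
  have h1 := ler_wpM2l (sqr_ge0 (c * m ^+ 2 * t ^+ 2)) hx.
  have h2 := mulr_ge0 (sqr_ge0 (c * m ^+ 2 * t ^+ 2)) (sqr_ge0 x).
  move: h1 h2; move: (_ * x ^+ 2) (_ * (F * _)) => *; lra.
have n1 := ler_norm (- (3 * c * m ^+ 2 * t ^+ 2 * x)); rewrite normrN in n1.
rewrite [6 * c * _ * _ * _](_ : _ = 2 * (3 * c * m ^+ 2 * t ^+ 2 * x)); last ring.
move: n1 h; move: (3 * c * _ * _ * x) => z.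
move: (36 * _ * _ * _ * N) (c * _ * _ * _) (`|z|) => *; lra.
Qed.

(** At [t = 1 / m] the weights are [36 c m], [6 c] and [c / m]. Half of the first and last terms
    absorbs [x]; the other half still covers the integrand of the mass identity, because
    [3 / 8 + 1 / 8 = 1 / 2]. *)
Lemma energy_gain_pointwise m N F w x y : 0 < m -> m <= 1 ->
  0 <= N -> 0 <= F -> 0 <= w -> x ^+ 2 <= F * (w * N) -> y ^+ 2 <= F * (w * N) ->
  c / 8 * (3 * (w * F) + 2 * y) <= 36 * c * m * N + 6 * c * x + c / m * (w * F).
Proof.
move=> m0 m1 N0 F0 w0 hx hy; have m0' := ltW m0; have mn0 := lt0r_neq0 m0.
have wF0 : 0 <= w * F by rewrite mulr_ge0.
have mi0 : 0 <= m^-1 by rewrite invr_ge0.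
have h1 : 2 * `|3 * x| <= 18 * (m * N) + 1 / 2 * (m^-1 * (w * F)).
  apply: young2.
  - exact: mulr_ge0 (ler0n _ _) (mulr_ge0 m0' N0).
  - exact: mulr_ge0 (divr_ge0 ler01 (ler0n _ _)) (mulr_ge0 mi0 wF0).
  rewrite [leRHS](_ : _ = 9 * (F * (w * N))); last by field.
  by rewrite [leLHS](_ : _ = 9 * x ^+ 2); [rewrite ler_wpM2l|ring].
have h2 : 2 * `|y| <= m * N + m^-1 * (w * F).
  apply: young2; [by rewrite mulr_ge0|by rewrite mulr_ge0|].
  by rewrite [leRHS](_ : _ = F * (w * N)) //; field.
have h3 : w * F <= m^-1 * (w * F) by rewrite ler_peMl// invf_ge1.
have n1 := ler_norm (- (3 * x)); rewrite normrN in n1.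
have n2 := ler_norm y.
have mN : 0 <= m * N by rewrite mulr_ge0.
rewrite [leLHS](_ : _ = c * ((3 * (w * F) + 2 * y) / 8)); last by field.
rewrite [leRHS](_ : _ = c * (36 * (m * N) + 6 * x + m^-1 * (w * F))); last by field.
apply: ler_wpM2l => //.
move: (m^-1 * (w * F)) (m * N) (w * F) h1 h2 h3 mN wF0 => *; lra.
Qed.
End pointwise.

(** * Green's formula and commutator identities in a ring of functions *)

Section sphere_algebra.
Context (R : realType) (A : comNzRingType) (c : {rmorphism R -> A}).
Context (D : 'I_3 -> A -> A) (X : 'I_3 -> A) (I : A -> R).
Context (DD : forall i f g, D i (f + g) = D i f + D i g)
  (DM : forall i f g, D i (f * g) = f * D i g + g * D i f)
  (Dc : forall i a, D i (c a) = 0)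
  (DX : forall i j, D i (X j) = (i == j)%:R - X i * X j)
  (XX : \sum_i X i * X i = 1)
  (XD : forall f, \sum_i X i * D i f = 0)
  (ID : forall f g, I (f + g) = I f + I g)
  (IC : forall a f, I (c a * f) = a * I f)
  (IBP : forall i f, I (D i f) = 2 * I (X i * f)).
Context (k : 'I_3 -> R) (kk : \sum_i k i * k i = 1).

(** The context is a list of laws for smooth functions: [c] embeds constants, [X] are the
    coordinates, [D] the tangential derivatives and [I] the integral. The operators [D i] do not
    commute on the sphere, and no such law is assumed. *)
Definition lap f : A := \sum_i D i (D i f).
Definition gdot f g : A := \sum_i D i f * D i g.
Definition height : A := \sum_i c (k i) * X i.
Local Notation u := height.
(** The derivative along grad u, written X in the overview; in the code [X] denotes the
    coordinates. *)
Definition slope f : A := gdot u f.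

Lemma I0 : I 0 = 0.
Proof. by apply: (addrI (I 0)); rewrite -ID !addr0. Qed.

Lemma IN f : I (- f) = - I f.
Proof. by apply: (addrI (I f)); rewrite -ID !subrr I0. Qed.

Lemma IB f g : I (f - g) = I f - I g.
Proof. by rewrite ID IN. Qed.

Lemma I_sum (J : Type) (r : seq J) (F : J -> A) :
  I (\sum_(j <- r) F j) = \sum_(j <- r) I (F j).
Proof. exact: (big_morph I ID I0). Qed.

Lemma D0 i : D i 0 = 0.
Proof. by apply: (addrI (D i 0)); rewrite -DD !addr0. Qed.

Lemma D_sum i (J : Type) (r : seq J) (F : J -> A) :
  D i (\sum_(j <- r) F j) = \sum_(j <- r) D i (F j).
Proof. exact: (big_morph (D i) (DD i) (D0 i)). Qed.

Lemma D_height i : D i u = c (k i) - u * X i.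
Proof.
rewrite /height D_sum; under eq_bigr do rewrite DM Dc mulr0 addr0 DX mulrBr.
rewrite sumrB (bigD1 i)//= eqxx mulr1 big1 ?addr0 => [|j /negbTE ji]; last first.
  by rewrite eq_sym ji mulr0.
by congr (_ - _); rewrite mulr_suml; apply: eq_bigr => j _; ring.
Qed.

Lemma slope_height : slope u = 1 - u * u.
Proof.
have ckk : \sum_i c (k i) * c (k i) = 1.
  by rewrite -(rmorph1 c) -kk rmorph_sum; apply: eq_bigr => i _; rewrite rmorphM.
rewrite /slope /gdot.
transitivity (\sum_i (c (k i) * c (k i) - 2 * u * (c (k i) * X i)
    + u * u * (X i * X i))).
  by apply: eq_bigr => i _; rewrite D_height; ring.
rewrite big_split sumrB /= -!mulr_sumr ckk XX -/height; ring.
Qed.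

(** The coordinates are spherical harmonics of degree one, of eigenvalue 2. *)
Lemma lap_height : lap u = - (2 * u).
Proof.
rewrite /lap.
transitivity (\sum_i (- (X i * D i u) - u * (1 - X i * X i))).
  apply: eq_bigr => i _; rewrite {1}D_height.
  have Dopp f : D i (- f) = - D i f by apply: (addrI (D i f)); rewrite -DD !subrr D0.
  by rewrite DD Dopp Dc DM DX eqxx /=; ring.
rewrite big_split /= sumrN XD oppr0 add0r sumrN -mulr_sumr sumrB XX.
rewrite sumr_const card_ord. ring.
Qed.

Lemma D_field (f g : A) i : D i (f * D i g) = f * D i (D i g) + D i f * D i g.
Proof. by rewrite DM; ring. Qed.

(** Applying [IBP] to [f * D i g] leaves the curvature term [2 X_i f D_i g], which sums to zero
    because the gradient of [g] is tangent. *)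
Lemma I_lap f g : I (f * lap g) = - I (gdot f g).
Proof.
have : \sum_i I (D i (f * D i g)) = 0.
  under eq_bigr do rewrite IBP.
  rewrite -mulr_sumr -I_sum; under eq_bigr do rewrite mulrCA.
  by rewrite -mulr_sumr XD mulr0 I0 mulr0.
under eq_bigr do rewrite D_field.
rewrite -I_sum big_split /= ID /lap /gdot -mulr_sumr => /eqP.
by rewrite addr_eq0 => /eqP.
Qed.

Lemma gdotC f g : gdot f g = gdot g f.
Proof. by apply: eq_bigr => i _; rewrite mulrC. Qed.

Lemma gdotM f g h : gdot (f * g) h = f * gdot g h + g * gdot f h.
Proof.
by rewrite /gdot !mulr_sumr -big_split; apply: eq_bigr => i _; rewrite DM /=; ring.
Qed.

(** Green's formula against [u], with [lap u = - 2 u]: the adjoint of [slope] is [- slope + 2 u]. *)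
Lemma I_slope f g : I (g * slope f) = - I (f * slope g) + 2 * I (u * (f * g)).
Proof.
have := I_lap (f * g) u; rewrite lap_height gdotM.
rewrite !(gdotC _ u) -/(slope f) -/(slope g) ID.
have -> : f * g * - (2 * u) = c (-2) * (u * (f * g)).
  by rewrite rmorphN rmorph_nat; ring.
rewrite IC; lra.
Qed.

Section functional.
Context (nu : R) (a b : A).

Definition mass : A := a * a + b * b.
Definition gradsq : A := gdot a a + gdot b b.
Definition lapsq : A := lap a * lap a + lap b * lap b.
Definition shear : A := 1 - u * u.
(** With f = a + i b, [cross] and [mcross] are the imaginary and the real part of conj f times the
    slope of f; [lcross] is the imaginary part of conj (Delta f) times the slope of f. *)
Definition cross : A := a * slope b - b * slope a.
Definition lcross : A := lap a * slope b - lap b * slope a.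
Definition mcross : A := a * slope a + b * slope b.
Local Notation La := (u * b + c nu * lap a).
Local Notation Lb := (- (u * a) + c nu * lap b).

Lemma I_mass_L : I (a * La + b * Lb) = - (nu * I gradsq).
Proof.
rewrite [X in I X = _](_ : _ = c nu * (a * lap a + b * lap b)); last ring.
by rewrite IC ID !I_lap /gradsq ID; ring.
Qed.

(** The advective part is [u] times a lap b - b lap a. By Green's formula only the derivative of [u]
    survives, and this is [cross]. *)
Lemma I_lap_L : I (- lap a * La + - lap b * Lb) = - I cross - nu * I lapsq.
Proof.
rewrite [X in I X = _](_ : _ = (u * a) * lap b - (u * b) * lap a - c nu * lapsq);
  last by rewrite /lapsq; ring.
rewrite !IB IC !I_lap !gdotM !ID -/(slope a) -/(slope b) (gdotC b a).
by rewrite /cross ?IB; ring.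
Qed.

(** [I_slope] for the pairs [u * a], [a] and [u * b], [b]: the slope of [u] itself brings in
    [shear]. *)
Lemma I_umcross : I (u * mcross) = - (2^-1 * I (shear * mass)) + I (u * u * mass).
Proof.
have ha := I_slope (u * a) a; have hb := I_slope (u * b) b.
have sM f g : slope (f * g) = f * slope g + g * slope f.
  by rewrite /slope gdotC gdotM !(gdotC _ u).
move: ha hb; rewrite !sM slope_height.
rewrite (_ : a * (u * slope a + a * (1 - u * u)) = u * a * slope a + shear * (a * a));
  last by rewrite /shear; ring.
rewrite (_ : b * (u * slope b + b * (1 - u * u)) = u * b * slope b + shear * (b * b));
  last by rewrite /shear; ring.
rewrite !ID.
rewrite /mcross /mass mulrDr ID !mulrA => ha hb.
rewrite [shear * _]mulrDr [u * u * _]mulrDr !ID !mulrA; lra.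
Qed.

(** The gain is the term in [shear * mass], which [I_umcross] extracts from
    [u * mcross - u * u * mass]: it is the damping that diffusion alone does not give. The terms
    with [nu] are errors to be absorbed. *)
Lemma I_cross_L :
  I ((slope b - u * b) * La + (u * a - slope a) * Lb) =
  - (2^-1 * I (shear * mass)) + nu * I lcross - nu * I cross.
Proof.
rewrite [X in I X = _](_ : _ = u * mcross - u * u * mass + c nu * lcross
   + c nu * ((u * a) * lap b - (u * b) * lap a));
  last by rewrite /mcross /mass /lcross; ring.
rewrite !ID !IC !ID !IN I_umcross !I_lap !gdotM !ID -/(slope a) -/(slope b) (gdotC b a).
by rewrite /cross ?IB; ring.
Qed.

(** Multiplication by [shear] commutes with the advection, so only diffusion contributes;
    differentiating the weight, with gradient - 2 u grad u, produces the term in [mcross]. *)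
Lemma I_shear_L : I (shear * a * La + shear * b * Lb) =
  - (nu * I (shear * gradsq)) + 2 * nu * I (u * mcross).
Proof.
have gsh g : gdot shear g = - (2 * (u * slope g)).
  rewrite /slope /gdot !mulr_sumr -sumrN; apply: eq_bigr => i _.
  have Dopp h : D i (- h) = - D i h by apply: (addrI (D i h)); rewrite -DD !subrr D0.
  by rewrite /shear -(rmorph1 c) DD Dc Dopp DM; ring.
have gs f g : gdot (shear * f) g = shear * gdot f g - 2 * (u * (f * slope g)).
  by rewrite gdotM gsh; ring.
rewrite [X in I X = _](_ : _ = c nu * ((shear * a) * lap a + (shear * b) * lap b)); last ring.
have -> : I (shear * gradsq) = I (shear * gdot a a) + I (shear * gdot b b).
  by rewrite -ID -mulrDr.
have -> : I (u * mcross) = I (u * (a * slope a)) + I (u * (b * slope b)).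
  by rewrite -ID -mulrDr.
rewrite IC ID !I_lap !gs !IB.
have h f : I (2 * (u * (f * slope f))) = 2 * I (u * (f * slope f)).
  by rewrite -(rmorph_nat c 2) IC.
by rewrite !h; ring.
Qed.

Lemma I_lap_form : I (- lap a * a + - lap b * b) = I gradsq.
Proof.
rewrite [X in I X = _](_ : _ = - (a * lap a) - b * lap b); last ring.
by rewrite IB IN !I_lap /gradsq ID; ring.
Qed.

Lemma I_cross_form : I ((slope b - u * b) * a + (u * a - slope a) * b) = I cross.
Proof. by congr I; rewrite /cross; ring. Qed.

(** [shear] vanishes at the two critical points of [u], so [I (shear * mass)] alone does not control
    [I mass]; near these points the term with [mcross] pays with a derivative. *)
Lemma I_mass : 2 * I mass = 3 * I (shear * mass) + 2 * I (u * mcross).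
Proof.
rewrite I_umcross.
have -> : I mass = I (shear * mass) + I (u * u * mass).
  by rewrite -ID; congr I; rewrite /shear; ring.
lra.
Qed.
End functional.

Lemma I_lap_sym a b a' b' :
  I (- lap a * a' + - lap b * b') = I (- lap a' * a + - lap b' * b).
Proof.
rewrite (_ : - lap a * a' + _ = - (a' * lap a) - b' * lap b); last ring.
rewrite (_ : - lap a' * a + _ = - (a * lap a') - b * lap b'); last ring.
by rewrite !IB !IN !I_lap (gdotC a') (gdotC b').
Qed.

(** As the adjoint of [slope] is [- slope + 2 u], the operator [slope - u] is skew, and [- i] times
    it is symmetric: this is the reason for the correction by [u]. *)
Lemma I_cross_sym a b a' b' :
  I ((slope b - u * b) * a' + (u * a - slope a) * b') =
  I ((slope b' - u * b') * a + (u * a' - slope a') * b).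
Proof.
rewrite (_ : (slope b - _) * _ + _ = a' * slope b - b' * slope a -
  u * (b * a') + u * (a * b')); last ring.
rewrite (_ : (slope b' - _) * _ + _ = a * slope b' - b * slope a' -
  u * (b' * a) + u * (a' * b)); last ring.
rewrite !ID !IN (I_slope b a') (I_slope a b') (mulrC b' a) (mulrC a' b).
lra.
Qed.
Context (P : Type) (ev : P -> {rmorphism A -> R}).
Context (evc : forall p a, ev p (c a) = a)
  (I_ge0 : forall f, (forall p, 0 <= ev p f) -> 0 <= I f).

Lemma sqr_sum_le (J : finType) (x y : J -> R) :
  (\sum_j x j * y j) ^+ 2 <= (\sum_j x j * x j) * (\sum_j y j * y j).
Proof.
have h (s t : R) : 0 <= s ^+ 2 * (\sum_j x j * x j) + 2 * s * t * (\sum_j x j * y j)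
    + t ^+ 2 * (\sum_j y j * y j).
  rewrite !mulr_sumr -!big_split /=; apply: sumr_ge0 => j _.
  rewrite (_ : _ + _ = (s * x j + t * y j) ^+ 2) ?sqr_ge0//; ring.
have Y0 : 0 <= \sum_j y j * y j by apply: sumr_ge0 => j _; rewrite -expr2 sqr_ge0.
move: (\sum_j x j * x j) (\sum_j x j * y j) (\sum_j y j * y j) h Y0 => a b d h d0.
have [d00|dn0] := eqVneq d 0.
  rewrite d00 mulr0 real_exprn_even_le0 ?num_real//=; apply/negPn/negP => bn0.
  have := h 1 (- (a + 1) / b); rewrite d00 mulr0 addr0 mulr1 expr1n.
  rewrite mul1r mulrA -[2 * _ / _ * _]mulrA mulVf// mulr1.
  have := h 1 0; rewrite d00; lra.
have dp : 0 < d by rewrite lt_neqAle eq_sym dn0.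
have := h d (- b).
rewrite (_ : _ + _ = d * (a * d - b ^+ 2)); last ring.
by rewrite pmulr_rge0// subr_ge0.
Qed.

(** Cauchy-Schwarz for grad u and grad f at a point, [shear] being the square of grad u. *)
Lemma ev_slope p f : ev p (slope f) ^+ 2 <= ev p shear * ev p (gdot f f).
Proof.
rewrite /shear -slope_height /slope /gdot !rmorph_sum /=.
under eq_bigr do rewrite rmorphM.
under [X in _ <= X * _]eq_bigr do rewrite rmorphM.
under [X in _ <= _ * X]eq_bigr do rewrite rmorphM.
exact: sqr_sum_le.
Qed.

Lemma ev_shear_ge0 p : 0 <= ev p shear.
Proof.
rewrite /shear -slope_height /slope /gdot rmorph_sum /=; apply: sumr_ge0 => i _.
by rewrite rmorphM -expr2 sqr_ge0.
Qed.

Lemma ev_gdot_ge0 p f : 0 <= ev p (gdot f f).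
Proof.
rewrite /gdot rmorph_sum /=; apply: sumr_ge0 => i _.
by rewrite rmorphM -expr2 sqr_ge0.
Qed.

Lemma ev_height_le1 p : ev p u ^+ 2 <= 1.
Proof.
by have := ev_shear_ge0 p; rewrite /shear rmorphB rmorph1 rmorphM subr_ge0 expr2.
Qed.

Lemma ev_comb7 p x1 x2 x3 x4 x5 x6 x7 f1 f2 f3 f4 f5 f6 f7 :
  ev p (c x1 * f1 - c x2 * f2 - c x3 * f3 + c x4 * f4 - c x5 * f5 - c x6 * f6
    + c x7 * f7) = x1 * ev p f1 - x2 * ev p f2 - x3 * ev p f3 + x4 * ev p f4
    - x5 * ev p f5 - x6 * ev p f6 + x7 * ev p f7.
Proof. by rewrite !(rmorphD, rmorphN, rmorphM) !evc. Qed.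

Lemma I_comb7 x1 x2 x3 x4 x5 x6 x7 f1 f2 f3 f4 f5 f6 f7 :
  I (c x1 * f1 - c x2 * f2 - c x3 * f3 + c x4 * f4 - c x5 * f5 - c x6 * f6
    + c x7 * f7) = x1 * I f1 - x2 * I f2 - x3 * I f3 + x4 * I f4
    - x5 * I f5 - x6 * I f6 + x7 * I f7.
Proof. by rewrite !(ID, IN) !IC. Qed.

Lemma ev_comb3 p x1 x2 x3 f1 f2 f3 :
  ev p (c x1 * f1 + c x2 * f2 + c x3 * f3) =
  x1 * ev p f1 + x2 * ev p f2 + x3 * ev p f3.
Proof. by rewrite !(rmorphD, rmorphM) !evc. Qed.

Lemma I_comb3 x1 x2 x3 f1 f2 f3 :
  I (c x1 * f1 + c x2 * f2 + c x3 * f3) = x1 * I f1 + x2 * I f2 + x3 * I f3.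
Proof. by rewrite !ID !IC. Qed.

Section bounds.
Context (a b : A).

Lemma ev_mass_ge0 p : 0 <= ev p (mass a b).
Proof. by rewrite /mass rmorphD !rmorphM addr_ge0// -expr2 sqr_ge0. Qed.

Lemma ev_gradsq_ge0 p : 0 <= ev p (gradsq a b).
Proof. by rewrite /gradsq rmorphD addr_ge0// ev_gdot_ge0. Qed.

Lemma ev_lapsq_ge0 p : 0 <= ev p (lapsq a b).
Proof. by rewrite /lapsq rmorphD !rmorphM addr_ge0// -expr2 sqr_ge0. Qed.

Lemma ev_slopes p : ev p (slope a) ^+ 2 + ev p (slope b) ^+ 2 <=
  ev p shear * ev p (gradsq a b).
Proof.
by rewrite /gradsq [ev p (gdot a a + _)]rmorphD mulrDr lerD// ev_slope.
Qed.

(** Lagrange's identity: the two sides differ by the square of [x * s + y * t]. *)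
Lemma lagrange_le (x y s t : R) : (x * t - y * s) ^+ 2 <= (x * x + y * y) * (s ^+ 2 + t ^+ 2).
Proof. have := sqr_ge0 (x * s + y * t); rewrite !expr2; nra. Qed.

Lemma ev_cross p : ev p (cross a b) ^+ 2 <=
  ev p (mass a b) * (ev p shear * ev p (gradsq a b)).
Proof.
apply: (le_trans _ (ler_wpM2l (ev_mass_ge0 p) (ev_slopes p))).
by rewrite /cross /mass rmorphB rmorphD !rmorphM; exact: lagrange_le.
Qed.

Lemma ev_lcross p : ev p (lcross a b) ^+ 2 <=
  ev p (lapsq a b) * (ev p shear * ev p (gradsq a b)).
Proof.
apply: (le_trans _ (ler_wpM2l (ev_lapsq_ge0 p) (ev_slopes p))).
by rewrite /lcross /lapsq rmorphB rmorphD !rmorphM; exact: lagrange_le.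
Qed.

Lemma ev_mcross p : ev p (u * mcross a b) ^+ 2 <=
  ev p (mass a b) * (ev p shear * ev p (gradsq a b)).
Proof.
apply: (le_trans _ (ler_wpM2l (ev_mass_ge0 p) (ev_slopes p))).
rewrite rmorphM exprMn (@le_trans _ _ (ev p (mcross a b) ^+ 2))//.
  by rewrite ler_piMl ?sqr_ge0// ev_height_le1.
rewrite /mcross /mass !rmorphD !rmorphM.
(* The sign change of [b] turns the difference in [lagrange_le] into the sum in [mcross]. *)
have := lagrange_le (ev p a) (- ev p b) (ev p (slope b)) (ev p (slope a)).
by rewrite mulrNN mulNr opprK [_ ^+ 2 + _ ^+ 2]addrC.
Qed.

Context (e : R) (e0 : 0 <= e) (e1 : 576 * e <= 1).
Context (m : R) (m0 : 0 < m) (m1 : m <= 1).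
Local Notation nu := (m ^+ 2).
Local Notation La := (u * b + c nu * lap a).
Local Notation Lb := (- (u * a) + c nu * lap b).

Lemma I_dissipation t : 0 <= t -> m * t <= 1 ->
  2 * (I (a * La + b * Lb) + 36 * e * m ^+ 2 * t * I (- lap a * La + - lap b * Lb)
    + 6 * e * m ^+ 2 * t ^+ 2 * I ((slope b - u * b) * La + (u * a - slope a) * Lb)
    + e * m ^+ 2 * t ^+ 3 * I (shear * a * La + shear * b * Lb))
  + (36 * e * m ^+ 2 * I (gradsq a b) + 12 * e * m ^+ 2 * t * I (cross a b)
    + 3 * e * m ^+ 2 * t ^+ 2 * I (shear * mass a b)) <= 0.
Proof.
move=> t0 mt1; rewrite I_mass_L I_lap_L I_cross_L I_shear_L.
(* The whole left side as one integrand. The coefficient of [cross] at order [m ^+ 2] is -60 = -72 +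
   12, and that of [shear * mass] is -3 = -6 + 3: in each sum the first term comes from the flow and
   the second from differentiating the weight. *)
pose z := c (36 * e * m ^+ 2 - 2 * m ^+ 2) * gradsq a b
  - c (72 * e * m ^+ 4 * t) * lapsq a b
  - c (3 * e * m ^+ 2 * t ^+ 2) * (shear * mass a b)
  + c (12 * e * m ^+ 4 * t ^+ 2) * lcross a b
  - c (60 * e * m ^+ 2 * t + 12 * e * m ^+ 4 * t ^+ 2) * cross a b
  - c (2 * e * m ^+ 4 * t ^+ 3) * (shear * gradsq a b)
  + c (4 * e * m ^+ 4 * t ^+ 3) * (u * mcross a b).
have : 0 <= I (- z).
  apply: I_ge0 => p; rewrite rmorphN oppr_ge0 /z ev_comb7 !(rmorphM _ shear).
  by apply: dissipation_pointwise => //;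
    solve [exact: ltW | exact: ev_gradsq_ge0 | exact: ev_lapsq_ge0 |
      exact: ev_mass_ge0 | exact: ev_shear_ge0 | exact: ev_cross |
      exact: ev_mcross | exact: ev_lcross].
rewrite IN oppr_ge0 /z I_comb7; apply: le_trans; rewrite le_eqVlt; apply/orP; left.
by apply/eqP; field.
Qed.

Lemma I_energy_ge t : 0 <= t ->
  I (mass a b) <= I (mass a b) + 36 * e * m ^+ 2 * t * I (gradsq a b)
    + 6 * e * m ^+ 2 * t ^+ 2 * I (cross a b)
    + e * m ^+ 2 * t ^+ 3 * I (shear * mass a b).
Proof.
move=> t0; have : 0 <= I (c (36 * e * m ^+ 2 * t) * gradsq a b
    + c (6 * e * m ^+ 2 * t ^+ 2) * cross a b
    + c (e * m ^+ 2 * t ^+ 3) * (shear * mass a b)).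
  apply: I_ge0 => p; rewrite ev_comb3 !(rmorphM _ shear).
  by apply: energy_ge_pointwise => //;
    solve [exact: ltW | exact: ev_gradsq_ge0 | exact: ev_lapsq_ge0 |
      exact: ev_mass_ge0 | exact: ev_shear_ge0 | exact: ev_cross |
      exact: ev_mcross | exact: ev_lcross].
by rewrite I_comb3; lra.
Qed.

(** Multiplying [I_mass] by [e / 8] turns the pointwise gain into [e / 4] times the mass. The
    summand [c 0 * 0] in the proof is padding that lets [I_comb3] apply. *)
Lemma I_energy_gain : (1 + e / 4) * I (mass a b) <=
  I (mass a b) + 36 * e * m ^+ 2 * m^-1 * I (gradsq a b)
    + 6 * e * m ^+ 2 * m^-1 ^+ 2 * I (cross a b)
    + e * m ^+ 2 * m^-1 ^+ 3 * I (shear * mass a b).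
Proof.
have mn0 : m != 0 by rewrite gt_eqF.
have : 0 <= I (c (36 * e * m) * gradsq a b + c (6 * e) * cross a b
    + c (e / m) * (shear * mass a b)
    - (c (3 * (e / 8)) * (shear * mass a b) + c (2 * (e / 8)) * (u * mcross a b)
       + c 0 * 0)).
  apply: I_ge0 => p; rewrite rmorphB subr_ge0 !ev_comb3 mul0r addr0.
  rewrite (rmorphM _ shear) -![_ * (e / 8) * _]mulrA ![_ * (e / 8 * _)]mulrCA -mulrDr.
  by apply: energy_gain_pointwise => //;
    solve [exact: ltW | exact: ev_gradsq_ge0 | exact: ev_lapsq_ge0 |
      exact: ev_mass_ge0 | exact: ev_shear_ge0 | exact: ev_cross |
      exact: ev_mcross | exact: ev_lcross].
rewrite IB !I_comb3 mul0r addr0.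
have := congr1 ( *%R e) (I_mass a b).
rewrite (_ : 36 * e * m ^+ 2 * m^-1 = 36 * e * m); last by field.
rewrite (_ : 6 * e * m ^+ 2 * m^-1 ^+ 2 = 6 * e); last by field.
rewrite (_ : e * m ^+ 2 * m^-1 ^+ 3 = e / m); last by field.
lra.
Qed.
End bounds.

Section pairs.
Context (nu : R).

(** The operator [L1] on f = a + i b, using - i u (a + i b) = u b - i u a. *)
Definition advection_diffusion a b : A * A :=
  (u * b + c nu * lap a, - (u * a) + c nu * lap b).

(* From [- lap] on, half the commutator and then the commutator of the previous
   operator with [f |-> i u f], acting on [f = a + i b]. *)
Definition multiplier_op (j : nat) a b : A * A :=
  match j with
  | 0 => (a, b)
  | 1 => (- lap a, - lap b)
  | 2 => (slope b - u * b, u * a - slope a)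
  | _ => (shear * a, shear * b)
  end.

Definition pairing (x y : A * A) : R := I (x.1 * y.1 + x.2 * y.2).

Lemma pair_eq (x y : A * A) : x.1 = y.1 -> x.2 = y.2 -> x = y.
Proof. by case: x y => ? ? [? ?] /= -> ->. Qed.

Lemma D_sub i f g : D i (f - g) = D i f - D i g.
Proof. by apply: (addIr (D i g)); rewrite -DD !subrK. Qed.

Lemma lap_sub f g : lap (f - g) = lap f - lap g.
Proof. by rewrite /lap -sumrB; apply: eq_bigr => i _; rewrite !D_sub. Qed.

Lemma slope_sub f g : slope (f - g) = slope f - slope g.
Proof. by rewrite /slope /gdot -sumrB; apply: eq_bigr => i _; rewrite D_sub mulrBr. Qed.

Lemma advection_diffusion_sub a b a' b' :
  advection_diffusion (a - a') (b - b') =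
  advection_diffusion a b - advection_diffusion a' b'.
Proof.
apply: pair_eq; rewrite /= !lap_sub; ring.
Qed.

Lemma multiplier_op_sub j a b a' b' :
  multiplier_op j (a - a') (b - b') = multiplier_op j a b - multiplier_op j a' b'.
Proof.
by case: j => [|[|[|j]]]; apply: pair_eq; rewrite /= ?lap_sub ?slope_sub; ring.
Qed.

Lemma pairing_sym j a b a' b' : pairing (multiplier_op j a b) (a', b') =
  pairing (multiplier_op j a' b') (a, b).
Proof.
case: j => [|[|[|j]]] /=; rewrite /pairing /=.
- by rewrite mulrC [b * _]mulrC.
- exact: I_lap_sym.
- exact: I_cross_sym.
- by congr I; ring.
Qed.

Lemma pairing_mass a b : pairing (advection_diffusion a b) (a, b) = - (nu * I (gradsq a b)).
Proof. by rewrite -I_mass_L /pairing /=; congr I; ring. Qed.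

(** The sum of the image of f under the operator and of i u f is nu Delta f; pairing it with i u f
    recovers [I cross] from quantities without derivatives of f other than the operator itself. *)
Lemma pairing_skew a b :
  pairing (- (u * b), u * a) (advection_diffusion a b) +
  pairing (- (u * b), u * a) (- (u * b), u * a) = - (nu * I (cross a b)).
Proof.
rewrite /pairing /= -ID.
rewrite [X in I X = _](_ : _ = c nu * ((u * a) * lap b - (u * b) * lap a)); last ring.
rewrite IC IB !I_lap !gdotM !ID -/(slope a) -/(slope b) (gdotC b a).
by rewrite ?IN; ring.
Qed.

Lemma lap_advection_diffusion a b : nu != 0 -> multiplier_op 1 a b =
  (c (- nu^-1) * ((advection_diffusion a b).1 - u * b),
   c (- nu^-1) * ((advection_diffusion a b).2 + u * a)).
Proof.
move=> nu0; have h f : c (- nu^-1) * (c nu * f) = - f.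
  by rewrite mulrA -rmorphM mulNr mulVf// rmorphN rmorph1 mulN1r.
by congr (_, _); rewrite /= ?[u * b + _]addrC ?[- (u * a) + _]addrC ?addrK ?subrK h.
Qed.

(** From [ev_slopes] and [shear <= 1]; it is what bounds the first-order multiplier by the
    gradient. *)
Lemma I_slopes_le a b :
  I (slope b * slope b + - slope a * - slope a) <= I (gradsq a b).
Proof.
rewrite -subr_ge0 -IB; apply: I_ge0 => p; rewrite rmorphB subr_ge0.
rewrite rmorphD !rmorphM rmorphN mulrNN -!expr2 addrC.
apply: (le_trans (ev_slopes a b p)); rewrite ler_piMl ?ev_gradsq_ge0//.
rewrite /shear rmorphB rmorph1 rmorphM -expr2.
by rewrite gerBl sqr_ge0.
Qed.

End pairs.
End sphere_algebra.

(** * The ring of smooth functions on the sphere *)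

Section smooth_ring.
Context (R : realType).

Definition smooth_pred : {pred sphere R -> R} := fun f => `[< smooth f >].

Lemma smooth_subring_closed : subring_closed smooth_pred.
Proof.
split; first by apply/asboolP; exact: smooth_cst.
- move=> f g /asboolP sf /asboolP sg; apply/asboolP.
  rewrite (_ : f - g = fun p => f p + (-1) * g p).
    by apply: smooth_add => //; apply: smooth_mul => //; exact: smooth_cst.
  by apply/funext => p; rewrite mulN1r.
- by move=> f g /asboolP sf /asboolP sg; apply/asboolP; exact: smooth_mul.
Qed.

HB.instance Definition _ :=
  GRing.isSubringClosed.Build _ smooth_pred smooth_subring_closed.

Record smf := Smf { smf_fun :> sphere R -> R; smfP : smf_fun \in smooth_pred }.

HB.instance Definition _ := [isSub for smf_fun].
HB.instance Definition _ := [Choice of smf by <:].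
HB.instance Definition _ := [SubChoice_isSubComNzRing of smf by <:].

Lemma smooth_smf (f : smf) : smooth f. Proof. exact/asboolP/(smfP f). Qed.

Definition to_smf (f : sphere R -> R) (sf : smooth f) : smf := Smf (introT (asboolP _) sf).

Definition smf_cst (a : R) : smf := to_smf (smooth_cst a).
Definition smf_coord i : smf := to_smf (smooth_coord i).
Definition smf_D i (f : smf) : smf := to_smf (smooth_tderiv i (smooth_smf f)).
Definition smf_ev (p : sphere R) (f : smf) : R := f p.
Definition smf_int (f : smf) : R := (\int[@area R]_p f p)%R.

Lemma smf_eq (f g : smf) : (forall p, f p = g p) -> f = g.
Proof. by move=> fg; apply: val_inj; apply/funext. Qed.

Lemma smf_cst_additive : additive smf_cst.
Proof. by move=> a b; apply: smf_eq. Qed.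
Lemma smf_cst_multiplicative : multiplicative smf_cst.
Proof. by split => [a b|]; apply: smf_eq. Qed.
HB.instance Definition _ := GRing.isAdditive.Build R smf smf_cst smf_cst_additive.
HB.instance Definition _ :=
  GRing.isMultiplicative.Build R smf smf_cst smf_cst_multiplicative.

Lemma smf_ev_additive p : additive (smf_ev p).
Proof. by []. Qed.
Lemma smf_ev_multiplicative p : multiplicative (smf_ev p).
Proof. by []. Qed.
HB.instance Definition _ p :=
  GRing.isAdditive.Build smf R (smf_ev p) (smf_ev_additive p).
HB.instance Definition _ p :=
  GRing.isMultiplicative.Build smf R (smf_ev p) (smf_ev_multiplicative p).

Lemma smf_ev_sum p (J : Type) (r : seq J) (F : J -> smf) :
  (\sum_(j <- r) F j) p = \sum_(j <- r) F j p.
Proof. exact: (raddf_sum (smf_ev p)). Qed.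

Lemma smf_DD i f g : smf_D i (f + g) = smf_D i f + smf_D i g.
Proof. by apply: smf_eq => p; apply: tderiv_add; exact: smooth_smf. Qed.

Lemma smf_DM i f g : smf_D i (f * g) = f * smf_D i g + g * smf_D i f.
Proof. by apply: smf_eq => p; apply: tderiv_mul; exact: smooth_smf. Qed.

Lemma smf_Dc i a : smf_D i (smf_cst a) = 0.
Proof. by apply: smf_eq => p; exact: tderiv_cst. Qed.

Lemma smf_DX i j : smf_D i (smf_coord j) = (i == j)%:R - smf_coord i * smf_coord j.
Proof.
apply: smf_eq => p; rewrite [LHS]tderiv_coord.
by case: (i == j).
Qed.

Lemma smf_XX : \sum_i smf_coord i * smf_coord i = 1.
Proof. by apply: smf_eq => p; rewrite smf_ev_sum; exact: dot_vec. Qed.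

Lemma smf_XD f : \sum_i smf_coord i * smf_D i f = 0.
Proof.
apply: smf_eq => p; rewrite smf_ev_sum.
by rewrite -[RHS](euler p (smooth_smf f)).
Qed.

Lemma integrable_smooth (f : sphere R -> R) : smooth f ->
  (@area R).-integrable setT (EFin \o f).
Proof.
move=> sf; have [M fM] := bounded_smooth sf.
apply: measurable_bounded_integrable => //; first exact: area_fin.
- exact: measurable_smooth.
- by exists M; split; [exact: num_real|move=> N MN p _; rewrite /= (le_trans (fM p))// ltW].
Qed.

Lemma integrable_smf (f : smf) : (@area R).-integrable setT (EFin \o f).
Proof. exact: integrable_smooth (smooth_smf f). Qed.

Lemma smf_intD f g : smf_int (f + g) = smf_int f + smf_int g.
Proof. by rewrite /smf_int -RintegralD//; exact: integrable_smf. Qed.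

Lemma smf_intZ a f : smf_int (smf_cst a * f) = a * smf_int f.
Proof. by rewrite /smf_int -RintegralZl//; exact: integrable_smf. Qed.

Lemma smf_int_ge0 f : (forall p, 0 <= smf_ev p f) -> 0 <= smf_int f.
Proof. by move=> f0; apply: Rintegral_ge0 => p _; exact: f0. Qed.

Lemma smf_int_D i f : smf_int (smf_D i f) = 2 * smf_int (smf_coord i * f).
Proof.
apply/eqP; rewrite -subr_eq0 -smf_intZ.
have -> : - smf_int (smf_cst 2 * (smf_coord i * f)) =
    smf_int (smf_cst (-1) * (smf_cst 2 * (smf_coord i * f))).
  by rewrite [RHS]smf_intZ mulN1r.
rewrite -smf_intD /smf_int /Rintegral.
have := integral_tderiv_eq0 i (smooth_smf f).
rewrite (_ : (fun p => _) = (EFin \o (smf_D i f + smf_cst (-1) *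
   (smf_cst 2 * (smf_coord i * f)) : smf))).
  by move=> ->.
by apply/funext => p /=; rewrite mulN1r.
Qed.

Lemma laplace_beltramiE (f : smf) p :
  laplace_beltrami f p = lap smf_D f p.
Proof.
rewrite /lap smf_ev_sum; apply: eq_bigr => i _.
rewrite /= /tderiv; congr (partial i (extend _) _).
by apply/funext => q; rewrite mxE.
Qed.

End smooth_ring.

(** * The space L^2 of the sphere *)

Section L2_space.
Context (R : realType).
Local Notation C := R[i].
Local Notation W := (sphere R -> Rcomplex R).
Local Notation mu := (@area R).
Implicit Types (f g : sphere R -> C).

Definition re f (p : sphere R) : R := complex.Re (f p).
Definition im f (p : sphere R) : R := complex.Im (f p).
Definition sqmod f (p : sphere R) : R := re f p ^+ 2 + im f p ^+ 2.

Lemma sqmod_ge0 f p : 0 <= sqmod f p.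
Proof. by rewrite addr_ge0// sqr_ge0. Qed.

Lemma L2normE f : L2norm f = ((\int[mu]_p (sqmod f p)%:E) `^ (2^-1))%E.
Proof.
rewrite /L2norm unlock; congr (_ `^ _)%E; apply: eq_integral => p _ /=.
rewrite ger0_norm; last by rewrite /Normc.normc; case: (f p) => x y; exact: sqrtr_ge0.
rewrite (powR_mulrn 2); last by rewrite /Normc.normc; case: (f p) => x y; exact: sqrtr_ge0.
rewrite /sqmod /re /im /Normc.normc; case: (f p) => x y /=.
by rewrite sqr_sqrtr// addr_ge0// sqr_ge0.
Qed.

Lemma measurable_sqmod f : measurable_fun setT (re f) -> measurable_fun setT (im f) ->
  measurable_fun setT (sqmod f).
Proof. by move=> mr mi; apply: measurable_funD; exact: measurable_funX. Qed.

Lemma L2P f : L2 f <-> [/\ measurable_fun setT (re f), measurable_fun setT (im f) &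
  mu.-integrable setT (EFin \o sqmod f)].
Proof.
have sf0 p : setT p -> (0 <= (sqmod f p)%:E)%E by rewrite lee_fin sqmod_ge0.
split=> -[mr mi h]; split => //.
  move: h; rewrite L2normE => h; apply/integrableP; split; first by apply/measurable_EFinP; exact: measurable_sqmod mr mi.
  rewrite (eq_integral (fun p => (sqmod f p)%:E)); last first.
    by move=> p _; rewrite /= ger0_norm ?sqmod_ge0.
  have : (0 <= \int[mu]_p (sqmod f p)%:E)%E by exact: integral_ge0.
  move: h; case: (\int[mu]_p _)%E => [r||]//; first by move=> *; rewrite ltry.
  by rewrite poweRyr// invr_eq0.
rewrite L2normE; move: h => /integrableP[_].
rewrite (eq_integral (fun p => (sqmod f p)%:E)); last first.
    by move=> p _; rewrite /= ger0_norm ?sqmod_ge0.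
exact: poweR_lty.
Qed.

Lemma L2_measurable_re f : L2 f -> measurable_fun setT (re f).
Proof. by case. Qed.
Lemma L2_measurable_im f : L2 f -> measurable_fun setT (im f).
Proof. by case. Qed.
Lemma L2_integrable f : L2 f -> mu.-integrable setT (EFin \o sqmod f).
Proof. by case/L2P. Qed.

Lemma integrable_le (f g : sphere R -> R) : measurable_fun setT f ->
  mu.-integrable setT (EFin \o g) -> (forall p, `|f p| <= g p) ->
  mu.-integrable setT (EFin \o f).
Proof.
move=> mf ig fg; apply: (le_integrable measurableT _ _ ig); first exact/measurable_EFinP.
by move=> p _; rewrite /= lee_fin (le_trans (fg p))// ler_norm.
Qed.

(** [Rcomplex R] makes the complex numbers a real vector space. The real structure suffices, since
    the real part of the hermitian product induces the same norm. *)
Definition L2_pred : {pred W} := fun f : W => `[< L2 (f : sphere R -> C) >].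

Lemma L2_submod_closed : submod_closed L2_pred.
Proof.
split.
  apply/asboolP/L2P; split; [exact: measurable_cst..|].
  rewrite (_ : EFin \o _ = cst 0%E); first exact: integrable0.
  by apply/funext => p; rewrite /= /sqmod /re /im /= expr0n/= addr0.
move=> a f g /asboolP Lf /asboolP Lg; apply/asboolP/L2P.
have reE : re (a *: f + g : W) = fun p => a * re f p + re g p.
  by apply/funext => p; rewrite /re [(_ + _) p]/(a *: f p + g p);
    case: (f p) (g p) => x y [x' y'].
have imE : im (a *: f + g : W) = fun p => a * im f p + im g p.
  by apply/funext => p; rewrite /im [(_ + _) p]/(a *: f p + g p);
    case: (f p) (g p) => x y [x' y'].
have mr : measurable_fun setT (re (a *: f + g : W)).
  rewrite reE; apply: measurable_funD; last exact: L2_measurable_re.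
  by apply: measurable_funM => //; exact: L2_measurable_re.
have mi : measurable_fun setT (im (a *: f + g : W)).
  rewrite imE; apply: measurable_funD; last exact: L2_measurable_im.
  by apply: measurable_funM => //; exact: L2_measurable_im.
split => //.
apply: (@integrable_le _ (fun p => 2 * a ^+ 2 * sqmod f p + 2 * sqmod g p)).
- exact: measurable_sqmod.
- rewrite (_ : EFin \o _ = (fun p => (2 * a ^+ 2)%:E * (sqmod f p)%:E +
     2%:E * (sqmod g p)%:E)%E); last by apply/funext => p.
  by apply: integrableD => //; apply: integrableZl => //; exact: L2_integrable.
- move=> p; rewrite ger0_norm ?sqmod_ge0// /sqmod reE imE.
  have := sqr_ge0 (a * re f p - re g p); have := sqr_ge0 (a * im f p - im g p).
  move: (re f p) (im f p) (re g p) (im g p) => x y z w; nra.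
Qed.

HB.instance Definition _ :=
  GRing.isSubmodClosed.Build R W L2_pred L2_submod_closed.

Record L2V := MkL2 { L2fun :> W; L2funP : L2fun \in L2_pred }.
HB.instance Definition _ := [isSub for L2fun].
HB.instance Definition _ := [Choice of L2V by <:].
HB.instance Definition _ := [SubChoice_isSubLmodule of L2V by <:].

Lemma L2V_L2 (f : L2V) : L2 (f : sphere R -> C).
Proof. exact/asboolP/L2funP. Qed.

Definition to_L2V f (Lf : L2 f) : L2V := MkL2 (introT (asboolP _) Lf : (f : W) \in L2_pred).

Definition inner f g : R := (\int[mu]_p (re f p * re g p + im f p * im g p))%R.

Lemma L2_inner_integrable f g : L2 f -> L2 g ->
  mu.-integrable setT (EFin \o (fun p => re f p * re g p + im f p * im g p)).
Proof.
move=> Lf Lg; apply: (@integrable_le _ (fun p => sqmod f p + sqmod g p)).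
- by apply: measurable_funD; apply: measurable_funM;
    solve [exact: L2_measurable_re|exact: L2_measurable_im].
- rewrite (_ : EFin \o _ = (fun p => (sqmod f p)%:E + (sqmod g p)%:E)%E) //.
  by apply: integrableD => //; exact: L2_integrable.
- move=> p; rewrite /sqmod ler_norml.
  move: (re f p) (im f p) (re g p) (im g p) => x y z w.
  have := sqr_ge0 (x + z); have := sqr_ge0 (y + w).
  have := sqr_ge0 (x - z); have := sqr_ge0 (y - w).
  have := sqr_ge0 x; have := sqr_ge0 y; have := sqr_ge0 z; have := sqr_ge0 w.
  by move=> *; apply/andP; split; lra.
Qed.

Definition L2_inner (f g : L2V) : R := inner f g.

Lemma L2_semi_inner : semi_inner L2_inner.
Proof.
split.
- by move=> f g; apply: eq_Rintegral => p _; rewrite mulrC [im _ _ * _]mulrC.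
- move=> a f g h; rewrite /L2_inner /inner -RintegralZl//; last first.
    exact: L2_inner_integrable (L2V_L2 f) (L2V_L2 h).
  rewrite -RintegralD//.
  + apply: eq_Rintegral => p _; rewrite /re /im [(_ + _ : L2V) p]/(a *: f p + g p).
    by case: (f p) (g p) (h p) => x y [x' y'] [x'' y'']/=; ring.
  + have := L2_inner_integrable (L2V_L2 f) (L2V_L2 h).
    by move=> /(@integrableZl _ _ _ _ _ measurableT a).
  + exact: L2_inner_integrable (L2V_L2 g) (L2V_L2 h).
- by move=> f; apply: Rintegral_ge0 => p _; rewrite -!expr2 addr_ge0// sqr_ge0.
Qed.

Lemma L2norm_inner f : L2 f -> L2norm f = (Num.sqrt (inner f f))%:E.
Proof.
move=> Lf; rewrite L2normE.
have i0 : (0 <= \int[mu]_p (sqmod f p)%:E)%E.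
  by apply: integral_ge0 => p _; rewrite lee_fin sqmod_ge0.
have ifin : (\int[mu]_p (sqmod f p)%:E)%E \is a fin_num.
  exact: integrable_fin_num (L2_integrable Lf).
by rewrite -(fineK ifin) poweR_EFin powR12_sqrt ?fine_ge0.
Qed.

Lemma L2norm_nm (f : L2V) : L2norm (f : sphere R -> C) = (nm L2_inner f)%:E.
Proof. exact: L2norm_inner (L2V_L2 f). Qed.

End L2_space.

(** * Density of smooth functions in L^2 *)

Section smooth_dense.
Import HBNNSimple.
Context (R : realType).
Local Notation mu := (@area R).
Implicit Types f g h : sphere R -> R.

(** Distances are kept squared to stay with plain integrals; the triangle inequality then costs a
    factor 2, hence the [e / 4] below. *)
Definition approximable f := measurable_fun setT f /\
  forall e : R, 0 < e -> exists2 g, smooth g &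
    (\int[mu]_p ((g p - f p) ^+ 2)%:E < e%:E)%E.

Lemma measurable_sqr_sub f g : measurable_fun setT f -> measurable_fun setT g ->
  measurable_fun setT (fun p => ((f p - g p) ^+ 2)%:E).
Proof.
move=> mf mg; apply/measurable_EFinP; apply: measurable_funX.
exact: measurable_funB.
Qed.

Lemma integral_sqr_tri f g h (a b : R) : measurable_fun setT f ->
  measurable_fun setT g -> measurable_fun setT h ->
  (\int[mu]_p ((f p - g p) ^+ 2)%:E < a%:E)%E ->
  (\int[mu]_p ((g p - h p) ^+ 2)%:E < b%:E)%E ->
  (\int[mu]_p ((f p - h p) ^+ 2)%:E < (2 * (a + b))%:E)%E.
Proof.
move=> mf mg mh fa gb.
have mfg := measurable_sqr_sub mf mg; have mgh := measurable_sqr_sub mg mh.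
have ge0 (u : sphere R -> R) p : setT p -> (0 <= (u p ^+ 2)%:E)%E.
  by move=> _; rewrite lee_fin sqr_ge0.
have h0 p : setT p -> (0 <= ((f p - g p) ^+ 2)%:E + ((g p - h p) ^+ 2)%:E)%E.
  by move=> _; rewrite adde_ge0 ?lee_fin ?sqr_ge0.
have mD := emeasurable_funD mfg mgh.
apply: (@le_lt_trans _ _ (\int[mu]_p (2%:E *
    (((f p - g p) ^+ 2)%:E + ((g p - h p) ^+ 2)%:E)))%E).
  apply: ge0_le_integral => //.
  - by move=> p _; rewrite lee_fin sqr_ge0.
  - exact: (measurable_sqr_sub mf mh).
  - by apply: measurable_funeM.
  - move=> p _; rewrite -EFinD -EFinM lee_fin.
    have := sqr_ge0 (f p - g p - (g p - h p)); move: (f p) (g p) (h p) => x y z; nra.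
rewrite ge0_integralZl//.
rewrite ge0_integralD//; [|exact: (ge0 (fun p => f p - g p))|exact: (ge0 (fun p => g p - h p))].
rewrite EFinM lte_pmul2l// EFinD.
by apply: lteD.
Qed.

Lemma approximable_trans f : measurable_fun setT f ->
  (forall e : R, 0 < e -> exists2 g, approximable g &
    (\int[mu]_p ((g p - f p) ^+ 2)%:E < e%:E)%E) -> approximable f.
Proof.
move=> mf H; split => // e e0.
have e4 : 0 < e / 4 by rewrite divr_gt0.
have [g [mg /(_ _ e4)[h sh hg]] gf] := H _ e4.
exists h => //; have := integral_sqr_tri (measurable_smooth sh) mg mf hg gf.
by rewrite (_ : 2 * (e / 4 + e / 4) = e)//; field.
Qed.

Lemma approximable_smooth f : smooth f -> approximable f.
Proof.
move=> sf; split; first exact: measurable_smooth.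
move=> e e0; exists f => //; rewrite (eq_integral (cst 0%E)).
  by rewrite integral0 lte_fin.
by move=> p _; rewrite subrr expr0n.
Qed.

Lemma approximable_lin (a : R) f g : approximable f -> approximable g ->
  approximable (fun p => a * f p + g p).
Proof.
move=> [mf af] [mg ag]; split.
  by apply: measurable_funD => //; exact: measurable_funM.
(* A positive bound for [a ^+ 2], also when [a = 0]. *)
move=> e e0; pose b := a ^+ 2 + 1.
have b0 : 0 < b by rewrite ltr_wpDl// sqr_ge0.
have [|f' sf' ff'] := af (e / 4 / b); first by rewrite !divr_gt0.
have [|g' sg' gg'] := ag (e / 4); first by rewrite divr_gt0.
have saf : smooth (fun p => a * f' p) by apply: smooth_mul => //; exact: smooth_cst.
exists (fun p => a * f' p + g' p); first exact: smooth_add.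
have maf : measurable_fun setT (fun p => a * f p) by exact: measurable_funM.
have mf' := measurable_smooth sf'; have mg' := measurable_smooth sg'.
have m1 : measurable_fun setT (fun p => a * f' p + g' p) by apply: measurable_funD => //; exact: measurable_smooth.
have m2 : measurable_fun setT (fun p => a * f p + g' p) by exact: measurable_funD.
have m3 : measurable_fun setT (fun p => a * f p + g p) by exact: measurable_funD.
rewrite (_ : e%:E = (2 * (e / 4 + e / 4))%:E); last by congr (_%:E); field.
apply: integral_sqr_tri m1 m2 m3 _ _; last first.
  rewrite (eq_integral (fun p => ((g' p - g p) ^+ 2)%:E))//.
  by move=> p _; congr (_ ^+ 2)%:E; ring.
rewrite (eq_integral (fun p => (a ^+ 2)%:E * ((f' p - f p) ^+ 2)%:E)%E); last first.
  by move=> p _; rewrite -EFinM; congr (_%:E); ring.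
rewrite ge0_integralZl//; first last.
- by rewrite lee_fin sqr_ge0.
- by move=> p _; rewrite lee_fin sqr_ge0.
- exact: (measurable_sqr_sub mf' mf).
rewrite (_ : (e / 4)%:E = b%:E * (e / 4 / b)%:E)%E; last first.
  by rewrite -EFinM; congr (_%:E); field; rewrite gt_eqF.
apply: (@le_lt_trans _ _ (b%:E * \int[mu]_p ((f' p - f p) ^+ 2)%:E)%E).
  apply: lee_wpmul2r; first by apply: integral_ge0 => p _; rewrite lee_fin sqr_ge0.
  by rewrite lee_fin lerDl.
by rewrite lte_pmul2l// lte_fin.
Qed.

(** Dominated convergence for the squared differences, with majorant [4 g^2]. *)
Lemma approximable_cvg (f_ : nat -> sphere R -> R) f g :
  (forall n, approximable (f_ n)) -> measurable_fun setT f ->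
  (forall p, f_ n p @[n --> \oo] --> f p) -> (forall n p, `|f_ n p| <= g p) ->
  mu.-integrable setT (fun p => (g p ^+ 2)%:E) -> approximable f.
Proof.
move=> af mf cf fg ig; apply: (approximable_trans mf) => e e0.
have mf_ n : measurable_fun setT (f_ n) by case: (af n).
have fgl p : `|f p| <= g p.
  by apply: (@cvgr_to_le _ _ _ _ _ _ _ (cvg_norm (cf p))); near=> n; exact: fg.
have [||||//|_ _] := @dominated_convergence _ _ R mu setT measurableT
  (fun n p => ((f_ n p - f p) ^+ 2)%:E) (cst 0%E) (fun p => 4%:E * (g p ^+ 2)%:E)%E.
- by move=> n; exact: (measurable_sqr_sub (mf_ n) mf).
- exact: measurable_cst.
- apply: aeW => p _; apply: cvg_EFin; first by near=> n.
  have c0 : f_ n p - f p @[n --> \oo] --> (0 : R).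
    by rewrite -(subrr (f p)); apply: cvgB => //; exact: cvg_cst.
  rewrite (_ : fine \o _ = fun n => (f_ n p - f p) * (f_ n p - f p)) -?[X in _ --> X](mulr0 (0 : R)).
    exact: cvgM.
  by apply/funext => n /=; rewrite expr2.
- exact: integrableZl.
- apply: aeW => p n _ /=; rewrite -EFinM lee_fin ger0_norm ?sqr_ge0//.
  have := fg n p; have := fgl p; rewrite !ler_norml.
  move: (f p) (f_ n p) (g p) => x y z /andP[? ?] /andP[? ?]; nra.
rewrite integral0 => /fine_cvgP[nf cf0].
have [n [nfin nlt]] : exists n, (\int[mu]_p ((f_ n p - f p) ^+ 2)%:E)%E \is a fin_num /\
    fine (\int[mu]_p ((f_ n p - f p) ^+ 2)%:E)%E < e.
  near \oo => n; exists n; split; first by near: n.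
  near: n; exact: (cvgr_lt (0 : R)).
by exists (f_ n) => //; rewrite -(fineK nfin) lte_fin.
Unshelve. all: by end_near. Qed.

(** A logistic step centred at [1 / n] with slope parameter [n ^ 2]: the moving centre makes the
    limit at [y = 0] equal to [0], as for the indicator of [0 < y]. *)
Definition smooth_step (n : nat) (y : R) : R := (1 + expR (n%:R - n%:R ^+ 2 * y : R))^-1.

Lemma smooth_step_gt0 n y : 0 < smooth_step n y.
Proof. by rewrite invr_gt0 addr_gt0// expR_gt0. Qed.

Lemma smooth_step_le1 n y : smooth_step n y <= 1.
Proof. by rewrite invf_le1 ?addr_gt0 ?expR_gt0// lerDl ltW// expR_gt0. Qed.

Lemma smooth_smooth_step n f : smooth f -> smooth (fun p => smooth_step n (f p)).
Proof.
move=> sf; apply: smooth_inv.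
  by move=> p; rewrite gt_eqF// addr_gt0// expR_gt0.
apply: smooth_add; first exact: smooth_cst.
apply: smooth_exp; apply: smooth_add; first exact: smooth_cst.
rewrite (_ : (fun p => _) = fun p => (- n%:R ^+ 2) * f p).
  by apply: smooth_mul => //; exact: smooth_cst.
by apply/funext => p; rewrite mulNr.
Qed.

Lemma cvg_smooth_step (y : R) : smooth_step n y @[n --> \oo] --> ((0 < y)%R%:R : R).
Proof.
have e1 n : 1 + n%:R <= expR n%:R :> R by exact: expR_ge1Dx.
have h0 := @cvg_harmonic R.
case: (ltP 0 y) => /= y0.
  have h1 : 1 - harmonic n @[n --> \oo] --> (1 : R).
    by rewrite -[X in _ --> X]subr0; apply: cvgB => //; exact: cvg_cst.
  apply: (@squeeze_cvgr _ _ _ _ (fun n => 1 - harmonic n) (cst 1)); [|exact: h1|exact: cvg_cst].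
  near=> n; rewrite smooth_step_le1 andbT.
  (* Then the exponent [n - n (n y)] is at most [- n]. *)
  have ny : 2 <= n%:R * y.
    rewrite -ler_pdivrMr//; near: n; exact: nbhs_infty_ger.
  rewrite /smooth_step /harmonic /=.
  set z := expR _; have z0 : 0 < z := expR_gt0 _.
  have zn : z <= expR (- n%:R).
    rewrite ler_expR; have : 0 <= n%:R :> R by []; move: (n%:R : R) ny => x; nra.
  have {zn} zn : z <= (1 + n%:R)^-1.
    by rewrite (le_trans zn)// expRN lef_pV2 ?posrE ?expR_gt0// ltr_wpDr.
  rewrite -natr1 [_ + 1]addrC; apply: (@le_trans _ _ (1 - z)); first by rewrite lerB.
  by rewrite -[_^-1]mul1r ler_pdivlMr ?addr_gt0//; nra.
apply: (@squeeze_cvgr _ _ _ _ (cst 0) harmonic); [|exact: cvg_cst|exact: h0].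
near=> n; rewrite ltW ?smooth_step_gt0//=.
rewrite /smooth_step /harmonic/= lef_pV2 ?posrE ?addr_gt0 ?expR_gt0// -natr1 addrC.
rewrite lerD2l (le_trans _ (_ : expR n%:R <= _))//.
  by rewrite (le_trans _ (e1 n))// lerDr.
by rewrite ler_expR lerDl oppr_ge0 mulr_ge0_le0// sqr_ge0.
Unshelve. all: by end_near. Qed.

Lemma smooth_prod n (F : 'I_n -> sphere R -> R) : (forall i, smooth (F i)) ->
  smooth (fun p => \prod_(i < n) F i p).
Proof.
elim: n F => [|n IH] F sF.
  rewrite (_ : (fun p => _) = fun=> 1); first exact: smooth_cst.
  by apply/funext => p; rewrite big_ord0.
rewrite (_ : (fun p => _) = fun p => F ord0 p * \prod_(i < n) F (lift ord0 i) p).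
  by apply: smooth_mul => //; exact: IH.
by apply/funext => p; rewrite big_ord_recl.
Qed.

Lemma integrable_cst (a : R) : mu.-integrable setT (fun=> a%:E).
Proof. exact: (integrable_smooth (smooth_cst a)). Qed.

(** A pi-system generating the Borel sets, whose indicators are limits of products of smooth
    steps. *)
Definition orthant (a : 'I_3 -> R) : set (sphere R) :=
  [set p | forall i, a i < coord i p].

Lemma orthantE a : orthant a = \bigcap_(i in [set: 'I_3]) (@coord R i @^-1` `]a i, +oo[).
Proof.
apply/seteqP; split => p /= h i; first by move=> _ /=; rewrite in_itv /= h.
by have := h i; rewrite /= in_itv /= andbT; exact.
Qed.

Lemma measurable_orthant a : measurable (orthant a).
Proof.
rewrite orthantE; apply: fin_bigcap_measurable; first exact: finite_finset.
by move=> i _; rewrite -[X in measurable X]setTI; exact: measurable_coord.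
Qed.

Lemma approximable_orthant a : approximable (\1_(orthant a)).
Proof.
apply: (@approximable_cvg (fun n p => \prod_(i < 3) smooth_step n (coord i p - a i)) _ (cst 1)).
- move=> n; apply: approximable_smooth; apply: smooth_prod => i.
  apply: smooth_smooth_step; apply: smooth_add; [exact: smooth_coord|exact: smooth_cst].
- exact: measurable_indic (measurable_orthant a).
- move=> p; rewrite (_ : \1_(orthant a) p = \prod_(i < 3) ((0 < coord i p - a i)%R%:R : R)).
    apply: cvg_big; first exact: mul_continuous.
    by move=> i _; exact: cvg_smooth_step.
  rewrite indicE; case: (boolP (p \in orthant a)).
    by rewrite inE => h; rewrite big1// => i _; rewrite subr_gt0 h.
  rewrite notin_setE => /existsNP[i /negP h].
  by rewrite (bigD1 i)//= subr_gt0 (negbTE h) mul0r.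
- move=> n p; rewrite ger0_norm ?prodr_ge0//; last by move=> i _; exact/ltW/smooth_step_gt0.
  by apply: prodr_ile1 => i _; rewrite smooth_step_le1 ltW// smooth_step_gt0.
- rewrite /= expr1n; exact: integrable_cst.
Qed.

Definition approximable_sets : set (set (sphere R)) :=
  [set A | measurable A /\ approximable (\1_A)].

Lemma lambda_approximable_sets : lambda_system setT approximable_sets.
Proof.
split => //.
- split => //; apply: approximable_smooth; rewrite indicT; exact: smooth_cst.
- move=> A B BA [mA aA] [mB aB]; split; first exact: measurableD.
  have := approximable_lin (-1) aB aA; congr approximable; apply/funext => p.
  rewrite !indicE in_setD mulN1r.
  case: (boolP (p \in B)) => pB; first by rewrite (mem_set (BA _ (set_mem pB))) andbF addNr.
  by rewrite andbT oppr0 add0r.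
- move=> F ndF aF; have mU : measurable (\bigcup_n F n).
    by apply: bigcup_measurable => n _; case: (aF n).
  split => //; apply: (@approximable_cvg (fun n => \1_(F n)) _ (cst 1)).
  + by move=> n; case: (aF n).
  + exact: measurable_indic.
  + move=> p; rewrite [X in _ --> X]indicE; case: (boolP (p \in _)) => [|pF].
      rewrite inE => -[m _ Fmp]; apply: cvg_near_cst; near=> n.
      have mn : (m <= n)%N by near: n; exact: nbhs_infty_ge.
      by move/subsetPset : (ndF _ _ mn) => /(_ _ Fmp) Fnp; rewrite indicE mem_set.
    apply: cvg_near_cst; near=> n; rewrite indicE memNset// => Fnp.
    by move: pF; rewrite notin_setE; apply; exists n.
  + by move=> n p; rewrite indicE; case: (_ \in _); rewrite ?normr1 ?normr0.
  + rewrite /= expr1n; exact: integrable_cst.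
Unshelve. all: by end_near. Qed.

Definition orthants : set (set (sphere R)) := [set orthant a | a in setT].

Lemma setI_closed_orthants : setI_closed orthants.
Proof.
move=> _ _ [a _ <-] [b _ <-]; exists (fun i => Num.max (a i) (b i)) => //.
apply/seteqP; split => p /= => [h|[h1 h2] i]; last by rewrite gt_max h1 h2.
by split => i; have := h i; rewrite gt_max => /andP[].
Qed.

Lemma coord_ge_m1 i (p : sphere R) : -1 <= coord i p.
Proof.
have : coord i p ^+ 2 <= 1.
  rewrite -(dot_vec p) /dot (bigD1 i)//= expr2 lerDl.
  by apply: sumr_ge0 => j _; rewrite -expr2 sqr_ge0.
by move: (coord i p) => x; nra.
Qed.

Lemma sub_gen_orthants : @measurable _ (sphere R) `<=` <<s orthants >>.
Proof.
apply: smallest_sub; first exact: smallest_sigma_algebra.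
rewrite -bigcup_mkord_ord; apply: bigcup_sub => /= i' _ A [B mB <-]; rewrite setTI; move: (inord i') => i.
have h : @measurable _ (measurableTypeR R) `<=` image_set_system [set: sphere R] (@coord R i) <<s orthants >>.
  rewrite [X in X `<=` _](_ : _ = <<s @RGenOInfty.G R>>); last exact: RGenOInfty.measurableE.
  apply: smallest_sub; first exact/sigma_algebra_image/smallest_sigma_algebra.
  move=> _ [x ->]; rewrite /image_set_system /= setTI.
  (* Coordinates are at least -1, so the bound -2 imposes nothing on the other two, and a half-space
     in one coordinate is an orthant. *)
  apply: sub_sigma_algebra; exists (fun j => if j == i then x else -2) => //.
  apply/seteqP; split => p /=.
    by move=> /(_ i); rewrite eqxx in_itv/= andbT.
  rewrite in_itv/= andbT => xp j; case: eqP => [->//|_].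
  by apply: lt_le_trans (coord_ge_m1 j p); rewrite ltrN2 ltr1n.
by have := h _ mB; rewrite /image_set_system/= setTI.
Qed.

(** Dynkin's pi-lambda theorem, from the orthants to all Borel sets. *)
Lemma approximable_indic A : measurable A -> approximable (\1_A).
Proof.
move=> /sub_gen_orthants.
have h := @lambda_system_subset _ _ setI_closed_orthants _ _ lambda_approximable_sets.
have /h{}h : orthants `<=` approximable_sets.
  by move=> _ [a _ <-]; split; [exact: measurable_orthant|exact: approximable_orthant].
by move=> /h[//|].
Qed.

Lemma approximable_sum n (c : 'I_n -> R) (A : 'I_n -> set (sphere R)) :
  (forall i, measurable (A i)) -> approximable (fun p => \sum_(i < n) c i * \1_(A i) p).
Proof.
elim: n c A => [|n IH] c A mA.
  rewrite (_ : (fun p => _) = fun=> 0); first by apply: approximable_smooth; exact: smooth_cst.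
  by apply/funext => p; rewrite big_ord0.
rewrite (_ : (fun p => _) = fun p => c ord0 * \1_(A ord0) p +
    \sum_(i < n) c (lift ord0 i) * \1_(A (lift ord0 i)) p).
  by apply: approximable_lin; [exact: approximable_indic|exact: IH].
by apply/funext => p; rewrite big_ord_recl.
Qed.

(** Simple functions increase to [f], so [f] itself is the square integrable majorant. *)
Lemma approximable_ge0 f : measurable_fun setT f -> (forall p, 0 <= f p) ->
  mu.-integrable setT (fun p => (f p ^+ 2)%:E) -> approximable f.
Proof.
move=> mf f0 if2; have mf' : measurable_fun setT (EFin \o f) by exact/measurable_EFinP.
have f0' p : setT p -> (0 <= (EFin \o f) p)%E by rewrite lee_fin f0.
pose f_ := nnsfun_approx measurableT mf'.
have cf p : f_ n p @[n --> \oo] --> f p.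
  by have /fine_cvgP[_] := cvg_nnsfun_approx measurableT mf' f0' (I : setT p).
apply: (@approximable_cvg f_ _ f _ mf cf _ if2).
  move=> n; rewrite (funext (fimfunEord (f_ n))).
  by apply: approximable_sum => i; exact: measurable_sfunP.
move=> n p; rewrite ger0_norm//.
have nd : {homo (fun n => f_ n p) : n m / (n <= m)%N >-> n <= m}.
  by move=> a b ab; have /asboolP := nd_nnsfun_approx measurableT mf' ab; exact.
have := nondecreasing_cvgn_le nd _ n; rewrite (cvg_lim _ (cf p))//; apply.
exact: cf.
Qed.

Lemma smooth_dense f : measurable_fun setT f ->
  mu.-integrable setT (fun p => (f p ^+ 2)%:E) -> approximable f.
Proof.
move=> mf if2; have mn : measurable_fun setT (fun p => `|f p|) by exact: measurableT_comp.
have h1 : approximable (fun p => `|f p|).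
  apply: approximable_ge0 => //; rewrite (_ : (fun p => _) = fun p => (f p ^+ 2)%:E)//.
  by apply/funext => p; rewrite real_normK// num_real.
(* [f] is the difference of the nonnegative functions [|f|] and [|f| - f]; the square of the latter
   is at most [4 f^2]. *)
have h2 : approximable (fun p => `|f p| - f p).
  apply: approximable_ge0; first exact: measurable_funB.
    by move=> p; rewrite subr_ge0 ler_norm.
  have i4 : mu.-integrable setT (EFin \o (fun p => 4 * f p ^+ 2)).
    have := @integrableZl _ _ _ mu _ measurableT 4 _ if2.
    by congr (integrable _ _ _).
  apply: (integrable_le _ i4); first by apply: measurable_funX; exact: measurable_funB.
  move=> p; rewrite ger0_norm ?sqr_ge0//.
  have := real_normK (num_real (f p)); have := ler_norm (f p); have := normr_ge0 (f p).
  by have := ler_norm (- f p); rewrite normrN; move: `|f p| (f p) => x y; nra.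
have := approximable_lin (-1) h2 h1; congr approximable; apply/funext => p.
by rewrite mulN1r opprB subrK.
Qed.

End smooth_dense.

(** * The advection-diffusion semigroup *)

Section lift.
Context (R : realType).
Local Notation C := R[i].
Local Notation V := (L2V R).
Local Notation mu := (@area R).
Local Notation ip := (@L2_inner R).
Local Notation nm := (nm ip).
Let ipP : semi_inner ip := @L2_semi_inner R.

(** The default [0] is never met along the semigroup, which preserves [L2] for nonnegative times. *)
Definition lift (g : sphere R -> C) : V :=
  if pselect (L2 g) is left h then to_L2V h else 0.

Lemma liftE g : L2 g -> (lift g : sphere R -> C) = g.
Proof. by move=> h; rewrite /lift; case: pselect. Qed.

Lemma L2V_eq (x y : V) : (forall p, re x p = re y p /\ im x p = im y p) -> x = y.
Proof.
move=> h; apply: val_inj; apply/funext => p; have := h p; rewrite /re /im /=.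
by case: (L2fun x p) (L2fun y p) => a b [a' b'] [/= -> ->].
Qed.

Lemma re_lin (a : R) (x y : V) p : re (a *: x + y : V) p = a * re x p + re y p.
Proof.
by rewrite /re [(_ + _ : V) p]/(a *: x p + y p); case: (x p) (y p) => ? ? [? ?].
Qed.

Lemma im_lin (a : R) (x y : V) p : im (a *: x + y : V) p = a * im x p + im y p.
Proof.
by rewrite /im [(_ + _ : V) p]/(a *: x p + y p); case: (x p) (y p) => ? ? [? ?].
Qed.

Lemma reB (x y : V) p : re (x - y : V) p = re x p - re y p.
Proof. by rewrite -[x]scale1r (re_lin 1 x) scale1r mul1r -scaleN1r -[_ *: y]addr0 re_lin mulN1r [re 0 p]/(0) addr0. Qed.

Lemma imB (x y : V) p : im (x - y : V) p = im x p - im y p.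
Proof. by rewrite -[x]scale1r (im_lin 1 x) scale1r mul1r -scaleN1r -[_ *: y]addr0 im_lin mulN1r [im 0 p]/(0) addr0. Qed.

Lemma L2V_subE (x y : V) : (x - y : V) = (fun p => x p - y p : C) :> (sphere R -> C).
Proof.
apply/funext => p; have := reB x y p; have := imB x y p; rewrite /re /im.
by case: ((x - y : V) p) (x p) (y p) => a b [a' b'] [a'' b''] /= -> ->.
Qed.

Lemma L2V_linE (a : R) (x y : V) :
  (a *: x + y : V) = (fun p => a%:C%C * x p + y p : C) :> (sphere R -> C).
Proof.
apply/funext => p; have := re_lin a x y p; have := im_lin a x y p; rewrite /re /im.
case: ((_ + _ : V) p) (x p) (y p) => s t [a' b'] [a'' b''] /= -> ->.
by congr (_ +i* _)%C; rewrite /= !mul0r ?subr0 ?add0r ?addr0.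
Qed.

Lemma nm_L2norm (x y : V) : L2norm (fun p => x p - y p : C) = (nm (x - y))%:E.
Proof. by rewrite -L2norm_nm L2V_subE. Qed.

Lemma eqL2_nm (x y : V) : eqL2 x y -> nm (x - y) = 0.
Proof.
move=> xy; apply: EFin_inj; rewrite -L2norm_nm L2normE.
rewrite (@ae_eq_integral _ _ _ mu setT (cst 0%E) _ measurableT)//.
- by rewrite integral0 poweR0r// invr_neq0.
- apply/measurable_EFinP; apply: measurable_sqmod;
    [exact: L2_measurable_re (L2V_L2 _)|exact: L2_measurable_im (L2V_L2 _)].
- case: xy => A [mA A0 sA]; exists A; split => // p /= h.
  apply: sA => /= xyp; apply: h => _; rewrite /sqmod reB imB /re /im xyp !subrr.
  by rewrite expr0n/= addr0.
Qed.

Lemma cvg_EFin0 (T : Type) (F : set_system T) (FF : Filter F) (f : T -> R) (g : T -> \bar R) :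
  (\forall x \near F, g x = (f x)%:E) -> (f x @[x --> F] --> 0) <-> (g x @[x --> F] --> 0%E).
Proof.
move=> fg; split => h.
  apply: cvg_EFin; first by apply: filterS fg => x ->.
  apply: cvg_trans h; apply: near_eq_cvg; apply: filterS fg => x /= ->//.
have /fine_cvgP[_] := h; apply: cvg_trans; apply: near_eq_cvg.
by apply: filterS fg => x /= ->.
Qed.

Context (T : R -> (sphere R -> C) -> (sphere R -> C)) (TP : C0_semigroup T).

Definition lift_semigroup (t : R) (x : V) : V := lift (T t x).

Lemma lift_semigroupE t x : 0 <= t -> (lift_semigroup t x : sphere R -> C) = T t x.
Proof. by move=> t0; rewrite liftE//; apply: (semigroup_L2 TP) => //; exact: L2V_L2. Qed.

Lemma semigroup_lift : semigroup ip lift_semigroup.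
Proof.
split.
- move=> t a x y t0; apply: eqL2_nm; rewrite lift_semigroupE//.
  have := semigroup_linear TP a%:C%C t0 (L2V_L2 x) (L2V_L2 y).
  by rewrite L2V_linE -L2V_linE -!(lift_semigroupE _ t0) L2V_linE.
- move=> t t0; have [M hM] := semigroup_bounded TP t0; exists M => x.
  have := hM _ (L2V_L2 x); rewrite -(lift_semigroupE _ t0) !L2norm_nm.
  by rewrite -EFinM lee_fin.
- by move=> x; apply: eqL2_nm; rewrite lift_semigroupE//; exact: semigroup_0 (L2V_L2 x).
- move=> s t x s0 t0; apply: eqL2_nm; rewrite !lift_semigroupE ?addr_ge0//.
  exact: (semigroup_add TP) (L2V_L2 x).
- move=> x.
  have h : (nm (lift_semigroup h x - x) @[h --> 0^'+] --> 0) <->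
     (L2norm (fun p => T h x p - x p) @[h --> 0^'+] --> 0%E).
    apply: cvg_EFin0; near=> h; have h0 : 0 <= h by near: h; exact: nbhs_right_ge.
    by rewrite -lift_semigroupE// nm_L2norm.
  exact/h/(semigroup_continuous TP)/L2V_L2.
Unshelve. all: by end_near. Qed.

Lemma gen_lift x y : gen ip lift_semigroup x y <-> generator_graph T x y.
Proof.
have h : (nm (h^-1 *: (lift_semigroup h x - x) - y) @[h --> 0^'+] --> 0) <->
   (L2norm (fun p => (h^-1)%:C%C * (T h x p - x p) - y p) @[h --> 0^'+] --> 0%E).
  apply: cvg_EFin0; near=> h; have h0 : 0 <= h by near: h; exact: nbhs_right_ge.
  rewrite -lift_semigroupE//.
  rewrite -nm_L2norm; congr L2norm; apply/funext => p; congr (_ - _).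
  rewrite -[h^-1 *: _]addr0 L2V_linE [(0 : V) p]/(0) addr0.
  by congr (_ * _); rewrite L2V_subE.
split; first by move/h => ?; split => //; exact: L2V_L2.
by case=> _ _ /h.
Unshelve. all: by end_near. Qed.

End lift.

(** * Smooth vectors and bounded multiplication operators *)

Section smooth_vectors.
Context (R : realType).
Local Notation C := R[i].
Local Notation V := (L2V R).
Local Notation mu := (@area R).
Local Notation ip := (@L2_inner R).
Local Notation nm := (nm ip).
Let ipP : semi_inner ip := @L2_semi_inner R.
Implicit Types a b h : smf R.

Lemma L2_complex a b : L2 (fun p => a p +i* b p)%C.
Proof.
apply/L2P; split; [exact: measurable_smooth (smooth_smf a)|exact: measurable_smooth (smooth_smf b)|].
exact: (integrable_smf (a * a + b * b)).
Qed.

Definition csm a b : V := to_L2V (L2_complex a b).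

Lemma csmB a b a' b' : csm (a - a') (b - b') = csm a b - csm a' b'.
Proof. by apply: L2V_eq => p; rewrite reB imB. Qed.

(** Makes differential operators total on [L2V]; the default [0] is not reached on smooth
    vectors. *)
Definition smf_of (f : sphere R -> R) : smf R :=
  if pselect (smooth f) is left h then to_smf h else 0.

Lemma smf_ofE a : smf_of a = a.
Proof.
rewrite /smf_of; case: pselect => [h|/(_ (smooth_smf a))//].
exact: smf_eq.
Qed.

Definition smre (x : V) : smf R := smf_of (re x).
Definition smim (x : V) : smf R := smf_of (im x).

Lemma smre_csm a b : smre (csm a b) = a. Proof. exact: smf_ofE. Qed.
Lemma smim_csm a b : smim (csm a b) = b. Proof. exact: smf_ofE. Qed.

Definition smooth_vec (x : V) : Prop := csmooth (x : sphere R -> C).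

Lemma smooth_vecP x : smooth_vec x -> exists a b, x = csm a b.
Proof. by move=> [sr si]; exists (to_smf sr), (to_smf si); exact: L2V_eq. Qed.

Lemma smooth_csm a b : smooth_vec (csm a b).
Proof. by split; exact: smooth_smf. Qed.

Section multiplication.
Context (h1 h2 : smf R).

(** Multiplication by the complex function [h1 + i h2]. *)
Definition cmul_fun (x : V) (p : sphere R) : C :=
  ((h1 p * re x p - h2 p * im x p) +i* (h1 p * im x p + h2 p * re x p))%C.

Lemma re_cmul x p : re (cmul_fun x) p = h1 p * re x p - h2 p * im x p.
Proof. by []. Qed.

Lemma im_cmul x p : im (cmul_fun x) p = h1 p * im x p + h2 p * re x p.
Proof. by []. Qed.

Lemma sqmod_cmul : exists2 K : R, 0 <= K &
  forall x p, sqmod (cmul_fun x) p <= K * sqmod x p.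
Proof.
have [K hK] := bounded_smooth (smooth_smf (h1 * h1 + h2 * h2)).
exists K; first by rewrite (le_trans _ (hK (point : sphere R))).
move=> x p; rewrite (_ : sqmod _ p = (h1 * h1 + h2 * h2) p * sqmod x p).
  by rewrite ler_wpM2r ?sqmod_ge0// (le_trans (ler_norm _) (hK p)).
have -> : (h1 * h1 + h2 * h2) p = h1 p * h1 p + h2 p * h2 p by [].
rewrite /sqmod re_cmul im_cmul; move: (h1 p) (h2 p) (re x p) (im x p) => s t y z; ring.
Qed.

Lemma L2_cmul x : L2 (cmul_fun x).
Proof.
have Lx := L2V_L2 x; have mr := L2_measurable_re Lx; have mi := L2_measurable_im Lx.
have mh1 := measurable_smooth (smooth_smf h1).
have mh2 := measurable_smooth (smooth_smf h2).
have m1 : measurable_fun setT (re (cmul_fun x)).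
  by apply: measurable_funB; exact: measurable_funM.
have m2 : measurable_fun setT (im (cmul_fun x)).
  by apply: measurable_funD; exact: measurable_funM.
apply/L2P; split => //.
have [K K0 hK] := sqmod_cmul.
apply: (@integrable_le _ _ (fun p => K * sqmod x p)).
- exact: measurable_sqmod.
- exact: (integrableZl measurableT K (L2_integrable Lx)).
- by move=> p; rewrite ger0_norm ?sqmod_ge0.
Qed.

Definition cmul (x : V) : V := to_L2V (L2_cmul x).

Lemma cmulB x y : cmul (x - y) = cmul x - cmul y.
Proof.
apply: L2V_eq => p; rewrite reB imB /cmul /=.
rewrite !re_cmul !im_cmul !reB !imB.
by move: (h1 p) (h2 p) (re x p) (im x p) => s t r i; split; ring.
Qed.

Lemma nm_cmul : exists2 K : R, 0 <= K & forall x, nm (cmul x) <= K * nm x.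
Proof.
have [K K0 hK] := sqmod_cmul; exists (Num.sqrt K); first exact: sqrtr_ge0.
move=> x; rewrite /nm -sqrtrM//; apply: ler_wsqrtr.
have ix := L2_integrable (L2V_L2 x).
have ic := L2_integrable (L2V_L2 (cmul x)).
rewrite /L2_inner /inner -RintegralZl//.
apply: le_Rintegral => //.
  exact: (integrableZl measurableT K ix).
by move=> p _; exact: hK.
Qed.

Lemma cmul_csm a b : cmul (csm a b) = csm (h1 * a - h2 * b) (h1 * b + h2 * a).
Proof. exact: L2V_eq. Qed.

Lemma cmul_cvg (J : Type) (F : set_system J) (FF : Filter F) (X : J -> V) x :
  nm (X i - x) @[i --> F] --> 0 -> nm (cmul (X i) - cmul x) @[i --> F] --> 0.
Proof.
move=> Xx; have [K K0 hK] := nm_cmul.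
apply: (@squeeze_cvgr _ _ _ _ (cst 0) (fun i => K * nm (X i - x))).
- by apply: nearW => i; rewrite nm_ge0 -cmulB hK.
- exact: cvg_cst.
- by rewrite -[X in _ --> X](mulr0 K); exact: cvgMl_tmp.
Qed.

End multiplication.

Lemma dense_smooth_vec (x : V) (e : R) : 0 < e -> exists2 y, smooth_vec y & nm (y - x) < e.
Proof.
move=> e0; have Lx := L2V_L2 x; have mr := L2_measurable_re Lx; have mi := L2_measurable_im Lx.
have sq_le (f : sphere R -> R) : measurable_fun setT f -> (forall p, f p ^+ 2 <= sqmod x p) ->
    mu.-integrable setT (fun p => (f p ^+ 2)%:E).
  move=> mf fx; apply: (integrable_le _ (L2_integrable Lx)); first exact: measurable_funX.
  by move=> p; rewrite ger0_norm ?sqr_ge0.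
(* Half of the squared distance for the real part and half for the imaginary part. *)
have e2 : 0 < e ^+ 2 / 2 by rewrite divr_gt0// exprn_gt0.
have [_ /(_ _ e2)[a sa ha]] : approximable (re x).
  by apply: smooth_dense => //; apply: sq_le => // p; rewrite lerDl sqr_ge0.
have [_ /(_ _ e2)[b sb hb]] : approximable (im x).
  by apply: smooth_dense => //; apply: sq_le => // p; rewrite lerDr sqr_ge0.
exists (csm (to_smf sa) (to_smf sb)); first exact: smooth_csm.
have eE : Num.sqrt (e ^+ 2) = e by rewrite sqrtr_sqr gtr0_norm.
rewrite -[ltRHS]eE /nm ltr_sqrt ?exprn_gt0//.
set y := csm _ _; have iy := L2_integrable (L2V_L2 (y - x)).
rewrite -lte_fin /L2_inner /inner /Rintegral fineK; last exact: (integrable_fin_num measurableT iy).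
rewrite (_ : e ^+ 2 = e ^+ 2 / 2 + e ^+ 2 / 2); last by field.
rewrite EFinD (eq_integral (fun p => ((a p - re x p) ^+ 2)%:E + ((b p - im x p) ^+ 2)%:E)%E).
  rewrite ge0_integralD//.
  - exact: lteD.
  - by move=> p _; rewrite lee_fin sqr_ge0.
  - exact: (measurable_sqr_sub (measurable_smooth sa) mr).
  - by move=> p _; rewrite lee_fin sqr_ge0.
  - exact: (measurable_sqr_sub (measurable_smooth sb) mi).
by move=> p _; rewrite -EFinD reB imB !expr2.
Qed.

End smooth_vectors.

(** * The advection-diffusion operator and its energy *)

Section advection_diffusion_operator.
Context (R : realType) (k : sphere R) (m : R) (m0 : 0 < m) (m1 : m <= 1)
  (e : R) (e0 : 0 < e) (e1 : 576 * e <= 1).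
Local Notation C := R[i].
Local Notation V := (L2V R).
Local Notation ip := (@L2_inner R).
Local Notation nm := (nm ip).
Local Notation smf := (smf R).
Local Notation cst := (@smf_cst R : {rmorphism R -> smf}).
Local Notation D := (@smf_D R).
Local Notation X := (@smf_coord R).
Local Notation I := (@smf_int R).
Local Notation kc := (fun i => coord i k).
Local Notation nu := (m ^+ 2).
Local Notation u := (height cst X kc).
Local Notation w := (shear cst X kc).
Local Notation ad := (advection_diffusion cst D X kc nu).
Local Notation mult := (multiplier_op cst D X kc).
Let ipP : semi_inner ip := @L2_semi_inner R.
Implicit Types (a b : smf) (x y : V).

Let DD := @smf_DD R.
Let DM := @smf_DM R.
Let Dc := @smf_Dc R.
Let DX := @smf_DX R.
Let XX := @smf_XX R.
Let XD := @smf_XD R.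
Let ID := @smf_intD R.
Let IC := @smf_intZ R.
Let IBP := @smf_int_D R.
Let I_ge0 := @smf_int_ge0 R.
Let kk : \sum_i kc i * kc i = 1 := dot_vec k.
Let evc (p : sphere R) (a : R) : smf_ev p (cst a) = a. Proof. by []. Qed.

Definition of_pair (z : smf * smf) : V := csm z.1 z.2.
Definition generator (x : V) : V := of_pair (ad (smre x) (smim x)).
Definition multiplier_at (j : 'I_4) (x : V) : V := of_pair (mult j (smre x) (smim x)).

(* On smooth vectors this is [ip (multiplier_at j x) x]; trading the derivatives of
   [x] for [y = generator x] makes the form continuous for the graph norm. *)
Definition graph_form (j : 'I_4) (x y : V) : R :=
  match val j with
  | 0 => ip x x
  | 1 => - (ip y x / nu)
  | 2 => - ((ip (cmul 0 u x) y + ip (cmul 0 u x) (cmul 0 u x)) / nu)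
  | _ => ip (cmul w 0 x) x
  end.

Lemma generator_csm a b : generator (csm a b) = of_pair (ad a b).
Proof. by rewrite /generator smre_csm smim_csm. Qed.

Lemma multiplier_csm j a b : multiplier_at j (csm a b) = of_pair (mult j a b).
Proof. by rewrite /multiplier_at smre_csm smim_csm. Qed.

Lemma heightE p : u p = dot k p.
Proof. by rewrite /height smf_ev_sum. Qed.

Lemma re_of_pair z p : re (of_pair z) p = z.1 p. Proof. by []. Qed.
Lemma im_of_pair z p : im (of_pair z) p = z.2 p. Proof. by []. Qed.

Lemma smf_evMDM (a b a' b' : smf) p : (a * b + a' * b') p = a p * b p + a' p * b' p.
Proof. by []. Qed.

Lemma smf_evNMDM (a b a' b' : smf) p : (- (a * b) + a' * b') p = - (a p * b p) + a' p * b' p.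
Proof. by []. Qed.

Lemma L1_csm a b : L1 k nu (csm a b : sphere R -> C) = (of_pair (ad a b) : sphere R -> C).
Proof.
apply/funext => p.
have hr := re_of_pair (ad a b) p; have hi := im_of_pair (ad a b) p.
rewrite smf_evMDM -laplace_beltramiE heightE in hr.
rewrite smf_evNMDM -laplace_beltramiE heightE in hi.
move: hr hi; rewrite /re /im /L1 /claplace_beltrami.
case: (of_pair _ p) => x y /= -> ->.
move: (laplace_beltrami a p) (laplace_beltrami b p) (dot k p) (a p) (b p) => r s t v z.
by congr (_ +i* _)%C; ring.
Qed.

Lemma smooth_vecB x y : smooth_vec x -> smooth_vec y -> smooth_vec (x - y).
Proof.
move=> /smooth_vecP[a [b ->]] /smooth_vecP[a' [b' ->]].
by rewrite -csmB; exact: smooth_csm.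
Qed.

Lemma generatorB x y : smooth_vec x -> smooth_vec y ->
  generator (x - y) = generator x - generator y.
Proof.
move=> /smooth_vecP[a [b ->]] /smooth_vecP[a' [b' ->]].
by rewrite -csmB !generator_csm (advection_diffusion_sub cst X DD)// -csmB.
Qed.

Lemma multiplier_atB j x y : smooth_vec x -> smooth_vec y ->
  multiplier_at j (x - y) = multiplier_at j x - multiplier_at j y.
Proof.
move=> /smooth_vecP[a [b ->]] /smooth_vecP[a' [b' ->]].
by rewrite -csmB !multiplier_csm (multiplier_op_sub cst X DD)// -csmB.
Qed.

Lemma multiplier_atC j x y : smooth_vec x -> smooth_vec y ->
  ip (multiplier_at j x) y = ip (multiplier_at j y) x.
Proof.
move=> /smooth_vecP[a [b ->]] /smooth_vecP[a' [b' ->]].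
rewrite !multiplier_csm.
exact: (pairing_sym (c := cst) DD DM Dc DX XX XD ID IC IBP).
Qed.

Lemma graph_form_continuous j : form_continuous ip (graph_form j).
Proof.
move=> J F FF x y a b xa yb; rewrite /graph_form; case: (val j) => [|[|[|_]]].
- exact: ip_cvg.
- by apply: cvgN; apply: cvgMr_tmp; exact: ip_cvg.
- apply: cvgN; apply: cvgMr_tmp; apply: cvgD; apply: ip_cvg => //; exact: cmul_cvg.
- by apply: ip_cvg => //; exact: cmul_cvg.
Qed.

Lemma graph_form_generator j x : smooth_vec x ->
  graph_form j x (generator x) = ip (multiplier_at j x) x.
Proof.
move=> /smooth_vecP[a [b ->]]; rewrite generator_csm multiplier_csm.
have nu0 : nu != 0 by rewrite expf_neq0// gt_eqF.
case: j => [[|[|[|[|//]]]] j4]; rewrite /graph_form /=.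
- by [].
- rewrite -mulNr; apply: (mulIf nu0); rewrite divfK//.
  rewrite (_ : ip _ _ = pairing I (ad a b) (a, b))//.
  rewrite (pairing_mass DM XD ID IC IBP) opprK mulrC; congr (_ * _).
  exact/esym/(I_lap_form DM XD ID IBP).
- rewrite -mulNr; apply: (mulIf nu0); rewrite divfK//.
  rewrite !cmul_csm !mul0r sub0r add0r.
  have := pairing_skew (c := cst) DM XD ID IC IBP kc nu a b.
  rewrite -[X in _ + X = _]/(ip (csm (- (u * b)) (u * a)) (csm (- (u * b)) (u * a))).
  rewrite -[X in X + _ = _]/(ip (csm (- (u * b)) (u * a)) (of_pair (ad a b))) => ->.
  rewrite opprK mulrC; congr (_ * _); exact/esym/I_cross_form.
- by rewrite cmul_csm !mul0r subr0 addr0.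
Qed.

Lemma csmD a b a' b' : csm (a + a') (b + b') = csm a b + csm a' b'.
Proof.
apply: L2V_eq => p; rewrite -[csm a b]scale1r re_lin im_lin !mul1r.
by [].
Qed.

Lemma csmZ (r : R) a b : csm (cst r * a) (cst r * b) = r *: csm a b.
Proof.
by apply: L2V_eq => p; rewrite -[r *: _]addr0 re_lin im_lin [re 0 p]/(0) [im 0 p]/(0) !addr0.
Qed.

(** Solving the definition of the operator for the Laplacian bounds it by the graph norm, at the
    price of the factor [nu^-1]. *)
Lemma multiplier1E x : smooth_vec x ->
  multiplier_at (inord 1) x = (- nu^-1) *: (generator x + cmul 0 u x).
Proof.
move=> /smooth_vecP[a [b ->]]; rewrite multiplier_csm generator_csm inordK//.
rewrite cmul_csm !mul0r sub0r add0r (@lap_advection_diffusion _ _ cst D X kc nu a b)//.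
  by rewrite /of_pair [_.1]/= [_.2 in LHS]/= csmZ csmD.
by rewrite expf_neq0// gt_eqF.
Qed.

(** Constants may depend on [nu]: they only control remainders that vanish in the limit of small
    time steps. *)
Lemma multiplier_at_bounded j : exists2 K : R, 0 <= K &
  forall x, smooth_vec x -> nm (multiplier_at j x) <= K * (nm x + nm (generator x)).
Proof.
have [K1 K10 hK1] : exists2 K : R, 0 <= K & forall x, smooth_vec x ->
    nm (multiplier_at (inord 1) x) <= K * (nm x + nm (generator x)).
  have [K K0 hK] := nm_cmul 0 u.
  exists (nu^-1 * (1 + K)); first by rewrite mulr_ge0 ?invr_ge0 ?sqr_ge0 ?addr_ge0.
  move=> x Sx; rewrite multiplier1E// nmZ// normrN ger0_norm ?invr_ge0 ?sqr_ge0//.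
  rewrite -mulrA ler_wpM2l ?invr_ge0 ?sqr_ge0//.
  rewrite (le_trans (nmD ipP _ _))// (le_trans (lerD (lexx _) (hK x)))//.
  have := nm_ge0 ip x; have := nm_ge0 ip (generator x).
  by move: (nm x) (nm _) => s t; nra.
have [Ku Ku0 hKu] := nm_cmul 0 u.
have [Kw Kw0 hKw] := nm_cmul w 0.
case: j => [[|[|[|[|//]]]] j4].
- exists 1 => // x /smooth_vecP[a [b ->]]; rewrite multiplier_csm mul1r.
  by rewrite [of_pair _]/(csm a b) lerDl nm_ge0.
- have -> : Ordinal j4 = inord 1 by apply: val_inj; rewrite /= inordK.
  by exists K1.
- exists (1 + K1 + Ku); first by rewrite !addr_ge0.
  move=> x Sx; have hx := hK1 x Sx; have hu := hKu x.
  move: (Sx) => /smooth_vecP[a [b xE]].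
  rewrite xE in hx hu *; move: hx hu; rewrite !multiplier_csm inordK// => hx hu.
  have -> : of_pair (mult 2 a b) = csm (slope cst D X kc b) (- slope cst D X kc a) +
     cmul 0 u (csm a b).
    by rewrite cmul_csm !mul0r sub0r add0r -csmD [- _ + u * a]addrC.
  set y := csm (slope _ _ _ _ b) _.
  (* The square of the left side is at most the squared gradient norm, which is the pairing of
     [- lap] with the vector itself and hence at most the product of the two norms on the right. *)
  have hy : nm y <= nm (of_pair (mult 1 a b)) + nm (csm a b).
    rewrite -ler_sqr ?nnegrE ?addr_ge0 ?nm_ge0// sqr_nm//.
    apply: (@le_trans _ _ (ip (of_pair (mult 1 a b)) (csm a b))).
      rewrite -[leRHS]/(I (- lap D a * a + - lap D b * b)) (I_lap_form DM XD ID IBP).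
      exact: (@I_slopes_le _ _ cst D X I DD DM Dc DX XX ID kc kk _
        (fun p => smf_ev p : {rmorphism smf -> R}) I_ge0 a b).
    have := ler_ip ipP (of_pair (mult 1 a b)) (csm a b).
    have := nm_ge0 ip (csm a b); have := nm_ge0 ip (of_pair (mult 1 a b)).
    by move: (nm _) (nm (csm a b)) (ip _ _) => s t r; nra.
  rewrite (le_trans (nmD ipP _ _))//.
  have := nm_ge0 ip (csm a b); have := nm_ge0 ip (generator (csm a b)).
  move: hx hu hy; move: (nm y) (nm (cmul _ _ _)) (nm (of_pair _)) (nm (csm a b)) (nm _).
  by move=> n1 n2 n3 n4 n5; nra.
- exists Kw => // x /smooth_vecP[a [b xE]].
  have -> : multiplier_at (Ordinal j4) x = cmul w 0 x.
    by rewrite xE multiplier_csm cmul_csm !mul0r subr0 addr0.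
  by rewrite (le_trans (hKw x))// ler_wpM2l// lerDl nm_ge0.
Qed.

(* With [t] of order [1 / m] the four terms of the energy are of the same order. The
   cross term is absorbed because [(6 / 2) ^ 2 < 36 * 1], and a small [e] lets the
   dissipation of the mass absorb the growth of the gradient term. *)
Definition weight (j : nat) : R :=
  [:: 1; 36 * e * m ^+ 2; 6 * e * m ^+ 2; e * m ^+ 2]`_j.

Local Notation wt := (fun j : 'I_4 => weight j).

Definition form_value (j : nat) a b : R :=
  match j with
  | 0 => I (mass a b)
  | 1 => I (gradsq D a b)
  | 2 => I (cross cst D X kc a b)
  | _ => I (w * mass a b)
  end.

Lemma ip_multiplier j a b : ip (of_pair (mult j a b)) (csm a b) = form_value j a b.
Proof.
case: j => [|[|[|j]]].
- by [].
- exact: (I_lap_form DM XD ID IBP).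
- exact: I_cross_form.
- by rewrite /form_value /mass mulrDr !mulrA.
Qed.

Lemma sum_ord4 (F : nat -> R) : \sum_(j < 4) F j = F 0%N + F 1%N + F 2%N + F 3%N.
Proof. by rewrite !big_ord_recl big_ord0 addr0 !addrA. Qed.

Lemma graph_form_csm (j : 'I_4) a b :
  graph_form j (csm a b) (generator (csm a b)) = form_value j a b.
Proof.
by rewrite graph_form_generator ?multiplier_csm ?ip_multiplier//; exact: smooth_csm.
Qed.

Lemma energy_csm t a b :
  energy wt graph_form t (csm a b) (generator (csm a b)) =
  I (mass a b) + 36 * e * m ^+ 2 * t * I (gradsq D a b) +
  6 * e * m ^+ 2 * t ^+ 2 * I (cross cst D X kc a b) +
  e * m ^+ 2 * t ^+ 3 * I (w * mass a b).
Proof.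
rewrite /energy; under eq_bigr do rewrite graph_form_csm.
by rewrite (sum_ord4 (fun j => weight j * t ^+ j * form_value j a b)) !mul1r.
Qed.

Let ev (p : sphere R) : {rmorphism smf -> R} := smf_ev p.
Local Notation energy := (energy wt graph_form).
Local Notation denergy := (denergy wt graph_form).
Local Notation multiplier := (multiplier wt multiplier_at).

Lemma energy_dissipation t x : 0 <= t -> t <= m^-1 -> smooth_vec x ->
  2 * ip (multiplier t x) (generator x) + denergy t x (generator x) <= 0.
Proof.
move=> t0 tm /smooth_vecP[a [b ->]].
have mt : m * t <= 1 by rewrite mulrC -ler_pdivlMr// div1r.
pose G j := ip (of_pair (mult j a b)) (of_pair (ad a b)).
have : 2 * (G 0%N + 36 * e * m ^+ 2 * t * G 1%N + 6 * e * m ^+ 2 * t ^+ 2 * G 2%N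
    + e * m ^+ 2 * t ^+ 3 * G 3%N) + (36 * e * m ^+ 2 * form_value 1 a b
    + 12 * e * m ^+ 2 * t * form_value 2 a b
    + 3 * e * m ^+ 2 * t ^+ 2 * form_value 3 a b) <= 0.
  exact: (@I_dissipation _ _ cst D X I DD DM Dc DX XX XD ID IC IBP kc kk _ ev evc I_ge0
    a b e (ltW e0) e1 m m0 m1 t t0 mt).
rewrite /denergy /multiplier (ip_suml ipP).
under eq_bigr do rewrite (ipZl ipP) multiplier_csm generator_csm.
under [X in _ -> _ + X <= _]eq_bigr do rewrite graph_form_csm.
rewrite (sum_ord4 (fun j => weight j * t ^+ j * G j)).
rewrite (sum_ord4 (fun j => weight j * (j%:R * t ^+ j.-1) * form_value j a b)).
rewrite /weight [_`_0]/= [_`_1]/= [_`_2]/= [_`_3]/= !expr0 !expr1.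
move: (G 0%N) (G 1%N) (G 2%N) (G 3%N) => g0 g1 g2 g3.
move: (form_value 0 a b) (form_value 1 a b) (form_value 2 a b) (form_value 3 a b).
move=> f0 f1 f2 f3; congr (_ <= 0); ring.
Qed.

Lemma energy_initial x : smooth_vec x -> energy 0 x (generator x) <= ip x x.
Proof.
move=> /smooth_vecP[a [b ->]]; rewrite energy_csm mulr0 !expr0n !mulr0 !mul0r !addr0.
by [].
Qed.

Lemma energy_lower t x : 0 <= t -> smooth_vec x -> ip x x <= energy t x (generator x).
Proof.
move=> t0 /smooth_vecP[a [b ->]]; rewrite energy_csm.
exact: (@I_energy_ge _ _ cst D X I DD DM Dc DX XX ID IC kc kk _ ev evc I_ge0
  a b e (ltW e0) m t t0).
Qed.

Lemma energy_final x : smooth_vec x ->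
  (1 + e / 4) * ip x x <= energy m^-1 x (generator x).
Proof.
move=> /smooth_vecP[a [b ->]]; rewrite energy_csm.
exact: (@I_energy_gain _ _ cst D X I DD DM Dc DX XX XD ID IC IBP kc kk _ ev evc I_ge0
  a b e (ltW e0) m m0 m1).
Qed.

Context (T : R -> (sphere R -> C) -> (sphere R -> C)) (TP : is_exp (L1 k nu) T).

(** One inclusion of [is_exp]: the generator lies in the closure of [L1] on smooth functions. *)
Lemma gen_core x y : gen ip (lift_semigroup T) x y -> exists phi : nat -> V,
  [/\ forall n, smooth_vec (phi n), nm (phi n - x) @[n --> \oo] --> 0 &
      nm (generator (phi n) - y) @[n --> \oo] --> 0].
Proof.
have [T0 TG] := TP; move=> /(gen_lift T0) /TG[_ _ [phi [sphi px py]]].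
pose psi n : V := csm (to_smf (sphi n).1) (to_smf (sphi n).2).
have psiE n : (psi n : sphere R -> C) = phi n.
  by apply/funext => p; rewrite /=; case: (phi n p).
exists psi; split.
- by move=> n; exact: smooth_csm.
- apply/cvg_EFin0; last exact: px.
  by apply: nearW => n; rewrite -nm_L2norm psiE.
- apply/cvg_EFin0; last exact: py.
  apply: nearW => n; rewrite -nm_L2norm -psiE L1_csm.
  by rewrite generator_csm.
Qed.

(** The other inclusion of [is_exp], for a constant sequence of smooth functions. *)
Lemma core_gen x : smooth_vec x -> gen ip (lift_semigroup T) x (generator x).
Proof.
move=> Sx; have [T0 TG] := TP; apply/(gen_lift T0)/TG; split; [exact: L2V_L2..|].
exists (fun=> x); split => //.
  rewrite nm_L2norm subrr (nm0 ipP); exact: cvg_cst.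
move: Sx => /smooth_vecP[a [b ->]].
rewrite L1_csm -generator_csm nm_L2norm subrr (nm0 ipP); exact: cvg_cst.
Qed.

Lemma lift_semigroup_decay t x : 0 <= t ->
  nm (lift_semigroup T t x) <= Num.sqrt (1 + e / 4) *
    expR (- (ln (Num.sqrt (1 + e / 4)) * t / m^-1)) * nm x.
Proof.
have tau0 : 0 < m^-1 by rewrite invr_gt0.
have kappa0 : 0 < e / 4 by rewrite divr_gt0.
have lower s y : 0 <= s -> s <= m^-1 -> smooth_vec y -> ip y y <= energy s y (generator y).
  by move=> s0 _; exact: energy_lower.
move=> t0; have := @sg_decay _ _ ip ipP _ (semigroup_lift TP.1) (@smooth_vec R) generator
  smooth_vecB generatorB gen_core core_gen (@dense_smooth_vec R) _ wt graph_form
  multiplier_at graph_form_continuous graph_form_generator multiplier_atB multiplier_atC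
  multiplier_at_bounded m^-1 (e / 4) tau0 kappa0 energy_dissipation energy_initial lower
  energy_final t x t0.
exact.
Qed.

End advection_diffusion_operator.

Theorem proposition1p6 (R : realType) :
  exists C0 eps0 nu0 : R, [/\ 0 < C0, 0 < eps0, 0 < nu0 &
    forall (k : sphere R) (nu : R), 0 < nu -> nu < nu0 ->
    forall expL : R -> (sphere R -> R[i]) -> (sphere R -> R[i]),
      is_exp (L1 k nu) expL ->
    forall psi_in : sphere R -> R[i], L2 psi_in ->
    forall t : R, 0 <= t ->
      (L2norm (expL t psi_in) <=
         (C0 * expR (- (eps0 * nu `^ (1 / 2) * t)))%:E * L2norm psi_in)%E].
Proof.
have inv_ex (c : R) : 0 < c -> exists e : R, 0 < e /\ c * e <= 1.
  by move=> c0; exists c^-1; rewrite invr_gt0 mulfV ?gt_eqF.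
(* The smallness required by the pointwise dissipation estimate. *)
have [e [e0 e1]] := inv_ex 576 (ltr0Sn _ _).
pose C0 : R := Num.sqrt (1 + e / 4).
have C1 : 1 < C0 by rewrite -[ltLHS]sqrtr1 ltr_sqrt ?ltrDl ?ltr_wpDr ?divr_gt0// ltW// divr_gt0.
exists C0, (ln C0), 1; split => //; first exact: lt_trans C1.
  exact: ln_gt0.
move=> k nu nu0 nu1 T TP psi Lpsi t t0.
(* The time step is [1 / m], so the rate is [ln C0] times [m]; [nu < 1] gives [m <= 1]. *)
pose m := Num.sqrt nu; have m0 : 0 < m by rewrite sqrtr_gt0.
have nuE : nu = m ^+ 2 by rewrite sqr_sqrtr// ltW.
have m1 : m <= 1 by rewrite -sqrtr1 ler_sqrt// ltW.
have T0 := TP.1; rewrite nuE in TP.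
have := lift_semigroup_decay m0 m1 e0 e1 TP (lift psi) t0.
rewrite -lee_fin EFinM -!L2norm_nm (lift_semigroupE T0)// liftE//.
rewrite invrK mul1r (powR12_sqrt (ltW nu0)) -/m -/C0 [_ * t * m]mulrAC.
exact.
Qed.
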